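(* Let $\xi(t)$, $t\geq0$, be a time-stable process. Then $\xi$ is identically distributed (in the sense of finite-dimensional distributions) as the sum of a deterministic linear function $t\mapsto bt$ (for some $b\in\mathbb{R}$), a centred Gaussian process with covariance function $C(t,s)$ satisfying $C(ut,us)=uC(t,s)$ for all $t,s,u\geq0$, and an independent time-stable process without Gaussian component.
   Context: For a process $\eta$ on $[0,\infty)$ and $a>0$, $(a\circ\eta)(t)=\eta(at)$. A stochastically continuous real-valued process $\xi(t)$, $t\geq0$, is called time-stable if for each integer $n\geq2$, $\xi_1+\cdots+\xi_n$ and $n\circ\xi$ have the same finite-dimensional distributions, where $\xi_1,\dots,\xi_n$ are i.i.d. copies of $\xi$. Such a process is infinitely divisible; ''without Gaussian component'' means its finite-dimensional (infinitely divisible) distributions have zero Gaussian part in their L\'evy--Khintchine triplets. *)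

(* Defs.v *)
From HB Require Import structures.
From mathcomp Require Import all_boot all_order all_algebra.
From mathcomp Require Import all_classical all_reals all_analysis.
Set Implicit Arguments. Unset Strict Implicit. Unset Printing Implicit Defensive.
Import Order.TTheory GRing.Theory Num.Theory.
Import numFieldNormedType.Exports.
Local Open Scope classical_set_scope.
Local Open Scope ring_scope.

Section Defs.
Context {R : realType}.

(* A real-valued process indexed by time; only times t >= 0 matter. *)
Definition process (T : Type) := R -> T -> R.

Definition is_process d (T : measurableType d) (X : process T) :=
  forall t : R, 0 <= t -> measurable_fun [set: T] (X t).

Definition Pr d (T : measurableType d) (P : probability T R) (A : set T) : R :=
  fine (P A).

Definition nonneg_times n (t : n.-tuple R) := forall i : 'I_n, 0 <= tnth t i.

Definition fdvec T n (X : process T) (t : n.-tuple R) : T -> n.-tuple R :=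
  fun w => [tuple X (tnth t i) w | i < n].

Definition fdd_eq d1 (T1 : measurableType d1) (P1 : probability T1 R)
  (X1 : process T1) d2 (T2 : measurableType d2) (P2 : probability T2 R)
  (X2 : process T2) :=
  forall n (t : n.-tuple R), nonneg_times t ->
  forall A : set (n.-tuple R), measurable A ->
    P1 (fdvec X1 t @^-1` A) = P2 (fdvec X2 t @^-1` A).

Definition tscale T (a : R) (X : process T) : process T :=
  fun t w => X (a * t) w.

(* Mutual independence of the processes X_1, ..., X_m (on a common space):
   product rule on the generating finite-dimensional cylinder events. *)
Definition indep_processes d (T : measurableType d) (P : probability T R)
  m (X : 'I_m -> process T) :=
  forall n (t : n.-tuple R), nonneg_times t ->
  forall A : 'I_m -> set (n.-tuple R), (forall i, measurable (A i)) ->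
    Pr P (\bigcap_(i in [set: 'I_m]) (fdvec (X i) t @^-1` A i)) =
    \prod_(i < m) Pr P (fdvec (X i) t @^-1` A i).

Definition indep2 d (T : measurableType d) (P : probability T R)
  (X Y : process T) :=
  forall n (t : n.-tuple R), nonneg_times t ->
  forall A B : set (n.-tuple R), measurable A -> measurable B ->
    Pr P (fdvec X t @^-1` A `&` fdvec Y t @^-1` B) =
    Pr P (fdvec X t @^-1` A) * Pr P (fdvec Y t @^-1` B).

Definition stoch_continuous d (T : measurableType d) (P : probability T R)
  (X : process T) :=
  forall t : R, 0 <= t -> forall eps : R, 0 < eps -> forall delta : R, 0 < delta ->
    exists eta : R, 0 < eta /\
      forall s : R, 0 <= s -> `|s - t| < eta ->
        Pr P [set w | eps < `|X s w - X t w|] < delta.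

Definition time_stable d (T : measurableType d) (P : probability T R)
  (X : process T) :=
  is_process X /\ stoch_continuous P X /\
  forall n : nat, (2 <= n)%N ->
  forall d' (T' : measurableType d') (P' : probability T' R)
         (Xs : 'I_n -> process T'),
    (forall i, is_process (Xs i)) ->
    (forall i, fdd_eq P' (Xs i) P X) ->
    indep_processes P' Xs ->
    fdd_eq P' (fun t w => \sum_(i < n) Xs i t w) P (tscale n%:R X).

Definition dot n (x y : n.-tuple R) : R := \sum_(i < n) tnth x i * tnth y i.
Definition sqnorm n (x : n.-tuple R) : R := dot x x.
Definition quad n (S : 'M[R]_n) (x : n.-tuple R) : R :=
  \sum_(i < n) \sum_(j < n) tnth x i * S i j * tnth x j.

Definition levy_measure n (nu : {measure set (n.-tuple R) -> \bar R}) :=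
  nu [set [tuple (0:R) | _ < n]] = 0%E /\
  (\int[nu]_x (Num.min 1 (sqnorm x))%:E < +oo)%E.

(* The random vector V : T -> R^n has Levy--Khintchine triplet (a, S, nu):
   its characteristic function is
   E exp(i<th,V>) = exp( i<th,a> - 1/2 th'S th
              + int (e^{i<th,x>} - 1 - i<th,x> 1_{|x|<=1}) nu(dx) ),
   written out in real and imaginary parts. *)
Definition LK_triplet d (T : measurableType d) (P : probability T R) n
  (V : T -> n.-tuple R) (a : n.-tuple R) (S : 'M[R]_n)
  (nu : {measure set (n.-tuple R) -> \bar R}) :=
  levy_measure nu /\ S^T = S /\ (forall th, 0 <= quad S th) /\
  forall th : n.-tuple R,
    let A := - (quad S th / 2) +
             Rintegral nu [set: n.-tuple R] (fun x => cos (dot th x) - 1) in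
    let B := dot th a +
             Rintegral nu [set: n.-tuple R]
               (fun x => sin (dot th x) -
                         dot th x * (if sqnorm x <= 1 then 1 else 0)) in
    Rintegral P [set: T] (fun w => cos (dot th (V w))) = expR A * cos B /\
    Rintegral P [set: T] (fun w => sin (dot th (V w))) = expR A * sin B.

Definition no_gaussian_component d (T : measurableType d)
  (P : probability T R) (X : process T) :=
  forall n (t : n.-tuple R), nonneg_times t ->
    exists (a : n.-tuple R) (nu : {measure set (n.-tuple R) -> \bar R}),
      LK_triplet P (fdvec X t) a 0 nu.

(* Centred Gaussian process with covariance function C: the characteristic
   function of each (G(t_1),...,G(t_n)) is exp(-1/2 sum th_i th_j C(t_i,t_j)). *)
Definition centred_gaussian d (T : measurableType d) (P : probability T R)
  (G : process T) (C : R -> R -> R) :=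
  forall n (t : n.-tuple R), nonneg_times t ->
  forall th : n.-tuple R,
    let q := \sum_(i < n) \sum_(j < n)
               tnth th i * tnth th j * C (tnth t i) (tnth t j) in
    Rintegral P [set: T] (fun w => cos (dot th (fdvec G t w))) = expR (- (q / 2)) /\
    Rintegral P [set: T] (fun w => sin (dot th (fdvec G t w))) = 0.

End Defs.

(* Main.v *)
Require Import Defs.
From HB Require Import structures.
From mathcomp Require Import all_boot all_order all_algebra.
From mathcomp Require Import all_classical all_reals all_analysis.
From mathcomp Require Import measurable_realfun complex.
From mathcomp Require Import ring lra.
Set Implicit Arguments. Unset Strict Implicit. Unset Printing Implicit Defensive.
Import Order.TTheory GRing.Theory Num.Theory.
Import numFieldNormedType.Exports.
Local Open Scope classical_set_scope.
Local Open Scope ring_scope.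

(* Time-stability says that the characteristic function [phi] of a finite
   family of values at times [t_i] satisfies [phi (n t) = phi (t) ^ n], so
   [Hlog = ln |phi|] is homogeneous of degree one in time and the vector at time
   [t] has the law of a sum of [2 ^ k] independent copies of the vector at time
   [t / 2 ^ k].  Along an ultrafilter in [k], the measures
   [2 ^ k E[rho (D_k); D_k in .]], with [rho = min (1, |x|^2)], converge (on a Loeb
   space); this yields the Levy-Khintchine form
   [phi = exp (- Q / 2 + jump part)] with [Q] quadratic.

   Since [Q l = lim - 2 Hlog (n l) / n ^ 2], [Q] inherits the homogeneity of [Hlog]
   in time, and polarising it gives the covariance.  Both [exp (- Q / 2)] and
   [phi exp (Q / 2)] are tight limits of characteristic functions of processes:
   of scaled symmetrised increments of [xi] for the former, of sums of
   independent soft-thresholded increments for the latter.  Such limits are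
   again characteristic functions of processes, realised on a Loeb space, which
   replaces the Kolmogorov extension and Prokhorov theorems.  The two processes
   on the product space give the decomposition. *)

(** * Integration of bounded functions *)

(** The measures [2 ^ k P (D_k in .)] have mass [2 ^ k], piling up at the origin; hence the weight
    [rho]. That the weighted masses stay bounded is the main quantitative input. It comes from the
    factorisation of [z ^ N - 1] in [small_time], without complex logarithms.

    On the Loeb space the weighted mass of infinitesimal increments sits where the limit vector [Y]
    is [0], and there the limit of [f / rho] is not determined by [Y]. Only integrands that are
    [o (|x|^2)] pass to the limit. What a second-order integrand loses at the origin is [Q]: the
    limiting truncated covariance minus its jump share, nonnegative because mass can only be lost.

    Dividing a Gaussian factor out of [phi] need not leave a characteristic function. Soft
    thresholding makes the integrands vanish near the origin without breaking continuity, so no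
    quadratic term arises; dominated convergence, as the threshold tends to [0], recovers the
    quotient.

    A single free ultrafilter serves all tuples of times, so drifts and covariances defined as
    limits are consistent between tuples. The drift is left inside the jump process, which is why
    the linear term is taken with [b = 0]. *)

Section superlevel_sets.
Variables (R : realType) (d : measure_display) (T : measurableType d) (f : T -> R).
Hypothesis mf : measurable_fun setT f.

Lemma measurable_gt_set r : measurable [set w | r < f w].
Proof.
rewrite (_ : mkset _ = f @^-1` `]r, +oo[%classic).
  by rewrite -[X in measurable X]setTI; exact: mf.
by apply/seteqP; split => w /=; rewrite in_itv/= andbT.
Qed.

Lemma measurable_ge_set r : measurable [set w | r <= f w].
Proof.
rewrite (_ : mkset _ = f @^-1` `[r, +oo[%classic).
  by rewrite -[X in measurable X]setTI; exact: mf.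
by apply/seteqP; split => w /=; rewrite in_itv/= andbT.
Qed.

End superlevel_sets.

Section bounded_measurable.
Context d (T : measurableType d) (R : realType).
Implicit Types f g : T -> R.

(** A bound at every point makes such functions integrable against every finite measure, so that
    integrability conditions reduce to closure rules. *)
Definition bmf f := measurable_fun setT f /\ exists K : R, forall x, `|f x| <= K.

Lemma bmf_cst c : bmf (fun=> c).
Proof. by split; [exact: measurable_cst | exists `|c|]. Qed.

Lemma bmfD f g : bmf f -> bmf g -> bmf (fun x => f x + g x).
Proof.
move=> [mf [K Kf]] [mg [L Lg]]; split; first exact: measurable_funD.
exists (K + L) => x; exact: le_trans (ler_normD _ _) (lerD (Kf x) (Lg x)).
Qed.

Lemma bmfM f g : bmf f -> bmf g -> bmf (fun x => f x * g x).
Proof.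
move=> [mf [K Kf]] [mg [L Lg]]; split; first exact: measurable_funM.
by exists (K * L) => x; rewrite normrM ler_pM.
Qed.

Lemma bmfZ c f : bmf f -> bmf (fun x => c * f x).
Proof. by move=> bf; apply: bmfM => //; exact: bmf_cst. Qed.

Lemma bmfN f : bmf f -> bmf (fun x => - f x).
Proof.
move=> /(bmfZ (-1)); rewrite (_ : (fun x => _) = fun x => - f x)//.
by apply: funext => x; rewrite mulN1r.
Qed.

Lemma bmfB f g : bmf f -> bmf g -> bmf (fun x => f x - g x).
Proof. by move=> bf bg; apply: bmfD => //; exact: bmfN. Qed.

Lemma bmf_sum (I : Type) (r : seq I) (Q : pred I) (F : I -> T -> R) :
  (forall i, bmf (F i)) -> bmf (fun x => \sum_(i <- r | Q i) F i x).
Proof.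
move=> bF; elim: r => [|i r IH].
  rewrite (_ : (fun x => _) = fun=> 0); first exact: bmf_cst.
  by apply: funext => x; rewrite big_nil.
rewrite (_ : (fun x => _) = fun x => (if Q i then F i x else 0) + \sum_(j <- r | Q j) F j x).
  by apply: bmfD => //; case: (Q i) => //; exact: bmf_cst.
by apply: funext => x; rewrite big_cons; case: ifP => //; rewrite add0r.
Qed.

Lemma bmf_prod (I : Type) (r : seq I) (Q : pred I) (F : I -> T -> R) :
  (forall i, bmf (F i)) -> bmf (fun x => \prod_(i <- r | Q i) F i x).
Proof.
move=> bF; elim: r => [|i r IH].
  rewrite (_ : (fun x => _) = fun=> 1); first exact: bmf_cst.
  by apply: funext => x; rewrite big_nil.
rewrite (_ : (fun x => _) = fun x => (if Q i then F i x else 1) * \prod_(j <- r | Q j) F j x).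
  by apply: bmfM => //; case: (Q i) => //; exact: bmf_cst.
by apply: funext => x; rewrite big_cons; case: ifP => //; rewrite mul1r.
Qed.

Lemma bmf_indic (A : set T) : measurable A -> bmf (fun x => \1_A x).
Proof.
move=> mA; split; first exact: measurable_indic.
by exists 1 => x; rewrite indicE; case: (_ \in _); rewrite ?normr0 ?normr1.
Qed.

Lemma bmf_comp (h : R -> R) (f : T -> R) : continuous h ->
  (exists K : R, forall y, `|h y| <= K) -> measurable_fun setT f ->
  bmf (fun x => h (f x)).
Proof.
move=> ch [K hK] mf; split; last by exists K.
by apply: measurableT_comp => //; exact: continuous_measurable_fun.
Qed.

Lemma bmf_cos f : measurable_fun setT f -> bmf (fun x => cos (f x)).
Proof.
by apply: bmf_comp; [exact: continuous_cos | exists 1; exact: cos_max].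
Qed.

Lemma bmf_sin f : measurable_fun setT f -> bmf (fun x => sin (f x)).
Proof.
by apply: bmf_comp; [exact: continuous_sin | exists 1; exact: sin_max].
Qed.

End bounded_measurable.

Lemma bmf_comp_meas (R : realType) d (T : measurableType d) d' (S : measurableType d')
  (f : S -> R) (W : T -> S) :
  measurable_fun setT W -> bmf f -> bmf (fun w => f (W w)).
Proof.
move=> mW [mf [K fK]]; split; last by exists K.
exact: measurableT_comp.
Qed.

Section expect.
Context d (T : measurableType d) (R : realType).
Variable mu : {finite_measure set T -> \bar R}.
Implicit Types f g : T -> R.

(** Finite measures rather than probabilities: the limit measures that carry the jumps need not have
    mass one. *)
Definition Ex f : R := \int[mu]_(x in [set: T]) f x.

Let muT_fin : (mu setT < +oo)%E.
Proof. by rewrite ltey_eq fin_num_measure. Qed.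

Lemma bmf_int f : bmf f -> mu.-integrable setT (EFin \o f).
Proof.
move=> [mf [K Kf]]; apply: (@measurable_bounded_integrable _ _ _ mu) => //.
exists K; split; first exact: num_real.
by move=> M KM x _; exact: le_trans (Kf x) (ltW KM).
Qed.

Lemma eq_Ex f g : (forall x, f x = g x) -> Ex f = Ex g.
Proof. by move=> fg; apply: eq_Rintegral => x _. Qed.

Lemma ExD f g : bmf f -> bmf g -> Ex (fun x => f x + g x) = Ex f + Ex g.
Proof. by move=> bf bg; apply: RintegralD => //; exact: bmf_int. Qed.

Lemma ExB f g : bmf f -> bmf g -> Ex (fun x => f x - g x) = Ex f - Ex g.
Proof. by move=> bf bg; apply: RintegralB => //; exact: bmf_int. Qed.

Lemma ExZ c f : bmf f -> Ex (fun x => c * f x) = c * Ex f.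
Proof. by move=> bf; apply: RintegralZl => //; exact: bmf_int. Qed.

Lemma Ex_cst c : Ex (fun=> c) = c * fine (mu setT).
Proof. exact: Rintegral_cst. Qed.

Lemma Ex_sum (I : Type) (r : seq I) (F : I -> T -> R) :
  (forall i, bmf (F i)) -> Ex (fun x => \sum_(i <- r) F i x) = \sum_(i <- r) Ex (F i).
Proof.
move=> bF; elim: r => [|i r IH].
  rewrite big_nil (@eq_Ex _ (fun=> 0)) ?Ex_cst ?mul0r// => x.
  by rewrite big_nil.
rewrite big_cons -IH -ExD//; last exact: bmf_sum.
by apply: eq_Ex => x; rewrite big_cons.
Qed.

Lemma Ex_le f g : bmf f -> bmf g -> (forall x, f x <= g x) -> Ex f <= Ex g.
Proof. by move=> bf bg fg; apply: le_Rintegral => //; exact: bmf_int. Qed.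

Lemma Ex_ge0 f : (forall x, 0 <= f x) -> 0 <= Ex f.
Proof. by move=> f0; apply: Rintegral_ge0. Qed.

Lemma Ex_indic A : measurable A -> Ex (\1_A) = fine (mu A).
Proof.
by move=> mA; rewrite /Ex /Rintegral integral_indic// setIT.
Qed.

Lemma Ex_abs f g : bmf f -> bmf g -> (forall x, `|f x| <= g x) -> `|Ex f| <= Ex g.
Proof.
move=> bf bg fg; rewrite ler_norml; apply/andP; split.
  rewrite -mulN1r -ExZ//; apply: Ex_le => //; first exact: bmfZ.
  by move=> x; have := fg x; rewrite ler_norml => /andP[+ _]; rewrite mulN1r.
by apply: Ex_le => // x; have := fg x; rewrite ler_norml => /andP[_].
Qed.

Lemma Ex_cvg (f_ : nat -> T -> R) f K :
  (forall n, measurable_fun setT (f_ n)) -> (forall n x, `|f_ n x| <= K) ->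
  (forall x, f_ n x @[n --> \oo] --> f x) ->
  Ex (f_ n) @[n --> \oo] --> Ex f.
Proof.
move=> mf bf cf.
have mlim : measurable_fun setT f.
  by apply: (@measurable_fun_cvg _ _ _ setT f_) => // x _; exact: cf.
have bK x : `|f x| <= K.
  have cn : `|f_ n x| @[n --> \oo] --> `|f x| by apply: cvg_norm; exact: cf.
  rewrite -(cvg_lim _ cn)//; apply: limr_le; first by apply/cvg_ex; exists `|f x|.
  by near=> n.
have [] := @dominated_convergence _ _ _ mu setT measurableT
  (fun n => EFin \o f_ n) (EFin \o f) (EFin \o cst K).
- by move=> n; apply/measurable_EFinP.
- exact/measurable_EFinP.
- by apply: aeW => x _; apply: cvg_EFin; [exact: nearW | exact: cf].
- by apply: bmf_int; exact: bmf_cst.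
- by apply: aeW => x n _; rewrite /= lee_fin.
move=> i1 _ c2.
apply: fine_cvg.
rewrite /Ex /Rintegral fineK//.
by apply: integrable_fin_num => //; apply: bmf_int; split => //; exists K.
Unshelve. all: by end_near. Qed.

End expect.

(** * Loeb measures *)

Lemma ultra_not (U : set_system nat) (UU : UltraFilter U) (A : set nat) :
  U (~` A) <-> ~ U A.
Proof.
split=> [UnA UA|nUA]; last by have [] := in_ultra_setVsetC A UU.
by have /filter_ex [x []] : U (~` A `&` A) by exact: filterI.
Qed.

(** The image of [U] under [u] is an ultrafilter living on the compact interval [[-K, K]], hence it
    converges. This takes the place of extracting subsequences. *)
Lemma ultra_cvg (R : realType) (U : set_system nat) (UU : UltraFilter U)
  (u : nat -> R) (K : R) : (forall k, `|u k| <= K) -> cvg (u @ U).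
Proof.
move=> uK; have := @segment_compact R (- K) K.
rewrite compact_ultra => /(_ (u @ U)) [].
- split=> [|G GF sub]; first exact: fmap_proper_filter.
  apply/seteqP; split; last exact: sub.
  (* Maximality of the image filter: if [A] were not in it, its complement would be, and the finer
     filter [G] would contain both. *)
  move=> A GA; have [//|UnA] := in_ultra_setVsetC (u @^-1` A) UU.
  have /filter_ex[x []//] : G (A `&` ~` A).
  by apply: filterI => //; apply: sub; rewrite /= preimage_setC.
- by apply: nearW => k; rewrite /= in_itv/= -ler_norml.
- by move=> l [_ ul]; apply/cvg_ex; exists l.
Unshelve. all: by end_near. Qed.

Lemma cvg_sum (R : realType) (J : Type) (r : seq J) (S : Type) (F : set_system S)
  (FF : Filter F) (f : J -> S -> R) (l : J -> R) :
  (forall i, f i x @[x --> F] --> l i) ->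
  \sum_(i <- r) f i x @[x --> F] --> \sum_(i <- r) l i.
Proof.
move=> fl; elim: r => [|i r IH].
  under eq_fun do [rewrite big_nil]; rewrite big_nil; exact: cvg_cst.
under eq_fun do [rewrite big_cons]; rewrite big_cons; exact: cvgD.
Qed.

Section positive_functional.
Context d (T : measurableType d) (R : realType).

(** Two kinds of functional are fed into the Loeb construction: expectations, with [K = 1], and the
    weighted functionals [f |-> 2 ^ k E[rho (D_k) f]], for which [K] bounds the total mass uniformly
    in [k]. *)
Record posfun (I : (T -> R) -> R) (K : R) : Prop := Posfun {
  pf_add : forall f g, bmf f -> bmf g -> I (fun x => f x + g x) = I f + I g ;
  pf_scale : forall c f, bmf f -> I (fun x => c * f x) = c * I f ;
  pf_ge0 : forall f, bmf f -> (forall x, 0 <= f x) -> 0 <= I f ;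
  pf_le1 : I (fun=> 1) <= K }.

Variables (I : (T -> R) -> R) (K : R).
Hypothesis hI : posfun I K.

Lemma posfun_le f g : bmf f -> bmf g -> (forall x, f x <= g x) -> I f <= I g.
Proof.
move=> bf bg fg; rewrite -subr_ge0 -mulN1r -(pf_scale hI)// -(pf_add hI)//; last exact: bmfZ.
apply: (pf_ge0 hI) => [|x]; first by apply: bmfD => //; exact: bmfZ.
by rewrite mulN1r subr_ge0.
Qed.

Lemma posfunB f g : bmf f -> bmf g -> I (fun x => f x - g x) = I f - I g.
Proof.
move=> bf bg; rewrite -[- I g]mulN1r -(pf_scale hI)// -(pf_add hI)//; last exact: bmfZ.
by congr I; apply: funext => x; rewrite mulN1r.
Qed.

Lemma posfun_abs f c : bmf f -> (forall x, `|f x| <= c) -> `|I f| <= c * K.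
Proof.
move=> bf fc; have c0 : 0 <= c by apply: le_trans (fc point).
have IcK : I (fun=> c) <= c * K.
  have -> : (fun=> c) = (fun x : T => c * (fun=> 1 : R) x).
    by apply: funext => x; rewrite mulr1.
  by rewrite (pf_scale hI) ?ler_wpM2l ?(pf_le1 hI)//; exact: bmf_cst.
rewrite ler_norml; apply/andP; split.
  rewrite lerNl -mulN1r -(pf_scale hI)//; apply: le_trans IcK.
  apply: posfun_le => [||x]; [exact: bmfZ | exact: bmf_cst | rewrite mulN1r].
  by rewrite lerNl; have := fc x; rewrite ler_norml => /andP[].
apply: le_trans IcK; apply: posfun_le => //; first exact: bmf_cst.
by move=> x; have := fc x; rewrite ler_norml => /andP[].
Qed.

Lemma posfun0 : I (fun=> 0) = 0.
Proof.
have -> : (fun=> 0) = (fun x : T => 0 * (fun=> 1 : R) x).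
  by apply: funext => x; rewrite mul0r.
by rewrite (pf_scale hI) ?mul0r//; exact: bmf_cst.
Qed.

Lemma posfun_sum (J : Type) (r : seq J) (F : J -> T -> R) :
  (forall i, bmf (F i)) -> I (fun x => \sum_(i <- r) F i x) = \sum_(i <- r) I (F i).
Proof.
move=> bF; elim: r => [|i r IH].
  rewrite big_nil -posfun0; congr I.
  by apply: funext => x; rewrite big_nil posfun0.
rewrite big_cons -IH -(pf_add hI)//; last exact: bmf_sum.
by congr I; apply: funext => x; rewrite big_cons.
Qed.

End positive_functional.

Lemma abs_indic_le1 (R : realType) (T : Type) (A : set T) (x : T) : `|\1_A x : R| <= 1.
Proof. by rewrite indicE; case: (_ \in _); rewrite ?normr0 ?normr1. Qed.

(** [S] is the minimum of [N] and the integer part of [z]. *)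
Lemma layer_count (R : realType) (z : R) (N : nat) : 0 <= z ->
  let S := \sum_(i < N) (i.+1%:R <= z)%R%:R in
  [/\ S <= z, S <= N%:R & z <= S + 1 \/ S = N%:R].
Proof.
move=> z0; elim: N => [|N /= [h1 hN h2]] /=.
  by rewrite big_ord0; split => //; right.
rewrite big_ord_recr /=; have [Nz|zN] := leP (N.+1%:R) z.
  have SN : \sum_(i < N) (i.+1%:R <= z)%R%:R = N%:R :> R.
    case: h2 => // zS; apply/eqP; rewrite eq_le hN/=.
    by rewrite -(lerD2r 1) (le_trans _ zS)// natr1.
  by rewrite SN /= mulr1n natr1; split => //; right.
rewrite /= mulr0n addr0; split => //; first by rewrite (le_trans hN)// ler_nat.
by left; case: h2 => // SN; rewrite SN natr1 ltW.
Qed.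

(** Layer-cake approximation: the error does not depend on [y], so a function with values in
    [[0, 1]] is uniformly close to an average of indicators of its superlevel sets. This is how
    statements about sets become statements about functions. *)
Lemma layer_approx (R : realType) (y : R) (N : nat) : 0 <= y <= 1 ->
  `|y - N.+1%:R^-1 * \sum_(i < N.+1) (i.+1%:R / N.+1%:R <= y)%R%:R| <= N.+1%:R^-1.
Proof.
move=> /andP[y0 y1]; have N0 : 0 < N.+1%:R :> R by rewrite ltr0n.
have [|h1 hN h2] := @layer_count R (y * N.+1%:R) N.+1; first by rewrite mulr_ge0// ltW.
under eq_bigr do rewrite ler_pdivrMr//.
rewrite -(ler_pM2r N0) mulVf ?gt_eqF// -[X in _ * X](gtr0_norm N0) -normrM mulrBl.
rewrite [_^-1 * _]mulrC -mulrA mulVf ?gt_eqF// mulr1 ger0_norm ?subr_ge0//.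
case: h2 => [|->]; first by rewrite lerBlDl.
by rewrite lerBlDl (le_trans (_ : _ <= N.+1%:R)) ?lerDl// ler_piMl// ltW.
Qed.

Section loeb_algebra.
Variables (U : set_system nat) (UU : UltraFilter U).
Variables (d : nat -> measure_display) (T : forall k, measurableType (d k)).

(** Sequences are not identified modulo [U]: membership in internal sets already ignores [U]-null
    sets of indices, so no quotient is formed. The first argument only lets the canonical structures
    recover [U]. *)
Definition loeb (_ : UltraFilter U) (S : forall k, measurableType (d k)) :=
  forall k, S k.
Local Notation Omega := (loeb UU T).

HB.instance Definition _ := gen_eqMixin Omega.
HB.instance Definition _ := gen_choiceMixin Omega.
HB.instance Definition _ := isPointed.Build Omega (fun k => point).

Definition internal (A : forall k, set (T k)) : set Omega :=
  [set w | U [set k | A k (w k)]].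

Definition internals : set (set Omega) :=
  [set X | exists2 A, (forall k, measurable (A k)) & X = internal A].

Lemma internalC A : internal (fun k => ~` A k) = ~` internal A.
Proof. by apply/seteqP; split=> w /=; rewrite /internal /= -ultra_not. Qed.

Lemma internalI A B :
  internal (fun k => A k `&` B k) = internal A `&` internal B.
Proof.
apply/seteqP; split=> w /=.
  by move=> h; split; apply: filterS h => k [].
by move=> [h1 h2]; apply: filterS2 h1 h2 => k.
Qed.

Lemma internalU A B :
  internal (fun k => A k `|` B k) = internal A `|` internal B.
Proof.
rewrite -[RHS]setCK setCU -!internalC -internalI -internalC; congr internal.
by apply: functional_extensionality_dep => k; rewrite setCI !setCK.
Qed.

Lemma internal_set0 : internal (fun=> set0) = set0.
Proof.
by apply/seteqP; split=> // w h; have /filter_ex [] := h.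
Qed.

Let i0 : internals set0.
Proof. by exists (fun=> set0) => //; rewrite internal_set0. Qed.

Let iU : setU_closed internals.
Proof.
move=> _ _ [A mA ->] [B mB ->]; exists (fun k => A k `|` B k).
  by move=> k; exact: measurableU.
by rewrite internalU.
Qed.

Let iC : setC_closed internals.
Proof.
move=> _ [A mA ->]; exists (fun k => ~` A k); last by rewrite internalC.
by move=> k; exact: measurableC.
Qed.

HB.instance Definition _ :=
  isAlgebraOfSets.Build default_measure_display Omega i0 iU iC.

(** Otherwise, choosing a counterexample in each coordinate where the inclusion fails gives a
    sequence in [internal A] but not in [internal B]. Hence an internal set determines its
    components for [U]-almost all indices, which makes [icontent] well defined. *)
Lemma internal_subset_near A B : internal A `<=` internal B ->
  U [set k | A k `<=` B k].
Proof.
move=> AB; apply: contrapT => /(ultra_not UU _).2 h.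
have H k : exists w : T k, ~ A k `<=` B k -> A k w /\ ~ B k w.
  have [?|/existsNP [w /not_implyP Aw]] := pselect (A k `<=` B k).
    by exists point.
  by exists w.
pose w : Omega := fun k => sval (cid (H k)).
have wP k : ~ A k `<=` B k -> A k (w k) /\ ~ B k (w k).
  by rewrite /w; case: cid.
have /AB Bw : internal A w by apply: filterS h => k /wP [].
have /filter_ex [k [/= nAB Bk]] : U ((~` [set k | A k `<=` B k]) `&` [set k | B k (w k)]).
  exact: filterI.
by have [_] := wP k nAB.
Qed.

Hypothesis Uoo : \oo `<=` U.

(** Countable saturation, by a diagonal argument. Without a finite subcover each finite stage [C n]
    is nonempty for [U]-many coordinates; a sequence that meets in coordinate [k] all satisfiable
    stages up to [k] then escapes the whole cover, because [U] is free. *)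
Lemma internal_compact A (B : nat -> forall k, set (T k)) :
  internal A `<=` \bigcup_j internal (B j) ->
  exists n, internal A `<=` \bigcup_(j < n) internal (B j).
Proof.
move=> AB; apply: contrapT => /forallNP nC.
pose C n k := A k `&` \bigcap_(j in `I_n) ~` B j k.
have CS m n k : (m <= n)%N -> C n k `<=` C m k.
  by move=> mn w [Aw Bw]; split => // j /= jm; apply: Bw => /=; exact: leq_trans mn.
have UC n : U [set k | C n k !=set0].
  have /existsNP [w /not_implyP [Aw Bw]] := nC n.
  suff : internal (C n) w by apply: filterS => k Ck; exists (w k).
  rewrite internalI; split=> //.
  suff h m : (m <= n)%N -> U [set k | (\bigcap_(j in `I_m) ~` B j k) (w k)].
    exact: h.
  elim: m => [_|m IH mn]; first by apply: filterS filterT => k _ j.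
  have /(ultra_not UU _).2 Um : ~ U [set k | B m k (w k)].
    by move=> h; apply: Bw; exists m.
  apply: filterS2 (IH (ltnW mn)) Um => k /= h1 h2 j /=.
  by rewrite ltnS leq_eqVlt => /predU1P [->//|]; exact: h1.
(* The stages [C n k] decrease in [n], so a point of the last nonempty one among the first [m + 1]
   lies in all the nonempty ones. *)
have H k m : exists w : T k, forall n, (n <= m)%N -> C n k !=set0 -> C n k w.
  elim: m => [|m [w wP]].
    have [[w Cw]|n0] := pselect (C 0%N k !=set0).
      by exists w => n; rewrite leqn0 => /eqP ->.
    by exists point => n; rewrite leqn0 => /eqP ->.
  have [[v Cv]|n0] := pselect (C m.+1 k !=set0).
    by exists v => n nm _; exact: CS nm _ Cv.
  by exists w => n; rewrite leq_eqVlt => /predU1P [->//|]; exact: wP.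
pose w : Omega := fun k => sval (cid (H k k)).
have wP k n : (n <= k)%N -> C n k !=set0 -> C n k (w k).
  by rewrite /w; case: cid => x h; exact: h.
have Uge n : U [set k | (n <= k)%N] by apply: Uoo; exact: nbhs_infty_ge.
have Aw : internal A w.
  by apply: filterS2 (UC 0%N) (Uge 0%N) => k Ck k0; have [] := wP k _ k0 Ck.
have [j _ Bj] := AB _ Aw.
have /filter_ex [k [/= Bk [/= Ck jk]]] : U ([set k | B j k (w k)] `&`
    ([set k | C j.+1 k !=set0] `&` [set k | (j.+1 <= k)%N])).
  by apply: filterI => //; exact: filterI.
by have [_ /(_ j (ltnSn j))] := wP _ _ jk Ck.
Qed.

Variables (R : realType) (I : forall k, (T k -> R) -> R) (K : R).
Hypothesis hI : forall k, posfun (@I k) K.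

(** The components are picked by choice; [icontentE] shows that the value does not depend on them.
    The two proof arguments are carried so that the measure instances can be attached to this
    constant. *)
Definition icontent (_ : \oo `<=` U) (_ : forall k, posfun (@I k) K) (X : set Omega) : \bar R :=
  match pselect (internals X) with
  | left h => (lim (I (\1_(s2val (cid2 h) k)) @[k --> U]))%:E
  | right _ => 0%E
  end.

Local Notation mu := (icontent Uoo hI).

Lemma I_cvg (g : forall k, T k -> R) c : (forall k, measurable_fun setT (g k)) ->
  (forall k x, `|g k x| <= c) -> cvg (I (g k) @[k --> U]).
Proof.
move=> mg gc; apply: (@ultra_cvg _ _ UU _ (c * K)) => k.
by apply: (posfun_abs (hI k)) => //; split => //; exists c.
Qed.

Lemma I_indic_cvg A : (forall k, measurable (A k)) ->
  cvg (I (\1_(A k) : T k -> R) @[k --> U]).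
Proof.
move=> mA; apply: (@I_cvg _ 1) => k; first exact: measurable_indic.
by move=> x; exact: abs_indic_le1.
Qed.

Lemma icontentE A : (forall k, measurable (A k)) ->
  mu (internal A) = (lim (I (\1_(A k) : T k -> R) @[k --> U]))%:E.
Proof.
move=> mA; rewrite /icontent; case: pselect => [h|[]]; last by exists A.
case: cid2 => B mB AB /=; congr (_%:E).
apply: cvg_lim => //; apply: cvg_trans (I_indic_cvg mA).
apply: near_eq_cvg; near=> k; congr I; congr (\1_ _); apply/seteqP; split.
  by near: k; apply: internal_subset_near; rewrite AB.
by near: k; apply: internal_subset_near; rewrite AB.
Unshelve. all: by end_near. Qed.

Let mu_ge0 X : (0 <= mu X)%E.
Proof.
have [[A mA ->]|nX] := pselect (internals X); last first.
  by rewrite /icontent; case: pselect.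
rewrite icontentE// lee_fin; apply: limr_ge; first exact: I_indic_cvg.
near=> k; apply: (pf_ge0 (hI k)); first exact: bmf_indic.
by move=> x; rewrite indicE.
Unshelve. all: by end_near. Qed.

Let mu0 : mu set0 = 0%E.
Proof.
rewrite -internal_set0 icontentE//; congr EFin; apply: cvg_lim => //.
rewrite (_ : (fun k => _) = fun=> 0); first exact: cvg_cst.
by apply: funext => k; rewrite indic0 (posfun0 (hI k)).
Qed.

Let mu_additive : measure_function.semi_additive mu.
Proof.
apply: (proj2 (additive2P mu0)) => _ _ [A mA ->] [B mB ->] AB0.
have ABk : U [set k | A k `&` B k = set0].
  have := @internal_subset_near (fun k => A k `&` B k) (fun=> set0).
  rewrite internalI AB0 internal_set0 => /(_ (@subset_refl _ _)).
  by apply: filterS => k /=; rewrite subset0.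
rewrite -internalU !icontentE//; last by move=> k; exact: measurableU.
rewrite -EFinD; congr EFin; apply: cvg_lim => //.
apply: cvg_trans (cvgD (I_indic_cvg mA) (I_indic_cvg mB)).
apply: near_eq_cvg; near=> k; rewrite !fctE -(pf_add (hI k)); [|exact: bmf_indic..].
congr I; apply: funext => x; rewrite !indicE in_setU.
have : A k `&` B k = set0 by near: k.
have [/set_mem Ax|] := boolP (x \in A k); have [/set_mem Bx|] := boolP (x \in B k);
  rewrite /= ?addr0 ?add0r//.
by move=> /seteqP[/(_ x) + _] => /(_ (conj Ax Bx)).
Unshelve. all: by end_near. Qed.

HB.instance Definition _ := isContent.Build _ Omega R mu mu_ge0 mu_additive.

(** By [internal_compact] a countable cover of an internal set has a finite subcover, so finite
    subadditivity is enough. *)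
Let mu_sub : measurable_subset_sigma_subadditive mu.
Proof.
move=> _ F mF [A mA ->] AF.
have [B BP] : {B : nat -> forall k, set (T k) & forall j,
    (forall k, measurable (B j k)) /\ F j = internal (B j)}.
  have h j : {B : forall k, set (T k) | (forall k, measurable (B k)) /\ F j = internal B}.
    by have [B mB FB] := cid2 (mF j); exists B.
  by exists (fun j => sval (h j)) => j; case: (h j).
have [n An] : exists n, internal A `<=` \bigcup_(j < n) internal (B j).
  apply: internal_compact => w /AF [j _ Fj]; exists j => //.
  by rewrite -(BP j).2.
have := @content_subadditive _ R Omega mu (internal A) F n.
move=> /(_ _ _ _)/le_trans; apply.
- by move=> k _; exact: mF.
- by exists A.
- rewrite -bigcup_mkord => w /An [j jn Bj]; exists j => //.
  by rewrite (BP j).2.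
- by rewrite -[leLHS](big_mkord xpredT (fun k => mu (F k))); exact: nneseries_lim_ge.
Qed.

HB.instance Definition _ := Content_SigmaSubAdditive_isMeasure.Build _ R Omega mu mu_sub.

Local Notation OmegaS := (g_sigma_algebraType (@measurable _ Omega)).

Let M0 : set OmegaS -> \bar R := measure_extension mu.

HB.instance Definition _ := Measure.on M0.

Let M0E A : (forall k, measurable (A k)) ->
  M0 (internal A) = (lim (I (\1_(A k) : T k -> R) @[k --> U]))%:E.
Proof.
by move=> mA; rewrite /M0 /measure_extension measurable_mu_extE; [exact: icontentE|exists A].
Qed.

Let internalT : internal (fun=> setT) = setT :> set Omega.
Proof. by apply/seteqP; split => // w _; apply: filterS filterT. Qed.

Let M0T : (M0 setT <= K%:E)%E.
Proof.
rewrite -internalT M0E// lee_fin; apply: limr_le; first exact: I_indic_cvg.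
by near=> k; rewrite indicT; exact: (pf_le1 (hI k)).
Unshelve. all: by end_near. Qed.

Let M0_fin : fin_num_fun M0.
Proof.
move=> A mA; rewrite ge0_fin_numE//; apply: le_lt_trans (ltry K).
apply: le_trans M0T; apply: le_measure; rewrite ?inE//.
Qed.

HB.instance Definition _ := @Measure_isFinite.Build _ OmegaS R M0 M0_fin.

Let M : {finite_measure set OmegaS -> \bar R} := M0.

(** The standard part of the internal function given by the sequence [g]. *)
Definition st (g : forall k, T k -> R) (w : OmegaS) : R := lim (g k (w k) @[k --> U]).

Lemma internal_measurable A : (forall k, measurable (A k)) ->
  measurable (internal A : set OmegaS).
Proof. by move=> mA; apply: sub_sigma_algebra; exists A. Qed.

Lemma near_internal A (w : OmegaS) :
  U [set k | \1_(A k) (w k) = \1_(internal A) w :> R].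
Proof.
have [Aw|nAw] := pselect (internal A w).
  by apply: filterS (Aw : U _) => k /= Ak; rewrite !indicE !mem_set.
have : internal (fun k => ~` A k) w by rewrite internalC.
by apply: filterS => k /= Ak; rewrite !indicE !memNset.
Qed.

Section st_integral.
Variables (g : forall k, T k -> R).
Hypothesis mg : forall k, measurable_fun setT (@g k).
Hypothesis g01 : forall k x, 0 <= @g k x <= 1.

Let bg k : bmf (@g k).
Proof.
split => //; exists 1 => x; have /andP[? ?] := @g01 k x.
by rewrite ger0_norm.
Qed.

Let A N i k : set (T k) := [set x | i.+1%:R / N.+1%:R <= @g k x].

Let mA N i k : measurable (@A N i k).
Proof.
exact: measurable_ge_set.
Qed.

Let s N (w : OmegaS) : R := N.+1%:R^-1 * \sum_(i < N.+1) \1_(internal (@A N i)) w.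

Let bs N : bmf (s N).
Proof.
by apply/bmfZ/bmf_sum => i; apply: bmf_indic; apply: internal_measurable.
Qed.

Let g_cvg w : cvg (@g k (w k) @[k --> U]).
Proof.
apply: (@ultra_cvg _ _ UU _ 1) => k; have /andP[? ?] := @g01 k (w k).
by rewrite ger0_norm.
Qed.

Let st_s N w : `|st g w - s N w| <= N.+1%:R^-1.
Proof.
have h : U [set k | forall i : 'I_N.+1,
    \1_(@A N i k) (w k) = \1_(internal (@A N i)) w :> R].
  by apply: filter_forall => i; exact: near_internal.
have c : `|@g k (w k) - s N w| @[k --> U] --> `|st g w - s N w|.
  by apply: cvg_norm; apply: cvgB; [exact: g_cvg | exact: cvg_cst].
rewrite -(cvg_lim _ c)//; apply: limr_le; first by apply/cvg_ex; eexists; exact: c.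
near=> k; rewrite /s.
rewrite (eq_bigr (fun i : 'I_N.+1 => (i.+1%:R / N.+1%:R <= @g k (w k))%R%:R)).
  exact: layer_approx.
move=> i _; have <- : \1_(@A N i k) (w k) = \1_(internal (@A N i)) w :> R.
  by move: i; near: k; exact: h.
rewrite indicE; congr (nat_of_bool _)%:R.
by apply/idP/idP => [/set_mem//|?]; rewrite inE.
Unshelve. all: by end_near. Qed.

Lemma invSn_cvg0 : N.+1%:R^-1 @[N --> \oo] --> (0 : R).
Proof. exact: cvg_harmonic. Qed.

Let st_measurable : measurable_fun setT (st g).
Proof.
apply: (@measurable_fun_cvg _ _ _ setT s) => [N|w _]; first exact: (bs N).1.
apply/cvgrPdist_le => e e0; near=> N; rewrite (le_trans (st_s _ _))//.
apply: le_trans (ler_norm _) _; near: N.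
by have /cvgr0_norm_le := invSn_cvg0; apply.
Unshelve. all: by end_near. Qed.

(** For indicators of internal sets the identity is [M0E]. The averages [s N] of such indicators are
    within [1 / (N + 1)] of [st g] pointwise, and of [g k] in every coordinate, so both sides are
    within [K / (N + 1)] of [Ex M (s N)]. *)
Lemma st_integral01 : measurable_fun setT (st g) /\
  Ex M (st g) = lim (I (@g k) @[k --> U]).
Proof.
split; first exact: st_measurable.
have bst : bmf (st g).
  split; first exact: st_measurable; exists 1 => w.
  rewrite ger0_norm; first by apply: limr_le => //; near=> k; have /andP[] := @g01 k (w k).
  by apply: limr_ge => //; near=> k; have /andP[] := @g01 k (w k).
have K0 : 0 <= K.
  apply: le_trans (pf_le1 (hI 0%N)); apply: (pf_ge0 (hI 0%N)) => //.
  exact: bmf_cst.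
have MT : fine (M setT) <= K.
  by rewrite -lee_fin fineK ?M0T//; exact: M0_fin.
have d1 N : `|Ex M (st g) - Ex M (s N)| <= N.+1%:R^-1 * K.
  rewrite -ExB//; apply: le_trans (@Ex_abs _ _ _ M _ (fun=> N.+1%:R^-1) _ _ _) _ => //.
  - exact: bmfB.
  - exact: bmf_cst.
  - by rewrite Ex_cst ler_wpM2l.
have Icvg i N : cvg (I (\1_(@A N i k)) @[k --> U]) by exact: I_indic_cvg.
have Es N : Ex M (s N) = lim (I (fun x => N.+1%:R^-1 * \sum_(i < N.+1) \1_(@A N i k) x) @[k --> U]).
  rewrite ExZ; last by apply: bmf_sum => i; apply: bmf_indic; exact: internal_measurable (mA N i).
  rewrite Ex_sum; last by move=> i; apply: bmf_indic; exact: internal_measurable (mA N i).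
  apply/esym/cvg_lim => //.
  rewrite (_ : (fun k => _) = (fun k => N.+1%:R^-1 * \sum_(i < N.+1) I (\1_(@A N i k)))); last first.
    apply: funext => k; rewrite (pf_scale (hI k)) ?(posfun_sum (hI k))//.
    - by move=> i; exact: bmf_indic.
    - by apply: bmf_sum => i; exact: bmf_indic.
  apply: cvgM; first exact: cvg_cst.
  apply: cvg_sum => i.
  rewrite Ex_indic; last exact: internal_measurable.
  rewrite [X in fine X](M0E (mA N i)); exact: Icvg.
have d2 N : `|lim (I (@g k) @[k --> U]) - Ex M (s N)| <= N.+1%:R^-1 * K.
  have bsk k : bmf (fun x => N.+1%:R^-1 * \sum_(i < N.+1) \1_(@A N i k) x : R).
    by apply/bmfZ/bmf_sum => i; exact: bmf_indic.
  have ds k x : `|@g k x - N.+1%:R^-1 * \sum_(i < N.+1) \1_(@A N i k) x| <= N.+1%:R^-1.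
    rewrite (eq_bigr (fun i : 'I_N.+1 => (i.+1%:R / N.+1%:R <= @g k x)%R%:R)).
      exact: layer_approx.
    move=> i _; rewrite indicE; congr (nat_of_bool _)%:R.
    by apply/idP/idP => [/set_mem//|?]; rewrite inE.
  rewrite Es -limB; last 2 first.
  - by apply: (@I_cvg _ 1) => // k x; have /andP[? ?] := @g01 k x; rewrite ger0_norm.
  - apply: (@I_cvg _ (N.+1%:R^-1 + 1)) => [k|k x]; first exact: (bsk k).1.
    move: (ds k x); rewrite /=; set S := N.+1%:R^-1 * _; set e := N.+1%:R^-1.
    have /andP[? ?] := @g01 k x.
    by rewrite !ler_norml => /andP[? ?]; apply/andP; split; lra.
  rewrite -lim_norm; last first.
    apply: (@ultra_cvg _ _ UU _ (N.+1%:R^-1 * K)) => k; rewrite !fctE -(posfunB (hI k))//.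
    by apply: (posfun_abs (hI k)) => //; exact: bmfB.
  apply: limr_le.
    apply: (@ultra_cvg _ _ UU _ (N.+1%:R^-1 * K)) => k; rewrite !fctE -(posfunB (hI k))//.
    by rewrite normr_id; apply: (posfun_abs (hI k)) => //; exact: bmfB.
  near=> k; rewrite !fctE -(posfunB (hI k))//.
  by apply: (posfun_abs (hI k)) => //; exact: bmfB.
apply/eqP; rewrite -subr_eq0 -normr_le0; apply/ler_addgt0Pr => e e0.
have : (N.+1%:R^-1 * K) + (N.+1%:R^-1 * K) @[N --> \oo] --> 0 * K + 0 * K.
  by apply: cvgD; apply: cvgM; by [exact: invSn_cvg0 | exact: cvg_cst].
rewrite mul0r addr0 add0r => /cvgr0_norm_le /(_ _ e0) [N _ /(_ N (leqnn _))] /=.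
apply: le_trans; rewrite [leRHS]ger0_norm ?addr_ge0 ?mulr_ge0//.
apply: le_trans (ler_distD (Ex M (s N)) _ _) _; apply: lerD => //.
by rewrite distrC.
Unshelve. all: by end_near. Qed.

End st_integral.

(** The only facts about the Loeb measure used afterwards. An affine change of values reduces the
    claim to functions into [[0, 1]]. *)
Theorem loeb_integral : exists mu : {finite_measure set OmegaS -> \bar R},
  forall (g : forall k, T k -> R) (c : R),
    (forall k, measurable_fun setT (g k)) -> (forall k x, `|g k x| <= c) ->
    measurable_fun setT (st g) /\ Ex mu (st g) = lim (I (g k) @[k --> U]).
Proof.
exists M => g c mg gc.
have c0 : 0 <= c by apply: le_trans (gc 0%N point).
(* The added [1] keeps the denominator positive when [c = 0]. *)
pose h k (x : T k) : R := (g k x + c + 1) / (c + c + 1).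
have c1 : 0 < c + c + 1 by rewrite ltr_wpDl ?addr_ge0.
have mh k : measurable_fun setT (h k).
  by apply: measurable_funM => //; do 2 apply: measurable_funD => //.
have h01 k x : 0 <= h k x <= 1.
  rewrite /h divr_ge0 ?(ltW c1)//=; last first.
    by have := gc k x; rewrite ler_norml => /andP[]; lra.
  by rewrite ler_pdivrMr// mul1r; have := gc k x; rewrite ler_norml => /andP[]; lra.
have [msth intsth] := st_integral01 mh h01.
have hcvg w : cvg (h k (w k) @[k --> U]).
  apply: (@ultra_cvg _ _ UU _ 1) => k; have /andP[? ?] := h01 k (w k).
  by rewrite ger0_norm.
have gE k x : g k x = (c + c + 1) * h k x - (c + 1).
  by rewrite /h mulrC divfK ?gt_eqF//; ring.
have stE : st g = (fun w => (c + c + 1) * st h w - (c + 1)).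
  apply: funext => w; rewrite /st; apply: cvg_lim => //.
  under eq_fun do rewrite gE.
  apply: cvgB; last exact: cvg_cst.
  by apply: cvgM; [exact: cvg_cst | exact: hcvg].
have bsth : bmf (st h).
  split => //; exists 1 => w; rewrite ger0_norm.
    by apply: limr_le; [exact: hcvg|near=> k; have /andP[] := h01 k (w k)].
  by apply: limr_ge; [exact: hcvg|near=> k; have /andP[] := h01 k (w k)].
rewrite stE; split.
  by apply: measurable_funB => //; apply: measurable_funM.
have bh k : bmf (h k).
  by split => //; exists 1 => x; have /andP[? ?] := h01 k x; rewrite ger0_norm.
have one_cvg : cvg (I (fun _ : T k => 1) @[k --> U]).
  apply: (@I_cvg (fun _ _ => 1) 1) => [k|k x]; last by rewrite normr1.
  exact: measurable_cst.
have MT : fine (M setT) = lim (I (fun _ : T k => 1) @[k --> U]).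
  rewrite -internalT [X in fine X]M0E//=.
  apply: (congr1 (fun u : nat -> R => lim (u @ U))).
  by apply: funext => k; rewrite indicT.
rewrite ExB; [|exact: bmfZ|exact: bmf_cst].
rewrite ExZ// Ex_cst intsth MT.
apply/esym/cvg_lim => //.
rewrite (_ : (fun k => _) = (fun k => (c + c + 1) * I (h k) - (c + 1) * I (fun _ : T k => 1))); last first.
  apply: funext => k; rewrite -(pf_scale (hI k))// -(pf_scale (hI k)); last exact: bmf_cst.
  rewrite -(posfunB (hI k)); [|exact: bmfZ|by apply: bmfZ; exact: bmf_cst].
  by congr I; apply: funext => x; rewrite gE mulr1.
apply: cvgB; apply: cvgM => //; try exact: cvg_cst.
by apply: (@I_cvg _ 1) => // k x; have /andP[? ?] := h01 k x; rewrite ger0_norm.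
Unshelve. all: by end_near. Qed.

End loeb_algebra.

(** * Uniqueness of characteristic functions *)

Section sign_polynomial.
Variable R : realType.

(* Iterating this odd polynomial on [[-1, 1]] converges pointwise to the sign; it
   turns [sin] into indicators of half-lines without leaving trigonometric
   polynomials. *)
Definition sgstep (s : R) : R := s * (3 - s ^+ 2) / 2.

(** The polynomial touches the values [1] and [-1] to second order at [1] and [-1]; the
    factorisations [e1] and [e2] express this. *)
Lemma sgstep_le1 s : `|s| <= 1 -> `|sgstep s| <= 1.
Proof.
rewrite /sgstep !ler_norml => /andP[h1 h2].
have e1 : 1 - s * (3 - s ^+ 2) / 2 = (1 - s) ^+ 2 * (2 + s) / 2 by field.
have e2 : 1 + s * (3 - s ^+ 2) / 2 = (1 + s) ^+ 2 * (2 - s) / 2 by field.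
have p1 : 0 <= (1 - s) ^+ 2 * (2 + s) / 2.
  by rewrite divr_ge0// mulr_ge0 ?sqr_ge0//; lra.
have p2 : 0 <= (1 + s) ^+ 2 * (2 - s) / 2.
  by rewrite divr_ge0// mulr_ge0 ?sqr_ge0//; lra.
by apply/andP; split; lra.
Qed.

Lemma iter_sgstep_le1 k s : `|s| <= 1 -> `|iter k sgstep s| <= 1.
Proof. by move=> h; elim: k => //= k IH; exact: sgstep_le1. Qed.

(** The iterates increase from [s], and each step multiplies the distance [1 - u] to the fixed point
    by [(1 - u) (2 + u) / 2], which decreases in [u] and is therefore at most its value [r < 1] at
    [s]. *)
Lemma iter_sgstep_pos s : 0 < s <= 1 -> iter k sgstep s @[k --> \oo] --> (1 : R).
Proof.
move=> /andP[s0 s1]; pose r := (1 - s) * (2 + s) / 2.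
have r0 : 0 <= r by rewrite /r divr_ge0// mulr_ge0; lra.
have r1 : r < 1.
  by rewrite /r; nra.
have H k : s <= iter k sgstep s <= 1 /\ 1 - iter k sgstep s <= r ^+ k.
  elim: k => [|k [/andP[h1 h2] h3]]; first by rewrite expr0 /= lexx s1; split => //; lra.
  rewrite /= exprS; set u := iter k sgstep s in h1 h2 h3 *.
  have e1 : 1 - sgstep u = (1 - u) * ((1 - u) * (2 + u) / 2) by rewrite /sgstep; field.
  have ur : (1 - u) * (2 + u) / 2 <= r by rewrite /r; nra.
  have u0 : 0 <= (1 - u) * (2 + u) / 2 by rewrite divr_ge0// mulr_ge0; lra.
  have hu : 0 <= 1 - u by lra.
  have e2 : sgstep u - u = u * (1 - u) * (1 + u) / 2 by rewrite /sgstep; field.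
  have p2 : 0 <= u * (1 - u) * (1 + u) / 2 by rewrite divr_ge0// !mulr_ge0//; lra.
  have p1 : 0 <= (1 - u) * ((1 - u) * (2 + u) / 2) by rewrite mulr_ge0.
  split; first by apply/andP; split; lra.
  by rewrite e1 mulrC ler_pM.
apply/cvgrPdist_le => e e0.
have : r ^+ k @[k --> \oo] --> (0 : R) by apply: cvg_expr; rewrite ger0_norm.
move=> /cvgr0_norm_le /(_ _ e0); apply: filterS => k rk.
have [/andP[h1 h2] h3] := H k.
rewrite ger0_norm ?subr_ge0// (le_trans h3)// (le_trans _ rk)//; exact: ler_norm.
Qed.

Lemma iter_sgstepN k s : iter k sgstep (- s) = - iter k sgstep s.
Proof. by elim: k => //= k ->; rewrite /sgstep sqrrN; field. Qed.

Lemma iter_sgstep_cvg s : `|s| <= 1 -> iter k sgstep s @[k --> \oo] --> Num.sg s.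
Proof.
rewrite ler_norml => /andP[h1 h2]; case: (sgrP s) => [->|s0|s0].
- rewrite (_ : (fun k => _) = fun=> 0); first exact: cvg_cst.
  by apply: funext => k; elim: k => //= k ->; rewrite /sgstep !mul0r.
- by apply: iter_sgstep_pos; rewrite s0.
- rewrite (_ : (fun k => _) = fun k => - iter k sgstep (- s)).
    by apply: cvgN; apply: iter_sgstep_pos; lra.
  by apply: funext => k; rewrite iter_sgstepN opprK.
Qed.

(** Once [|x| / (k + 1) < pi] the two signs agree, so the sequence is eventually constant. *)
Lemma sg_sin_cvg (x : R) : Num.sg (sin (x / k.+1%:R)) @[k --> \oo] --> Num.sg x.
Proof.
have h : \forall k \near \oo, `|x| / k.+1%:R < pi.
  have : `|x| / k.+1%:R @[k --> \oo] --> `|x| * 0.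
    by apply: cvgMr; exact: cvg_harmonic.
  rewrite mulr0 => /cvgr0_norm_lt /(_ _ (pi_gt0 R)).
  by apply: filterS => k; rewrite ger0_norm// divr_ge0.
apply: cvg_near_cst; near=> k.
have xk : `|x| / k.+1%:R < pi by near: k.
have k0 : 0 < k.+1%:R :> R by rewrite ltr0n.
case: (sgrP x) => [->|x0|x0].
- by rewrite mul0r sin0 sgr0.
- rewrite gtr0_sg// sin_gt0_pi// divr_gt0//=.
  by rewrite (gtr0_norm x0) in xk.
- rewrite -[x]opprK mulNr sinN sgrN gtr0_sg// sin_gt0_pi// divr_gt0 ?oppr_gt0//=.
  by rewrite (ltr0_norm x0) in xk.
Unshelve. all: by end_near. Qed.

End sign_polynomial.

Section uniqueness.
Variables (R : realType) (n : nat).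
Variables (d1 : measure_display) (T1 : measurableType d1) (P1 : probability T1 R).
Variables (d2 : measure_display) (T2 : measurableType d2) (P2 : probability T2 R).
Variables (V1 : T1 -> n.-tuple R) (V2 : T2 -> n.-tuple R).
Hypothesis mV1 : measurable_fun setT V1.
Hypothesis mV2 : measurable_fun setT V2.
Local Notation V := (n.-tuple R).
Implicit Types (f g h : V -> R) (th x : V).

Definition tadd th ph : V := [tuple tnth th i + tnth ph i | i < n].
Definition topp th : V := [tuple - tnth th i | i < n].
Definition tdelta (i : 'I_n) (a : R) : V := [tuple if j == i then a else 0 | j < n].

Lemma dotDl th ph x : dot (tadd th ph) x = dot th x + dot ph x.
Proof.
rewrite /dot -big_split; apply: eq_bigr => i _ /=.
by rewrite tnth_mktuple mulrDl.
Qed.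

Lemma dotNl th x : dot (topp th) x = - dot th x.
Proof.
rewrite /dot -sumrN; apply: eq_bigr => i _ /=.
by rewrite tnth_mktuple mulNr.
Qed.

Lemma dot_delta i a x : dot (tdelta i a) x = a * tnth x i.
Proof.
rewrite /dot (bigD1 i)//= big1 ?addr0 ?tnth_mktuple ?eqxx// => j ji.
by rewrite tnth_mktuple (negbTE ji) mul0r.
Qed.

Lemma measurable_dot th : measurable_fun setT (dot th).
Proof.
rewrite (_ : dot th = fun x => \sum_(i <- index_enum 'I_n) tnth th i * tnth x i)//.
elim: (index_enum _) => [|i r IH].
  under eq_fun do [rewrite big_nil]; exact: measurable_cst.
under eq_fun do [rewrite big_cons]; apply: measurable_funD => //.
by apply: measurable_funM => //; exact: measurable_tnth.
Qed.

Definition agree f := Ex P1 (fun w => f (V1 w)) = Ex P2 (fun w => f (V2 w)).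

(** The laws of [V1] and [V2], each weighted by [g], have the same Fourier transform. *)
Definition trig_agree g := bmf g /\ forall th,
  agree (fun x => g x * cos (dot th x)) /\ agree (fun x => g x * sin (dot th x)).

(* Multipliers form an algebra closed under bounded limits, whence a
   sigma-algebra of indicators. *)
Definition multiplier h := bmf h /\ forall g, trig_agree g -> trig_agree (fun x => h x * g x).

Lemma agreeZD a f b g : bmf f -> bmf g -> agree f -> agree g ->
  agree (fun x => a * f x + b * g x).
Proof.
move=> bf bg ef eg; rewrite /agree !ExD ?ExZ ?ef ?eg//.
all: try by [exact: bmf_comp_meas | apply: bmfZ; exact: bmf_comp_meas].
Qed.

Lemma agree_cvg (f_ : nat -> V -> R) f K : (forall k, bmf (f_ k)) ->
  (forall k x, `|f_ k x| <= K) -> (forall x, f_ k x @[k --> \oo] --> f x) ->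
  (forall k, agree (f_ k)) -> agree f.
Proof.
move=> bf fK cf ag.
have c1 : Ex P1 (fun w => f_ k (V1 w)) @[k --> \oo] --> Ex P1 (fun w => f (V1 w)).
  apply: (@Ex_cvg _ _ _ _ (fun k w => f_ k (V1 w)) _ K) => // k.
  exact: (bmf_comp_meas mV1 (bf k)).1.
have c2 : Ex P2 (fun w => f_ k (V2 w)) @[k --> \oo] --> Ex P2 (fun w => f (V2 w)).
  apply: (@Ex_cvg _ _ _ _ (fun k w => f_ k (V2 w)) _ K) => // k.
  exact: (bmf_comp_meas mV2 (bf k)).1.
apply: (@cvg_unique _ _ (Ex P1 (fun w => f_ k (V1 w)) @[k --> \oo])) => //.
by apply: cvg_trans c2; under eq_fun do rewrite ag.
Qed.

Lemma bmf_cosdot th : bmf (fun x => cos (dot th x)).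
Proof. by apply: bmf_cos; exact: measurable_dot. Qed.

Lemma bmf_sindot th : bmf (fun x => sin (dot th x)).
Proof. by apply: bmf_sin; exact: measurable_dot. Qed.

Local Hint Resolve bmf_cosdot bmf_sindot : core.

Lemma multiplier_cst c : multiplier (fun=> c).
Proof.
split; first exact: bmf_cst.
move=> g [bg ag]; split; first exact: bmfZ.
move=> th; have [a1 a2] := ag th; split.
- rewrite (_ : (fun x => _) = (fun x => c * (g x * cos (dot th x)) + 0 * 0)); last first.
    by apply: funext => x; ring.
  apply: (@agreeZD c (fun x => g x * cos (dot th x)) 0 (fun=> 0)) => //.
  + exact: bmfM.
  + exact: bmf_cst.
  + by rewrite /agree !Ex_cst !mul0r.
- rewrite (_ : (fun x => _) = (fun x => c * (g x * sin (dot th x)) + 0 * 0)); last first.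
    by apply: funext => x; ring.
  apply: (@agreeZD c (fun x => g x * sin (dot th x)) 0 (fun=> 0)) => //.
  + exact: bmfM.
  + exact: bmf_cst.
  + by rewrite /agree !Ex_cst !mul0r.
Qed.

Lemma multiplierD f g : multiplier f -> multiplier g -> multiplier (fun x => f x + g x).
Proof.
move=> [bf hf] [bg hg]; split; first exact: bmfD.
move=> u tu; have bu := tu.1; have [bfu fu] := hf _ tu; have [bgu gu] := hg _ tu.
split; first by apply: bmfM => //; exact: bmfD.
move=> th; have [f1 f2] := fu th; have [g1 g2] := gu th; split.
- have := agreeZD 1 1 (bmfM bfu (bmf_cosdot th)) (bmfM bgu (bmf_cosdot th)) f1 g1.
  by congr agree; apply: funext => x; ring.
- have := agreeZD 1 1 (bmfM bfu (bmf_sindot th)) (bmfM bgu (bmf_sindot th)) f2 g2.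
  by congr agree; apply: funext => x; ring.
Qed.

Lemma multiplierM f g : multiplier f -> multiplier g -> multiplier (fun x => f x * g x).
Proof.
move=> [bf hf] [bg hg]; split; first exact: bmfM.
move=> u tu; have := hf _ (hg _ tu); congr trig_agree.
by apply: funext => x; ring.
Qed.

Lemma multiplier_cvg (f_ : nat -> V -> R) f K : (forall k x, `|f_ k x| <= K) ->
  (forall x, f_ k x @[k --> \oo] --> f x) -> (forall k, multiplier (f_ k)) ->
  multiplier f.
Proof.
move=> fK cf mf.
have bf : bmf f.
  split.
    apply: (@measurable_fun_cvg _ _ _ setT f_) => [k|x _]; first exact: (mf k).1.1.
    exact: cf.
  exists K => x; have c : `|f_ k x| @[k --> \oo] --> `|f x| by exact: cvg_norm.
  rewrite -(cvg_lim _ c)//; apply: limr_le; first by apply/cvg_ex; eexists; exact: c.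
  exact: nearW.
split=> // g tg; have [L gL] := tg.1.2; have bgg := tg.1.
split; first exact: bmfM.
have K0 x : 0 <= K by apply: le_trans (fK 0%N x).
move=> th; split.
- apply: (@agree_cvg (fun k x => f_ k x * g x * cos (dot th x)) _ (K * L * 1)).
  + by move=> k; do 2 apply: bmfM => //; exact: (mf k).1.
  + by move=> k x; rewrite !normrM !ler_pM ?mulr_ge0// cos_max.
  + by move=> x; do 2 (apply: cvgM; last exact: cvg_cst).
  + by move=> k; have [_ /(_ _ tg) [_ /(_ th)[]]] := mf k.
- apply: (@agree_cvg (fun k x => f_ k x * g x * sin (dot th x)) _ (K * L * 1)).
  + by move=> k; do 2 apply: bmfM => //; exact: (mf k).1.
  + by move=> k x; rewrite !normrM !ler_pM ?mulr_ge0// sin_max.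
  + by move=> x; do 2 (apply: cvgM; last exact: cvg_cst).
  + by move=> k; have [_ /(_ _ tg) [_ /(_ th)[]]] := mf k.
Qed.

(** The product-to-sum formulas turn multiplication by the cosine into shifts of the frequency [th]
    by [ph] and [- ph]. *)
Lemma multiplier_cos ph : multiplier (fun x => cos (dot ph x)).
Proof.
split => // g [bg tg]; split; first exact: bmfM.
move=> th; have [c1 s1] := tg (tadd th ph); have [c2 s2] := tg (tadd th (topp ph)).
split.
- have := agreeZD (1/2) (1/2) (bmfM bg (bmf_cosdot _)) (bmfM bg (bmf_cosdot _)) c1 c2.
  by congr agree; apply: funext => x; rewrite !dotDl dotNl cosD cosB; field.
- have := agreeZD (1/2) (1/2) (bmfM bg (bmf_sindot _)) (bmfM bg (bmf_sindot _)) s1 s2.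
  by congr agree; apply: funext => x; rewrite !dotDl dotNl sinD sinB; field.
Qed.

Lemma multiplier_sin ph : multiplier (fun x => sin (dot ph x)).
Proof.
split => // g [bg tg]; split; first exact: bmfM.
move=> th; have [c1 s1] := tg (tadd th ph); have [c2 s2] := tg (tadd th (topp ph)).
split.
- have := agreeZD (1/2) (-1/2) (bmfM bg (bmf_sindot _)) (bmfM bg (bmf_sindot _)) s1 s2.
  by congr agree; apply: funext => x; rewrite !dotDl dotNl sinD sinB; field.
- have := agreeZD (-1/2) (1/2) (bmfM bg (bmf_cosdot _)) (bmfM bg (bmf_cosdot _)) c1 c2.
  by congr agree; apply: funext => x; rewrite !dotDl dotNl cosD cosB; field.
Qed.

Lemma multiplier_iter f k : multiplier f -> multiplier (fun x => iter k (@sgstep R) (f x)).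
Proof.
move=> mf; elim: k => //= k IH.
rewrite (_ : (fun x => _) = (fun x => iter k (@sgstep R) (f x) *
   (3 / 2 + (- 1 / 2) * (iter k (@sgstep R) (f x) * iter k (@sgstep R) (f x))))).
  apply: multiplierM => //; apply: multiplierD; first exact: multiplier_cst.
  by apply: multiplierM; [exact: multiplier_cst | exact: multiplierM].
by apply: funext => x; rewrite /sgstep; field.
Qed.

(** Two nested limits: iterating [sgstep] gives the sign of a sine of small slope, and letting the
    slope tend to [0] gives the sign itself. *)
Lemma multiplier_sg i (a : R) : multiplier (fun x => Num.sg (tnth x i - a)).
Proof.
apply: (@multiplier_cvg (fun k x => Num.sg (sin ((tnth x i - a) / k.+1%:R))) _ 1).
- by move=> k x; rewrite normr_sg; case: (_ != 0).
- by move=> x; exact: sg_sin_cvg.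
move=> k; apply: (@multiplier_cvg (fun m x => iter m (@sgstep R) (sin ((tnth x i - a) / k.+1%:R))) _ 1).
- by move=> m x; apply: iter_sgstep_le1; exact: sin_max.
- by move=> x; apply: iter_sgstep_cvg; exact: sin_max.
move=> m; apply: multiplier_iter.
rewrite (_ : (fun x => _) = (fun x => sin (dot (tdelta i k.+1%:R^-1) x) * cos (a / k.+1%:R) +
   cos (dot (tdelta i k.+1%:R^-1) x) * (- sin (a / k.+1%:R)))).
  apply: multiplierD; apply: multiplierM; [exact: multiplier_sin|exact: multiplier_cst|
     exact: multiplier_cos|exact: multiplier_cst].
by apply: funext => x; rewrite mulrBl sinB dot_delta [_^-1 * _]mulrC mulrN.
Qed.

Definition mult_sets : set (set V) := [set A | measurable A /\ multiplier (\1_A)].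

Lemma mult_sets_sigma : sigma_algebra setT mult_sets.
Proof.
split.
- split => //; rewrite (_ : \1_set0 = fun=> 0); first exact: multiplier_cst.
  by rewrite indic0.
- move=> A [mA hA]; split; first exact: measurableD.
  rewrite (_ : \1_(setT `\` A) = fun x => 1 + (-1) * \1_A x).
    apply: multiplierD; first exact: multiplier_cst.
    by apply: multiplierM => //; exact: multiplier_cst.
  apply: funext => x; rewrite setTD !indicE in_setC.
  by case: (x \in A); rewrite /=; ring.
- move=> A hA; split; first by apply: bigcupT_measurable => k; exact: (hA k).1.
  pose f N x : R := \prod_(k < N) (1 - \1_(A k) x).
  have mf N : multiplier (f N).
    elim: N => [|N IH].
      rewrite (_ : f 0%N = fun=> 1); first exact: multiplier_cst.
      by apply: funext => x; rewrite /f big_ord0.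
    rewrite (_ : f _ = fun x => f N x * (1 + (-1) * \1_(A N) x)).
      apply: multiplierM => //; apply: multiplierD; first exact: multiplier_cst.
      by apply: multiplierM; [exact: multiplier_cst | exact: (hA N).2].
    by apply: funext => x; rewrite /f big_ord_recr /=; congr (_ * _); ring.
  apply: (@multiplier_cvg (fun N x => 1 + (-1) * f N x) _ 2).
  + move=> N x; rewrite (le_trans (ler_normD _ _))// normr1 normrM normrN1 mul1r.
    have : `|f N x| <= 1.
      rewrite /f normr_prod; apply: prodr_ile1 => k _; rewrite normr_ge0/= indicE.
      by case: (_ \in _); rewrite ?subrr ?normr0 ?subr0 ?normr1.
    by lra.
  + move=> x; apply: cvg_near_cst.
    have [[k _ Akx]|nA] := pselect ((\bigcup_k A k) x).
      exists k.+1 => // N /= kN; rewrite indicE mem_set; last by exists k.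
      rewrite /f (bigD1 (Ordinal kN))//= indicE mem_set//= subrr mul0r.
      by ring.
    exists 0%N => // N _ /=; rewrite indicE memNset//= /f big1; first by ring.
    move=> i _; rewrite indicE memNset ?subr0// => Ai.
    by apply: nA; exists i.
  + move=> N; apply: multiplierD; first exact: multiplier_cst.
    by apply: multiplierM => //; exact: multiplier_cst.
Qed.

Lemma mult_sets_measurable (A : set V) : measurable A -> mult_sets A.
Proof.
move: A; apply: smallest_sub; first exact: mult_sets_sigma.
rewrite -bigcup_seq => B [i _ [C mC <-]].
rewrite setTI.
suff : [set C : set R | mult_sets ((@tnth n R)^~ i @^-1` C)] C by [].
have mC' : <<s @RGenOInfty.G R >> C by rewrite -[X in X C]/((@RGenOInfty.G R).-sigma.-measurable) -RGenOInfty.measurableE.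
move: C mC' {mC}; apply: smallest_sub.
  have [s0 sC sU] := mult_sets_sigma; split => /=.
  - by rewrite preimage_set0.
  - by move=> C hC; exact: (sC _ hC).
  - by move=> F hF; rewrite preimage_bigcup; exact: sU.
move=> _ [a ->] /=; split.
  rewrite -[X in measurable X]setTI.
  exact: (@measurable_tnth _ _ n i measurableT `]a, +oo[%classic (measurable_itv _)).
have msg := multiplier_sg i a.
(* The indicator of [y > 0] is [(sg y ^ 2 + sg y) / 2], which is also right at [y = 0]. *)
rewrite (_ : \1__ = fun x => (1/2) * (Num.sg (tnth x i - a) * Num.sg (tnth x i - a) + Num.sg (tnth x i - a))).
  apply: multiplierM; first exact: multiplier_cst.
  by apply: multiplierD => //; exact: multiplierM.
apply: funext => x; rewrite indicE.
rewrite (_ : (x \in _) = (a < tnth x i)); last first.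
  by apply/idP/idP => [/set_mem|h]; [|apply/mem_set]; rewrite /= in_itv/= andbT.
rewrite -subr_gt0; case: (sgrP (tnth x i - a)) => h /=; by field.
Qed.

Theorem char_unique :
  (forall th, agree (fun x => cos (dot th x)) /\ agree (fun x => sin (dot th x))) ->
  forall A, measurable A -> P1 (V1 @^-1` A) = P2 (V2 @^-1` A).
Proof.
move=> H A mA.
have t1 : trig_agree (fun=> 1).
  split; first exact: bmf_cst.
  by move=> th; have [h1 h2] := H th; split; [move: h1|move: h2]; congr agree;
    apply: funext => x; rewrite mul1r.
(* The multiplier [\1_A] is applied to the constant [1] and evaluated at frequency zero, where the
   cosine is [1] and only the probability of [A] remains. *)
have [_ [_ /(_ _ t1) [_ /(_ (topp [tuple 0 | i < n]))]]] := mult_sets_measurable mA.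
rewrite /agree => -[h _]; move: h.
have dot0 x : dot (topp [tuple 0 | i < n]) x = 0.
  by rewrite /dot big1// => i _; rewrite !tnth_mktuple oppr0 mul0r.
have E d (T : measurableType d) (P : probability T R) (W : T -> V) :
    measurable_fun setT W ->
    Ex P (fun w => \1_A (W w) * 1 * cos (dot (topp [tuple 0 | i < n]) (W w))) = fine (P (W @^-1` A)).
  move=> mW; rewrite -Ex_indic; last by rewrite -[X in measurable X]setTI; exact: mW.
  by apply: eq_Ex => w; rewrite dot0 cos0 !mulr1 !indicE.
rewrite !E// => h.
by rewrite -[LHS]fineK ?fin_num_measure//; last (by rewrite -[X in measurable X]setTI; exact: mV1);
  rewrite h fineK// fin_num_measure// -[X in measurable X]setTI; exact: mV2.
Qed.

End uniqueness.

(** * Trigonometric inequalities *)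

Section trig_bounds.
Variable R : realType.
Implicit Types x y : R.

Lemma sin_mvt x : 0 <= x -> exists2 c, 0 <= c <= x & sin x = cos c * x.
Proof.
move=> x0; have [c] := @MVT_segment R sin cos 0 x x0
  (fun y _ => is_derive_sin y) (continuous_subspaceT (@continuous_sin R)).
by rewrite sin0 !subr0 in_itv/= => c0 e; exists c.
Qed.

Lemma abs_sin_le x : `|sin x| <= `|x|.
Proof.
wlog x0 : x / 0 <= x => [h|].
  have [/h//|x0] := leP 0 x.
  by rewrite -normrN -sinN -[leRHS]normrN h// oppr_ge0 ltW.
have [c _ ->] := sin_mvt x0; rewrite normrM ler_piMl//; exact: cos_max.
Qed.

Lemma one_sub_cosE x : 1 - cos x = 2 * sin (x / 2) ^+ 2.
Proof.
have -> : cos x = cos (x / 2 + x / 2) by congr cos; field.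
by rewrite cosD -!expr2 cos2sin2; ring.
Qed.

Lemma one_sub_cos_ge0 x : 0 <= 1 - cos x.
Proof. by rewrite subr_ge0 cos_le1. Qed.

Lemma one_sub_cos_le x : 1 - cos x <= x ^+ 2 / 2.
Proof.
rewrite one_sub_cosE; have := abs_sin_le (x / 2).
rewrite -ler_sqr ?nnegrE// !real_normK ?num_real// expr_div_n; lra.
Qed.

Lemma cos_ge x : 1 - x ^+ 2 / 2 <= cos x.
Proof. by have := one_sub_cos_le x; lra. Qed.

Lemma abs_sin_ge x : `|x| <= 1 -> `|x| / 2 <= `|sin x|.
Proof.
wlog x0 : x / 0 <= x => [h|].
  have [/h//|x0] := leP 0 x.
  by rewrite -(normrN x) -(normrN (sin x)) -sinN; apply: h; rewrite oppr_ge0 ltW.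
rewrite (ger0_norm x0) => x1; have [c /andP[c0 cx] ->] := sin_mvt x0.
have hc : 1 / 2 <= cos c.
  apply: le_trans (cos_ge c).
  have : c ^+ 2 <= 1 by rewrite expr_le1//; lra.
  lra.
by rewrite ger0_norm ?mulr_ge0//; [nra|lra].
Qed.

Lemma one_sub_cos_ge x : `|x| <= 2 -> x ^+ 2 / 8 <= 1 - cos x.
Proof.
move=> x2; rewrite one_sub_cosE.
have : `|x / 2| <= 1 by rewrite normrM (@ger0_norm _ 2^-1)//; lra.
move=> /abs_sin_ge; rewrite -ler_sqr ?nnegrE ?divr_ge0// expr_div_n !real_normK ?num_real//.
by rewrite expr_div_n; lra.
Qed.

Lemma abs_sub_sin_le x : `|x - sin x| <= 2 * x ^+ 2.
Proof.
wlog x0 : x / 0 <= x => [h|].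
  have [/h//|x0] := leP 0 x.
  have := h (- x); rewrite sinN sqrrN oppr_ge0 => /(_ (ltW x0)).
  by rewrite -opprB normrN opprK addrC.
have [c /andP[c0 cx] ->] := sin_mvt x0.
have -> : x - cos c * x = x * (1 - cos c) by ring.
rewrite ger0_norm ?mulr_ge0 ?one_sub_cos_ge0//.
have [x1|x1] := leP x 1.
  have := one_sub_cos_le c; have : c ^+ 2 <= x ^+ 2 by rewrite ler_sqr ?nnegrE.
  have : x ^+ 2 <= x by rewrite expr2 ler_piMl.
  by have := one_sub_cos_ge0 c; nra.
by have := cos_geN1 c; nra.
Qed.

(* Averaging [cos] over finitely many frequencies replaces, in the tail bound, the
   usual integral of the characteristic function near [0]. *)
Lemma dirichlet_sum (h : R) (N : nat) :
  (\sum_(j < N) cos ((j%:R + 1 / 2) * h)) * (2 * sin (h / 2)) = sin (N%:R * h).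
Proof.
elim: N => [|N IH]; first by rewrite big_ord0 !mul0r sin0.
rewrite big_ord_recr mulrDl IH /=.
have e1 : (N%:R + 1 / 2) * h = N%:R * h + h / 2 by field.
have -> : N.+1%:R * h = N%:R * h + h / 2 + h / 2 by rewrite -natr1; field.
rewrite e1; set a := N%:R * h; set b := h / 2.
have -> : sin (a + b + b) = sin (a + b) * cos b + cos (a + b) * sin b by rewrite sinD.
have {1}-> : a = a + b - b by ring.
by rewrite sinB; ring.
Qed.

(** The closed form bounds the sum by [1 / (2 |sin (x / 2N)|)]. Since [|x / 2N| <= 1], that sine is
    at least [|x| / 4N] in absolute value, so the average is at most [2 / |x|]; hence the constant
    [4]. *)
Lemma dirichlet_le (x : R) (N : nat) : (0 < N)%N -> 4 <= `|x| <= 2 * N%:R ->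
  N%:R^-1 * \sum_(j < N) cos ((j%:R + 1 / 2) * (x / N%:R)) <= 1 / 2.
Proof.
move=> N0 /andP[x4 xN]; have N0' : 0 < N%:R :> R by rewrite ltr0n.
have := dirichlet_sum (x / N%:R) N; set S := \sum_(_ < _) _.
rewrite [N%:R * _]mulrC divfK ?gt_eqF// => hS.
have e : `|x / N%:R / 2| = `|x| / N%:R / 2.
  by rewrite !normrM !normfV (ger0_norm (ltW N0')) (@ger0_norm _ 2).
have y1 : `|x / N%:R / 2| <= 1 by rewrite e !ler_pdivrMr//; lra.
have := abs_sin_ge y1; set s := sin _ in hS * => hs.
have h1 : `|S| * (2 * `|s|) <= 1.
  have -> : `|S| * (2 * `|s|) = `|S * (2 * s)| by rewrite !normrM (@ger0_norm _ 2).
  by rewrite hS; exact: sin_max.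
rewrite e in hs.
have h2 : `|S| * (2 * (`|x| / N%:R / 2 / 2)) <= 1.
  by apply: le_trans h1; rewrite ler_wpM2l// ler_wpM2l.
have h3 : N%:R^-1 * `|S| * (`|x| / 2) <= 1.
  by apply: le_trans h2; rewrite le_eqVlt; apply/orP; left; apply/eqP; field; rewrite gt_eqF.
apply: (@le_trans _ _ (N%:R^-1 * `|S|)); first by apply: ler_wpM2l; [rewrite invr_ge0 ltW | exact: ler_norm].
have : 0 <= N%:R^-1 * `|S| by rewrite mulr_ge0// invr_ge0 ltW.
by set u := _ * `|S| in h3 *; nra.
Qed.

End trig_bounds.

(** * Product spaces, laws of functions and a tail bound *)

Section induction_bmf.
Context d (S : measurableType d) (R : realType).

(** Induction on bounded measurable functions. After an affine normalisation to [[0, 1]], the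
    layer-cake averages converge uniformly, so the three closure conditions suffice. *)
Lemma bmf_ind (Q : (S -> R) -> Prop) :
  (forall A, measurable A -> Q (\1_A)) ->
  (forall a b f g, bmf f -> bmf g -> Q f -> Q g -> Q (fun x => a * f x + b * g x)) ->
  (forall (f_ : nat -> S -> R) f K, (forall k, bmf (f_ k)) ->
     (forall k x, `|f_ k x| <= K) -> (forall x, f_ k x @[k --> \oo] --> f x) ->
     (forall k, Q (f_ k)) -> Q f) ->
  forall g, bmf g -> Q g.
Proof.
move=> Qi Ql Qc g [mg [c gc]].
have QT : Q (fun=> 1) by have := Qi _ (@measurableT _ S); rewrite indicT.
have c0 : 0 <= c by apply: le_trans (gc point).
have c1 : 0 < c + c + 1 by rewrite ltr_wpDl ?addr_ge0.
pose h x : R := (g x + c + 1) / (c + c + 1).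
have h01 x : 0 <= h x <= 1.
  rewrite /h divr_ge0 ?(ltW c1)//=; last first.
    by have := gc x; rewrite ler_norml => /andP[]; lra.
  by rewrite ler_pdivrMr// mul1r; have := gc x; rewrite ler_norml => /andP[]; lra.
have mh : measurable_fun setT h.
  by apply: measurable_funM => //; do 2 apply: measurable_funD => //.
have bh : bmf h.
  by split => //; exists 1 => x; have /andP[? ?] := h01 x; rewrite ger0_norm.
have gE : g = fun x => (c + c + 1) * h x + (- (c + 1)) * 1.
  by apply: funext => x; rewrite /h mulrC divfK ?gt_eqF//; ring.
suff Qh : Q h by rewrite gE; apply: (Ql _ _ h (fun=> 1)) => //; exact: bmf_cst.
pose A N i : set S := [set x | i.+1%:R / N.+1%:R <= h x].
have mA N i : measurable (A N i) by exact: measurable_ge_set.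
pose s N M x : R := \sum_(i < M) \1_(A N i) x.
have bs N M : bmf (s N M) by apply: bmf_sum => i; exact: bmf_indic.
have Qs N M : Q (s N M).
  elim: M => [|M IH].
    rewrite (_ : s _ _ = fun x => 0 * 1 + 0 * 1).
      by apply: (Ql _ _ (fun=> 1) (fun=> 1)) => //; exact: bmf_cst.
    by apply: funext => x; rewrite /s big_ord0; ring.
  rewrite (_ : s _ _ = fun x => 1 * s N M x + 1 * \1_(A N M) x).
    by apply: Ql => //; [exact: bmf_indic|exact: Qi].
  by apply: funext => x; rewrite /s big_ord_recr /=; ring.
have sh N x : `|h x - N.+1%:R^-1 * s N N.+1 x| <= N.+1%:R^-1.
  rewrite /s (eq_bigr (fun i : 'I_N.+1 => (i.+1%:R / N.+1%:R <= h x)%R%:R)).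
    exact: layer_approx.
  move=> i _; rewrite indicE; congr (nat_of_bool _)%:R.
  by apply/idP/idP => [/set_mem//|?]; rewrite inE.
apply: (Qc (fun N x => N.+1%:R^-1 * s N N.+1 x) _ 2).
- by move=> N; exact: bmfZ.
- move=> N x; move: (sh N x); set u := _ * s _ _ _; have /andP[? ?] := h01 x.
  have : N.+1%:R^-1 <= 1 :> R by rewrite invf_le1 ?ltr0n// ler1n.
  by set v := _^-1; rewrite !ler_norml => ? /andP[? ?]; apply/andP; split; lra.
- move=> x; apply/cvgrPdist_le => e e0; near=> N; apply: le_trans (sh _ _) _.
  apply: le_trans (ler_norm _) _; near: N.
  by have /cvgr0_norm_le := @invSn_cvg0 R; apply.
move=> N; rewrite (_ : (fun x => _) = fun x => N.+1%:R^-1 * s N N.+1 x + 0 * 1).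
  by apply: (Ql _ _ _ (fun=> 1)) => //; exact: bmf_cst.
by apply: funext => x; ring.
Unshelve. all: by end_near. Qed.

End induction_bmf.

Section product_expectation.
Context (R : realType).

Lemma Ex_prob_cst d (T : measurableType d) (P : probability T R) c : Ex P (fun=> c) = c.
Proof. by rewrite Ex_cst [X in fine X](@probability_setT _ _ _ P) mulr1. Qed.

(** Passes a product rule from events to functions. It yields integration on product spaces, the
    change of variables for laws, and the replacement of an event by a trigonometric factor in
    [mixed_step]. *)
Lemma Ex_mul_of_indic d (T : measurableType d) (P : probability T R)
  d' (S : measurableType d') (Q : probability S R) (W : T -> S) (h : T -> R) (c : R) :
  measurable_fun setT W -> bmf h ->
  (forall A, measurable A -> Ex P (fun w => h w * \1_A (W w)) = c * fine (Q A)) ->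
  forall g, bmf g -> Ex P (fun w => h w * g (W w)) = c * Ex Q g.
Proof.
move=> mW bh H g; move: g; apply: bmf_ind.
- by move=> A mA; rewrite H// Ex_indic.
- move=> a b f g bf bg ef eg.
  have bfW := bmf_comp_meas mW bf; have bgW := bmf_comp_meas mW bg.
  rewrite ExD ?ExZ//; try exact: bmfZ.
  rewrite mulrDr !(mulrCA c) -ef -eg -!ExZ -?ExD; try by repeat (apply: bmfM || apply: bmf_cst || done).
  by apply: eq_Ex => w; ring.
- move=> f_ f K bf fK cf ef.
  have [mh [L hL]] := bh.
  have c1 : Ex P (fun w => h w * f_ k (W w)) @[k --> \oo] --> Ex P (fun w => h w * f (W w)).
    apply: (@Ex_cvg _ _ _ _ (fun k w => h w * f_ k (W w)) _ (L * K)).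
    + by move=> k; exact: (bmfM bh (bmf_comp_meas mW (bf k))).1.
    + by move=> k w; rewrite normrM ler_pM.
    + by move=> w; apply: cvgMl_tmp; exact: cf.
  have c2 : c * Ex Q (f_ k) @[k --> \oo] --> c * Ex Q f.
    by apply: cvgMl_tmp; apply: (@Ex_cvg _ _ _ _ f_ _ K) => // k; exact: (bf k).1.
  apply: (@cvg_unique _ _ (Ex P (fun w => h w * f_ k (W w)) @[k --> \oo])) => //.
  rewrite (_ : (fun k => _) = fun k => c * Ex Q (f_ k))//.
  by apply: funext => k; exact: ef.
Qed.

Definition prodP d1 (T1 : measurableType d1) (P1 : probability T1 R)
  d2 (T2 : measurableType d2) (P2 : probability T2 R) : probability (T1 * T2)%type R :=
  (P1 \x P2)%E.

Lemma Ex_prod d1 (T1 : measurableType d1) (P1 : probability T1 R)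
  d2 (T2 : measurableType d2) (P2 : probability T2 R) f g : bmf f -> bmf g ->
  Ex (prodP P1 P2) (fun w => f w.1 * g w.2) = Ex P1 f * Ex P2 g.
Proof.
move=> bf bg.
apply: (@Ex_mul_of_indic _ _ (prodP P1 P2) _ _ P2 snd (fun w => f w.1)) => //.
  exact: (bmf_comp_meas (@measurable_fst _ _ T1 T2) bf).
move=> B mB.
have -> : Ex (prodP P1 P2) (fun w => f w.1 * \1_B w.2) =
          Ex (prodP P1 P2) (fun w => \1_B w.2 * f w.1).
  by apply: eq_Ex => w; rewrite mulrC.
rewrite mulrC.
apply: (@Ex_mul_of_indic _ _ (prodP P1 P2) _ _ P1 fst (fun w => \1_B w.2)) => //.
  exact: (bmf_comp_meas (@measurable_snd _ _ T1 T2) (bmf_indic R mB)).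
move=> A mA; rewrite (_ : (fun w => _) = \1_(A `*` B)).
  rewrite Ex_indic; last exact: measurableX.
  rewrite [X in fine X](product_measure1E P1 P2 mA mB).
  by rewrite fineM ?fin_num_measure// mulrC.
apply: funext => w; rewrite !indicE -natrM mulnb; congr (nat_of_bool _)%:R.
apply/andP/idP => [[/set_mem h1 /set_mem h2]|/set_mem[h1 h2]]; first by apply/mem_set.
by split; apply/mem_set.
Qed.

(** Let [A] be the average of [cos] over the frequencies [(j + 1/2) a / N], all at most [a]. The
    hypothesis bounds the mean of [1 - A] by [eta], while [dirichlet_le] gives [A <= 1/2] on [E N];
    so the indicator of [E N] is at most [2 (1 - A)], and [N] tends to infinity. *)
Lemma tail_bound d (T : measurableType d) (P : probability T R) (Y : T -> R) (a eta : R) :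
  measurable_fun setT Y -> 0 < a ->
  (forall th, `|th| <= a -> 1 - Ex P (fun w => cos (th * Y w)) <= eta) ->
  fine (P [set w | 4 <= a * `|Y w|]) <= 2 * eta.
Proof.
move=> mY a0 H.
pose E N := [set w | 4 <= a * `|Y w| /\ a * `|Y w| <= 2 * N%:R].
have maY : measurable_fun setT (fun w => a * `|Y w|).
  by apply: measurable_funM => //; exact: measurableT_comp.
have mE N : measurable (E N).
  rewrite (_ : E N = (fun w => a * `|Y w|) @^-1` `[4, 2 * N%:R]%classic).
    by rewrite -[X in measurable X]setTI; apply: maY.
  by apply/seteqP; split => w /=; rewrite in_itv/= => /andP.
have mE' : measurable [set w | 4 <= a * `|Y w|] := measurable_ge_set maY 4.
have EN N : (0 < N)%N -> Ex P (\1_(E N)) <= 2 * eta.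
  move=> N0; have N0' : 0 < N%:R :> R by rewrite ltr0n.
  pose A w := N%:R^-1 * \sum_(j < N) cos ((j%:R + 1 / 2) / N%:R * a * Y w).
  have bc th : bmf (fun w => cos (th * Y w)) by apply: bmf_cos; exact: measurable_funM.
  have bA : bmf A by apply: bmfZ; apply: bmf_sum => j; exact: bc.
  have EA : 1 - Ex P A <= eta.
    rewrite /A ExZ; last by apply: bmf_sum => j; exact: bc.
    rewrite Ex_sum; last by move=> j; exact: bc.
    have h : \sum_(j < N) (1 - eta) <= \sum_(j < N) Ex P (fun w => cos ((j%:R + 1 / 2) / N%:R * a * Y w)).
      apply: ler_sum => j _; rewrite lerBlDr -lerBlDl; apply: H.
      have j0 : 0 <= (j%:R + 1 / 2) / N%:R :> R by rewrite divr_ge0 ?addr_ge0// ltW.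
      rewrite normrM (ger0_norm j0) (gtr0_norm a0) ler_piMl ?(ltW a0)//.
      rewrite ler_pdivrMr// mul1r; have : j.+1%:R <= N%:R :> R by rewrite ler_nat.
      by rewrite -natr1; lra.
    move: h; rewrite sumr_const card_ord -[(1 - eta) *+ N]mulr_natl => h.
    have : N%:R^-1 * (N%:R * (1 - eta)) <= N%:R^-1 * \sum_(j < N) Ex P (fun w => cos ((j%:R + 1 / 2) / N%:R * a * Y w)).
      apply: ler_wpM2l; first by rewrite invr_ge0 ltW. exact: h.
    by rewrite mulKf ?gt_eqF//; lra.
  have : Ex P (\1_(E N)) <= Ex P (fun w => 2 * (1 - A w)).
    apply: Ex_le; first exact: bmf_indic.
      by apply: bmfZ; apply: bmfB => //; exact: bmf_cst.
    move=> w; rewrite indicE.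
    have A1 : A w <= 1.
      rewrite /A ler_pdivrMl// mulr1.
      apply: (@le_trans _ _ (\sum_(j < N) (1 : R))); first by apply: ler_sum => j _; exact: cos_le1.
      by rewrite sumr_const card_ord.
    have [/set_mem [h1 h2]|_] := boolP (w \in E N); last by rewrite mulr_ge0//; lra.
    have : A w <= 1 / 2.
      have aY : `|a * Y w| = a * `|Y w| by rewrite normrM (gtr0_norm a0).
      have := @dirichlet_le R (a * Y w) N N0; rewrite aY h1 h2 => /(_ isT).
      apply: le_trans; rewrite le_eqVlt; apply/orP; left; apply/eqP; congr (_ * _).
      by apply: eq_bigr => j _; congr cos; ring.
    by rewrite /=; lra.
  rewrite ExZ; last by apply: bmfB => //; exact: bmf_cst.
  by rewrite ExB ?Ex_prob_cst//; [lra|exact: bmf_cst].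
have c : Ex P (\1_(E N)) @[N --> \oo] --> Ex P (\1_[set w | 4 <= a * `|Y w|]).
  apply: (@Ex_cvg _ _ _ _ (fun N => \1_(E N)) _ 1).
  - by move=> N; exact: measurable_indic.
  - by move=> N w; exact: abs_indic_le1.
  move=> w; apply: cvg_near_cst; near=> N; rewrite !indicE; congr (nat_of_bool _)%:R.
  apply/idP/idP => /set_mem => [[h1 _]|h1]; apply/mem_set => //; split => //.
  have : a * `|Y w| <= N%:R by near: N; exact: nbhs_infty_ger.
  by have : 0 <= N%:R :> R by []; lra.
rewrite -Ex_indic// -(cvg_lim _ c)//; apply: limr_le; first by apply/cvg_ex; eexists; exact: c.
by near=> N; apply: EN; near: N; exists 1%N.
Unshelve. all: by end_near. Qed.

End product_expectation.

(** * Characteristic functions realised by processes *)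

Local Open Scope complex_scope.

Section complex_numbers.
Variable R : realType.
Local Notation C := R[i].
Implicit Types (z w : C) (x y : R).

Definition cn z : R := Normc.normc z.

Lemma cnE z : cn z = Num.sqrt (complex.Re z ^+ 2 + complex.Im z ^+ 2).
Proof. by case: z. Qed.

Lemma cn_sqr z : cn z ^+ 2 = complex.Re z ^+ 2 + complex.Im z ^+ 2.
Proof. by rewrite cnE sqr_sqrtr// addr_ge0 ?sqr_ge0. Qed.

Lemma cn_ge0 z : 0 <= cn z. Proof. by rewrite cnE sqrtr_ge0. Qed.

Lemma cnM z w : cn (z * w) = cn z * cn w. Proof. exact: Normc.normcM. Qed.

Lemma cnD z w : cn (z + w) <= cn z + cn w. Proof. exact: le_normcD. Qed.

Lemma cnN z : cn (- z) = cn z. Proof. exact: normcN. Qed.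

Lemma cn0 : cn 0 = 0. Proof. exact: Normc.normc0. Qed.

Lemma cn1 : cn 1 = 1. Proof. exact: Normc.normc1. Qed.

Lemma cnX z n : cn (z ^+ n) = cn z ^+ n.
Proof. by elim: n => [|n IH]; rewrite ?expr0 ?cn1// !exprS cnM IH. Qed.

Lemma abs_Re_le z : `|complex.Re z| <= cn z.
Proof.
rewrite -ler_sqr ?nnegrE ?cn_ge0// cn_sqr real_normK ?num_real//.
by rewrite lerDl sqr_ge0.
Qed.

Lemma abs_Im_le z : `|complex.Im z| <= cn z.
Proof.
rewrite -ler_sqr ?nnegrE ?cn_ge0// cn_sqr real_normK ?num_real//.
by rewrite lerDr sqr_ge0.
Qed.

Lemma cn_le z : cn z <= `|complex.Re z| + `|complex.Im z|.
Proof.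
rewrite -ler_sqr ?nnegrE ?cn_ge0 ?addr_ge0// cn_sqr.
rewrite -[complex.Re z ^+ 2]real_normK ?num_real// -[complex.Im z ^+ 2]real_normK ?num_real//.
have := normr_ge0 (complex.Re z); have := normr_ge0 (complex.Im z); nra.
Qed.

Lemma cn_real x : cn (x%:C) = `|x|.
Proof. by rewrite cnE /= expr0n addr0 sqrtr_sqr. Qed.

Definition cexp y : C := cos y +i* sin y.

Lemma cexpD x y : cexp (x + y) = cexp x * cexp y.
Proof.
by apply/eqP; rewrite eq_complex /= cosD sinD eqxx/= addrC eqxx.
Qed.

Lemma cexp0 : cexp 0 = 1.
Proof. by rewrite /cexp cos0 sin0. Qed.

Lemma cn_cexp y : cn (cexp y) = 1.
Proof. by rewrite cnE /= cos2Dsin2 sqrtr1. Qed.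

Definition cE w : C := (expR (complex.Re w))%:C * cexp (complex.Im w).

Lemma cED z w : cE (z + w) = cE z * cE w.
Proof.
case: z => a b; case: w => a' b'; rewrite /cE /= expRD cexpD rmorphM/=.
by rewrite mulrACA.
Qed.

Lemma cE0 : cE 0 = 1.
Proof. by rewrite /cE /= expR0 cexp0 mulr1. Qed.

Lemma cEMn w n : cE (w *+ n) = cE w ^+ n.
Proof. by elim: n => [|n IH]; rewrite ?mulr0n ?cE0 ?expr0// mulrS cED exprS IH. Qed.

Lemma cn_cE w : cn (cE w) = expR (complex.Re w).
Proof. by rewrite /cE cnM cn_cexp mulr1 cn_real ger0_norm// expR_ge0. Qed.

(** The upper bound is [exp a <= 1 / (1 - a)] combined with
    [(1 + a + a^2) (1 - a) = 1 - a^3 >= 1]. *)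
Lemma exp_npos_bounds (a : R) : a <= 0 -> 1 + a <= expR a /\ expR a <= 1 + a + a ^+ 2.
Proof.
move=> a0; split; first exact: expR_ge1Dx.
have h : 1 - a <= expR (- a) by have := expR_ge1Dx (- a).
have e0 := expR_gt0 a.
have e1 : expR a * expR (- a) = 1 by rewrite -expRD subrr expR0.
have h2 : expR a * (1 - a) <= 1 by rewrite -[leRHS]e1 ler_pM2l.
have a1 : 0 < 1 - a by lra.
rewrite -(ler_pM2r a1); apply: le_trans h2 _.
have -> : (1 + a + a ^+ 2) * (1 - a) = 1 + a ^+ 2 * (- a) by ring.
by rewrite lerDl mulr_ge0 ?sqr_ge0// oppr_ge0.
Qed.

(** In the left half-plane the exponential has modulus at most one, so the quadratic remainder bound
    holds without restricting [|w|]. *)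
Lemma cE_taylor w : complex.Re w <= 0 -> cn (cE w - 1 - w) <= 4 * cn w ^+ 2.
Proof.
move=> a0; rewrite cn_sqr; apply: le_trans (cn_le _) _.
have -> : complex.Re (cE w - 1 - w) = expR (complex.Re w) * cos (complex.Im w) - 1 - complex.Re w.
  by rewrite !raddfB /= mul0r subr0.
have -> : complex.Im (cE w - 1 - w) = expR (complex.Re w) * sin (complex.Im w) - complex.Im w.
  by rewrite !raddfB /= mul0r addr0 subr0.
move: (complex.Re w) (complex.Im w) a0 => a b a0.
have [h1 h2] := exp_npos_bounds a0.
have := one_sub_cos_le b; have := one_sub_cos_ge0 b; have := abs_sub_sin_le b.
have := expR_gt0 a; set e := expR a in h1 h2 *.
have e1 : e <= 1 by rewrite /e -expR0 ler_expR.
move=> e0 hs hc0 hc.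
have r1 : `|e * cos b - 1 - a| <= a ^+ 2 + b ^+ 2 / 2.
  have -> : e * cos b - 1 - a = (e - 1 - a) - e * (1 - cos b) by ring.
  have : 0 <= e * (1 - cos b) <= b ^+ 2 / 2.
    by rewrite (mulr_ge0 (ltW e0) hc0)/= (le_trans _ hc)// ler_piMl.
  by move=> /andP[? ?]; rewrite ler_norml; apply/andP; split; nra.
have r2 : `|e * sin b - b| <= `|a| * `|b| + 2 * b ^+ 2.
  have -> : e * sin b - b = (e - 1) * sin b - (b - sin b) by ring.
  apply: le_trans (ler_normB _ _) _; apply: lerD => //.
  rewrite normrM ler_pM//; last exact: abs_sin_le.
  by rewrite ler0_norm ?(ler0_norm a0); lra.
have : `|a| * `|b| <= (a ^+ 2 + b ^+ 2) / 2.
  rewrite -[a ^+ 2]real_normK ?num_real// -[b ^+ 2]real_normK ?num_real//.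
  by have := sqr_ge0 (`|a| - `|b|); rewrite sqrrB; lra.
have := sqr_ge0 a; have := sqr_ge0 b; lra.
Qed.

Lemma cn_subX z w n : cn z <= 1 -> cn w <= 1 -> cn (z ^+ n - w ^+ n) <= n%:R * cn (z - w).
Proof.
move=> z1 w1; elim: n => [|n IH]; first by rewrite !expr0 subrr cn0 mul0r.
have -> : z ^+ n.+1 - w ^+ n.+1 = z * (z ^+ n - w ^+ n) + (z - w) * w ^+ n.
  by rewrite !exprS; ring.
apply: le_trans (cnD _ _) _; rewrite !cnM -natr1 mulrDl mul1r; apply: lerD.
  by apply: le_trans IH; rewrite ler_piMl ?cn_ge0.
by rewrite ler_piMr ?cn_ge0// cnX exprn_ile1 ?cn_ge0.
Qed.

Definition ccvg (F : set_system nat) (z : nat -> C) (l : C) :=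
  cn (z k - l) @[k --> F] --> 0.

Section filter.
Variables (F : set_system nat) (FF : ProperFilter F).

Lemma ccvg_ReIm (z : nat -> C) (l : C) : ccvg F z l <->
  (complex.Re (z k) @[k --> F] --> complex.Re l /\
   complex.Im (z k) @[k --> F] --> complex.Im l).
Proof.
split=> [h|[h1 h2]].
  split; apply/cvgrPdist_le => e e0; move/cvgr0_norm_le : h => /(_ _ e0);
    apply: filterS => k; rewrite (ger0_norm (cn_ge0 _)); apply: le_trans.
    by rewrite distrC; have := abs_Re_le (z k - l); rewrite raddfB.
  by rewrite distrC; have := abs_Im_le (z k - l); rewrite raddfB.
rewrite /ccvg.
have h0 : `|complex.Re (z k) - complex.Re l| + `|complex.Im (z k) - complex.Im l| @[k --> F] --> (0 : R).
  rewrite -[0]addr0; apply: cvgD; rewrite -[X in _ --> X](normr0 R); apply: cvg_norm;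
    [rewrite -(subrr (complex.Re l)) | rewrite -(subrr (complex.Im l))];
    by apply: cvgB => //; exact: cvg_cst.
apply: (squeeze_cvgr _ (cvg_cst 0) h0); apply: nearW => k.
by rewrite cn_ge0/=; have := cn_le (z k - l); rewrite !raddfB.
Qed.

(** The limit of [(1 + w_k / n_k) ^ n_k], obtained without logarithms: [cE l] is the [n_k]-th power
    of [cE (l / n_k)], both bases lie in the unit disc, and there powers differ by at most [n_k]
    times the difference of the bases. *)
Lemma power_cvg (z w : nat -> C) (l : C) (n : nat -> nat) :
  (forall k, (0 < n k)%N) -> (n k)%:R^-1 @[k --> F] --> (0 : R) ->
  (forall k, z k = 1 + (n k)%:R^-1 * w k) -> (forall k, cn (z k) <= 1) ->
  complex.Re l <= 0 -> ccvg F w l -> ccvg F (fun k => z k ^+ n k) (cE l).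
Proof.
move=> n0 nV zE z1 l0 wl; rewrite /ccvg.
have h0 : cn (w k - l) + 4 * cn l ^+ 2 * (n k)%:R^-1 @[k --> F] --> (0 : R).
  rewrite -[0]addr0; apply: cvgD => //; rewrite -[X in _ --> X](mulr0 (4 * cn l ^+ 2)).
  exact: cvgMl_tmp.
apply: (squeeze_cvgr _ (cvg_cst 0) h0); apply: nearW => k.
rewrite cn_ge0/=.
have nk : (n k)%:R != 0 :> C by rewrite pnatr_eq0 -lt0n.
have nk0 : 0 < (n k)%:R :> R by rewrite ltr0n.
pose v := (n k)%:R^-1 * l.
have cnV : cn ((n k)%:R^-1) = (n k)%:R^-1.
  have -> : (n k)%:R^-1 = ((n k)%:R^-1 : R)%:C :> C by rewrite fmorphV rmorph_nat.
  by rewrite cn_real ger0_norm// invr_ge0 ltW.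
have lE : cE l = cE v ^+ n k.
  by rewrite -cEMn; congr cE; rewrite /v -[RHS]mulr_natl mulrA divff// mul1r.
have vl : complex.Re v = (n k)%:R^-1 * complex.Re l.
  rewrite /v; have -> : (n k)%:R^-1 = ((n k)%:R^-1 : R)%:C :> C by rewrite fmorphV rmorph_nat.
  by case: (l) => a b /=; rewrite mul0r subr0.
have v0 : complex.Re v <= 0 by rewrite vl mulr_ge0_le0// invr_ge0 ltW.
rewrite lE; apply: le_trans (cn_subX _ _ _) _ => //.
  by rewrite cn_cE -expR0 ler_expR.
have -> : z k - cE v = (n k)%:R^-1 * (w k - l) - (cE v - 1 - v).
  by rewrite zE /v; ring.
apply: (@le_trans _ _ ((n k)%:R * ((n k)%:R^-1 * cn (w k - l) + 4 * ((n k)%:R^-1 * cn l) ^+ 2))).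
  apply: ler_wpM2l; first exact: ltW.
  apply: le_trans (cnD _ _) _; rewrite cnN cnM cnV lerD2l.
  by apply: le_trans (cE_taylor v0) _; rewrite /v cnM cnV.
by rewrite le_eqVlt; apply/orP; left; apply/eqP; field; rewrite gt_eqF.
Qed.

End filter.

End complex_numbers.

Section char_functions.
Variable R : realType.
Local Notation C := R[i].

Definition cf d (T : measurableType d) (P : probability T R) (Y : T -> R) : C :=
  Ex P (fun w => cos (Y w)) +i* Ex P (fun w => sin (Y w)).

(** The modulus of a vector integral is at most the integral of the modulus: project the integrand
    on the direction of the integral [z] and apply the Cauchy-Schwarz inequality pointwise. *)
Lemma cn_Ex_le d (T : measurableType d) (mu : {finite_measure set T -> \bar R}) (f g h : T -> R) :
  bmf f -> bmf g -> bmf h -> (forall x, 0 <= h x) ->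
  (forall x, f x ^+ 2 + g x ^+ 2 <= h x ^+ 2) -> cn (Ex mu f +i* Ex mu g) <= Ex mu h.
Proof.
move=> bf bg bh h0 fgh; set z := _ +i* _.
have [n0|n0] := leP (cn z) 0; first by rewrite (le_trans n0)// Ex_ge0.
have e : cn z ^+ 2 = Ex mu (fun x => Ex mu f * f x + Ex mu g * g x).
  by rewrite cn_sqr /= ExD ?ExZ// ?expr2//; exact: bmfZ.
have : cn z ^+ 2 <= cn z * Ex mu h.
  rewrite {1}e -ExZ//; apply: Ex_le.
  - by apply: bmfD; exact: bmfZ.
  - exact: bmfZ.
  move=> x; have := cn_sqr z; rewrite /=; set a := Ex mu f; set b := Ex mu g.
  have := fgh x; have := h0 x; have := cn_ge0 z; set c := cn z.
  move: (f x) (g x) (h x) => u v w c0 w0 uvw cab.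
  have cw : 0 <= c * w by rewrite mulr_ge0.
  apply: le_trans (ler_norm _) _; rewrite -ler_sqr ?nnegrE//.
  rewrite real_normK ?num_real// exprMn cab.
  apply: (@le_trans _ _ ((a ^+ 2 + b ^+ 2) * (u ^+ 2 + v ^+ 2))).
    rewrite -subr_ge0; have -> : (a ^+ 2 + b ^+ 2) * (u ^+ 2 + v ^+ 2) - (a * u + b * v) ^+ 2 =
      (a * v - b * u) ^+ 2 by ring.
    exact: sqr_ge0.
  by rewrite ler_wpM2l// addr_ge0 ?sqr_ge0.
by rewrite expr2 ler_pM2l.
Qed.

Section cf_prob.
Variables (d : measure_display) (T : measurableType d) (P : probability T R).
Implicit Types Y : T -> R.

Lemma cf_le1 Y : measurable_fun setT Y -> cn (cf P Y) <= 1.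
Proof.
move=> mY; rewrite -[leRHS](Ex_prob_cst P); apply: cn_Ex_le.
- exact: bmf_cos.
- exact: bmf_sin.
- exact: bmf_cst.
- by move=> x.
- by move=> x; rewrite cos2Dsin2 expr1n.
Qed.

Lemma cf_sub_le Y Y' g : measurable_fun setT Y -> measurable_fun setT Y' -> bmf g ->
  (forall x, 0 <= g x) ->
  (forall x, (cos (Y x) - cos (Y' x)) ^+ 2 + (sin (Y x) - sin (Y' x)) ^+ 2 <= g x ^+ 2) ->
  cn (cf P Y - cf P Y') <= Ex P g.
Proof.
move=> mY mY' bg g0 H.
have -> : cf P Y - cf P Y' = Ex P (fun x => cos (Y x) - cos (Y' x)) +i* Ex P (fun x => sin (Y x) - sin (Y' x)).
  by rewrite !ExB//; [exact: bmf_sin|exact: bmf_sin|exact: bmf_cos|exact: bmf_cos].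
by apply: cn_Ex_le => //; apply: bmfB; by [exact: bmf_sin|exact: bmf_cos].
Qed.

Lemma eq_cf Y Y' : (forall x, Y x = Y' x) -> cf P Y = cf P Y'.
Proof. by move=> e; congr cf; apply: funext. Qed.

Lemma cf0 : cf P (fun=> 0) = 1.
Proof. by rewrite /cf !Ex_prob_cst cos0 sin0. Qed.

Lemma cf_cst c : cf P (fun=> c) = cexp c.
Proof. by rewrite /cf !Ex_prob_cst. Qed.

End cf_prob.

Lemma cf_prod d1 (T1 : measurableType d1) (P1 : probability T1 R)
  d2 (T2 : measurableType d2) (P2 : probability T2 R) (Y1 : T1 -> R) (Y2 : T2 -> R) :
  measurable_fun setT Y1 -> measurable_fun setT Y2 ->
  cf (prodP P1 P2) (fun w => Y1 w.1 + Y2 w.2) = cf P1 Y1 * cf P2 Y2.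
Proof.
move=> m1 m2.
have c1 := bmf_cos m1; have c2 := bmf_cos m2; have s1 := bmf_sin m1; have s2 := bmf_sin m2.
have b f g : bmf f -> bmf g -> bmf (fun w : T1 * T2 => f w.1 * g w.2 : R).
  move=> bf bg; apply: bmfM.
    exact: (bmf_comp_meas (@measurable_fst _ _ T1 T2) bf).
  exact: (bmf_comp_meas (@measurable_snd _ _ T1 T2) bg).
apply/eqP; rewrite eq_complex /=; apply/andP; split; apply/eqP.
  rewrite -!Ex_prod// -ExB//; [|exact: (b _ _ c1 c2)|exact: (b _ _ s1 s2)].
  by apply: eq_Ex => w; rewrite cosD.
rewrite -!Ex_prod// -ExD//; [|exact: (b _ _ c1 s2)|exact: (b _ _ s1 c2)].
by apply: eq_Ex => w; rewrite sinD addrC.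
Qed.

Definition lin (T : Type) (l : seq (R * R)) (X : @process R T) (w : T) : R :=
  \sum_(p <- l) p.1 * X p.2 w.

Lemma lin_nil T (X : @process R T) w : lin [::] X w = 0.
Proof. by rewrite /lin big_nil. Qed.

Lemma lin_cons T p l (X : @process R T) w : lin (p :: l) X w = p.1 * X p.2 w + lin l X w.
Proof. by rewrite /lin big_cons. Qed.

Lemma lin1 T a t (X : @process R T) w : lin [:: (a, t)] X w = a * X t w.
Proof. by rewrite lin_cons lin_nil addr0. Qed.

Lemma measurable_lin d (T : measurableType d) l (X : @process R T) :
  (forall t, measurable_fun setT (X t)) -> measurable_fun setT (lin l X).
Proof.
move=> mX; elim: l => [|p l IH].
  rewrite (_ : lin _ _ = fun=> 0); first exact: measurable_cst.
  by apply: funext => w; rewrite lin_nil.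
rewrite (_ : lin _ _ = fun w => p.1 * X p.2 w + lin l X w).
  by apply: measurable_funD => //; apply: measurable_funM.
by apply: funext => w; rewrite lin_cons.
Qed.

Record realization := Realization {
  r_disp : measure_display ;
  r_type : measurableType r_disp ;
  r_prob : probability r_type R ;
  r_proc : @process R r_type ;
  r_meas : forall t, measurable_fun setT (r_proc t) }.

Arguments r_proc : clear implicits.
Arguments r_meas : clear implicits.

Definition rcf (r : realization) (l : seq (R * R)) : C := cf (r_prob r) (lin l (r_proc r)).

(** A list pairs weights with times, so one functional on lists encodes the characteristic functions
    of all finite-dimensional distributions at once. *)
Definition realizable (Phi : seq (R * R) -> C) := exists r, forall l, rcf r l = Phi l.

(** Sums of independent processes, built on the product space. *)
Lemma realizable_mul Phi Psi : realizable Phi -> realizable Psi ->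
  realizable (fun l => Phi l * Psi l).
Proof.
move=> [r rP] [s sP].
have m t : measurable_fun setT (fun w : r_type r * r_type s => r_proc r t w.1 + r_proc s t w.2).
  apply: measurable_funD; apply: measurableT_comp => //; exact: r_meas.
exists (@Realization _ _ (prodP (r_prob r) (r_prob s)) (fun t w => r_proc r t w.1 + r_proc s t w.2) m) => l.
rewrite -rP -sP /rcf /= -cf_prod; [|exact/measurable_lin/r_meas..].
apply: eq_cf => w; rewrite /lin -big_split; apply: eq_bigr => p _ /=.
by rewrite mulrDr.
Qed.

Lemma realizable_shift (c : R -> R) :
  realizable (fun l => cexp (\sum_(p <- l) p.1 * c p.2)).
Proof.
pose P : probability unit R := dirac tt.
exists (@Realization _ _ P (fun t _ => c t) (fun t => measurable_cst (c t))) => l.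
by rewrite /rcf -(cf_cst P).
Qed.

Lemma realizable_exp Phi n : realizable Phi -> realizable (fun l => Phi l ^+ n).
Proof.
move=> h; elim: n => [|n IH].
  have [r rP] := realizable_shift (fun=> 0); exists r => l.
  by rewrite rP big1 ?cexp0// => p _; rewrite mulr0.
have [r rP] := realizable_mul h IH; exists r => l.
by rewrite rP exprS.
Qed.

End char_functions.
Arguments r_proc {R} r _ _.
Arguments r_meas {R} r t.
Arguments cn {R} z : simpl never.

Section unit_mass.
Context d (T : measurableType d) (R : realType).
Variable mu : {finite_measure set T -> \bar R}.

Definition prob_of (_ : mu setT = 1%E) : set T -> \bar R := mu.

Hypothesis h : mu setT = 1%E.

HB.instance Definition _ := Measure.on (prob_of h).
HB.instance Definition _ := Measure_isProbability.Build _ _ _ (prob_of h) h.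

Definition as_prob : probability T R := prob_of h.

End unit_mass.

(** * Limits of characteristic functions of processes *)

Section squash.
Variable R : realType.

(* A bounded coordinate on the line: [b = squash x] survives the passage to the
   Loeb space, and tightness makes [|b| = 1] negligible. *)
Definition squash (x : R) := x / (1 + `|x|).

Let d0 (x : R) : 0 < 1 + `|x|. Proof. by rewrite ltr_pwDl. Qed.

Lemma continuous_squash : continuous squash.
Proof.
move=> x; apply: cvgM; first exact: cvg_id.
apply: cvgV; first by rewrite gt_eqF.
by apply: cvgD; [exact: cvg_cst | apply: cvg_norm; exact: cvg_id].
Qed.

Lemma norm_squash x : `|squash x| = `|x| / (1 + `|x|).
Proof. by rewrite /squash normrM normfV (gtr0_norm (d0 x)). Qed.

Lemma squash_le1 x : `|squash x| <= 1.
Proof. by rewrite norm_squash ler_pdivrMr// mul1r lerDr. Qed.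

Lemma squashK x : squash x / (1 - `|squash x|) = x.
Proof.
rewrite norm_squash /squash; have := d0 x; set a := `|x| => a0.
have -> : 1 - a / (1 + a) = (1 + a)^-1 by field; rewrite gt_eqF.
by rewrite invrK divfK// gt_eqF.
Qed.

Lemma squash_big x M : 0 <= M -> M / (1 + M) < `|squash x| -> M < `|x|.
Proof.
move=> M0; rewrite norm_squash; have := d0 x; set a := `|x| => a0.
have M1 : 0 < 1 + M by lra.
by rewrite ltr_pdivrMr// mulrAC ltr_pdivlMr// !mulrDr !mulr1 [M * a]mulrC; lra.
Qed.

(* Written with a power rather than a quotient because [`^] is known to be
   measurable. *)
Definition unsquash (y : R) : R := y * ((1 - `|y|) `^ (-1)).

Lemma unsquashE y : `|y| < 1 -> unsquash y = y / (1 - `|y|).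
Proof. by move=> y1; rewrite /unsquash powR_inv1// subr_ge0 ltW. Qed.

Lemma measurable_unsquash : measurable_fun setT unsquash.
Proof.
apply: measurable_funM => //.
apply: (measurableT_comp (measurable_powR (-1))).
by apply: measurable_funB => //; exact: measurableT_comp.
Qed.

End squash.

Section realizable_limit.
Variables (R : realType) (U : set_system nat).
Hypotheses (UU : UltraFilter U) (Uoo : \oo `<=` U).
Variables (Phi_ : nat -> seq (R * R) -> R[i]) (Phi : seq (R * R) -> R[i]).
Hypothesis rPhi : forall k, realizable (Phi_ k).
Hypothesis cPhi : forall l, ccvg U (fun k => Phi_ k l) (Phi l).
Hypothesis tight : forall t eta : R, 0 < eta -> exists delta : R, 0 < delta /\
  U [set k | forall th : R, `|th| <= delta ->
       1 - complex.Re (Phi_ k [:: (th, t)]) <= eta].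

Let r k : realization R := sval (cid (rPhi k)).
Let rP k l : rcf (r k) l = Phi_ k l. Proof. by rewrite /r; case: cid. Qed.
Let T k := r_type (r k).
Let X k (t : R) : T k -> R := r_proc (r k) t.
Let mX k t : measurable_fun setT (@X k t). Proof. exact: r_meas. Qed.
Let I k := @Ex _ (T k) R (r_prob (r k)).

Let pI k : posfun (@I k) 1.
Proof.
split.
- by move=> f g bf bg; exact: ExD.
- by move=> c f bf; exact: ExZ.
- by move=> f bf f0; exact: Ex_ge0.
- by rewrite /I Ex_prob_cst.
Qed.

(** A form of the continuity theorem. [tight] bounds the tails of each [X t] separately, through the
    behaviour of the characteristic function near [0]. The limit process is the standard part of
    [X k t]; it is finite off the null set [N t], and a linear form meets only finitely many of
    these sets. *)
Theorem realizable_lim : realizable Phi.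
Proof.
have [mu muP] := @loeb_integral U UU _ T Uoo R (@I) 1 pI.
set S := g_sigma_algebraType _ in mu muP.
have muT : mu setT = 1%E.
  have n1 k (x : T k) : `|1 : R| <= 1 by rewrite normr1.
  have [_] := muP (fun _ _ => 1) 1 (fun k => measurable_cst _) n1.
  rewrite (_ : st _ = fun=> 1); last first.
    by apply: funext => w; rewrite /st; apply: cvg_lim => //; exact: cvg_cst.
  rewrite Ex_cst mul1r.
  have limI1 : lim (@I k (fun _ => 1) @[k --> U]) = 1.
    by apply: cvg_lim => //; apply: cvg_near_cst; apply: nearW => k; rewrite /I Ex_prob_cst.
  move=> h; have {}h := eq_trans h limI1.
  by rewrite -[LHS]fineK ?fin_num_measure// h.
pose b t := st (fun k x => squash (@X k t x)) : S -> R.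
have [mb bb] : (forall t, measurable_fun setT (b t)) /\
    (forall t w, squash (@X k t (w k)) @[k --> U] --> b t w).
  split => [t|t w].
    apply: (muP (fun k x => squash (@X k t x)) 1 _ _).1 => [k|k x]; last exact: squash_le1.
    apply: measurableT_comp => //; apply: continuous_measurable_fun.
    exact: continuous_squash.
  apply: (@ultra_cvg R U UU (fun k => squash (@X k t (w k))) 1) => k; exact: squash_le1.
pose Y t w := unsquash (b t w).
have mY t : measurable_fun setT (Y t).
  by apply: measurableT_comp => //; exact: measurable_unsquash.
pose N t : set S := [set w | 1 <= `|b t w|].
have mN t : measurable (N t).
  apply: measurable_ge_set.
  by apply: (measurableT_comp (@normr_measurable R setT) (mb t)).
have XY t w : ~ N t w -> @X k t (w k) @[k --> U] --> Y t w.
  move=> /negP; rewrite -ltNge => bw; rewrite /Y unsquashE//.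
  rewrite (_ : (fun k => _) = fun k => squash (@X k t (w k)) / (1 - `|squash (@X k t (w k))|)).
    apply: cvgM => //; apply: cvgV; first by rewrite gt_eqF// subr_gt0.
    by apply: cvgB; [exact: cvg_cst | apply: cvg_norm; exact: bb].
  by apply: funext => k; rewrite squashK.
(* If the standard part of the squashed value has modulus at least [1], then [|X k t|] exceeds any
   bound for [U]-many [k]. The bound [4 / de] is the one at which [tail_bound] applies, with
   probability at most [2 (e / 2)]. *)
have muN t : fine (mu (N t)) = 0.
  apply/eqP; rewrite eq_le fine_ge0// andbT; apply/ler_addgt0Pr => e e0; rewrite add0r.
  have e2 : 0 < e / 2 by rewrite divr_gt0.
  have [de [de0 Ude]] := tight t e2.
  pose B k : set (T k) := [set x | 4 <= de * `|@X k t x|].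
  have mB k : measurable (B k).
    apply: (@measurable_ge_set _ _ _ (fun x => de * `|@X k t x|)).
    by apply: measurable_funM => //; exact: measurableT_comp.
  have B1 k (x : T k) : `|\1_(B k) x : R| <= 1 by exact: abs_indic_le1.
  have [ms es] := muP (fun k => \1_(B k)) 1 (fun k => (bmf_indic R (mB k)).1) B1.
  have cB (w : S) : \1_(B k) (w k) @[k --> U] --> st (fun k => \1_(B k) : T k -> R) w.
    by apply: (@ultra_cvg R U UU (fun k => \1_(B k) (w k)) 1) => k; exact: B1.
  rewrite -Ex_indic//; apply: (@le_trans _ _ (Ex mu (st (fun k => \1_(B k) : T k -> R)))).
    apply: Ex_le.
    - exact: bmf_indic.
    - split => //; exists 1 => w.
      rewrite -(cvg_lim _ (cvg_norm (cB w)))//; apply: limr_le.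
        by apply/cvg_ex; eexists; apply: cvg_norm; exact: cB.
      exact: nearW.
    move=> w; rewrite indicE; have [/set_mem Nw|_] := boolP (w \in N t); last first.
      by apply: limr_ge; [apply/cvg_ex; eexists; exact: cB|apply: nearW => k; rewrite indicE].
    rewrite (_ : st _ w = 1)//; apply: cvg_lim => //; apply: cvg_near_cst.
    pose M := 4 / de.
    have M0 : 0 <= M by rewrite divr_ge0// ltW.
    have M1 : M / (1 + M) < 1 by rewrite ltr_pdivrMr ?mul1r; lra.
    have : \forall k \near U, M / (1 + M) < `|squash (@X k t (w k))|.
      have := cvgr_gt _ (cvg_norm (bb t w)) (M / (1 + M)); apply.
      exact: lt_le_trans Nw.
    apply: filterS => k /(squash_big M0) h; rewrite indicE mem_set// /B /=.
    by rewrite mulrC -ler_pdivrMr// ltW.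
  rewrite es; apply: limr_le.
    by apply: (@ultra_cvg R U UU _ (1 * 1)) => k; apply: (posfun_abs (pI k)) => //; exact: bmf_indic.
  apply: filterS Ude => k kd; rewrite /I Ex_indic//.
  have -> : e = 2 * (e / 2) by field.
  have tb := @tail_bound R _ (T k) (r_prob (r k)) (@X k t) de (e / 2) (@mX k t) de0.
  apply: tb.
  move=> th /kd; rewrite -rP; apply: le_trans; rewrite lerD2l lerN2 /rcf /=.
  rewrite le_eqVlt; apply/orP; left; apply/eqP; apply: eq_Ex => x.
  by rewrite lin1.
have linXY l w : (forall p, p \in l -> ~ N p.2 w) ->
    lin l (fun t => @X k t) (w k) @[k --> U] --> lin l Y w.
  rewrite /lin; elim: l => [|p l IH] h.
    by under eq_fun do [rewrite big_nil]; rewrite big_nil; exact: cvg_cst.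
  under eq_fun do [rewrite big_cons]; rewrite big_cons; apply: cvgD.
    by apply: cvgMl_tmp; apply: XY; apply: h; rewrite mem_head.
  by apply: IH => q ql; apply: h; rewrite inE ql orbT.
have key (f : R -> R) l : continuous f -> (forall y, `|f y| <= 1) ->
    I (fun x => f (lin l (fun t => @X k t) x)) @[k --> U] --> Ex mu (fun w => f (lin l Y w)).
  move=> cf f1.
  pose g k x := f (lin l (fun t => @X k t) x).
  have mg k : measurable_fun setT (g k).
    by apply: measurableT_comp; [exact: continuous_measurable_fun|exact: measurable_lin].
  have [ms es] := muP g 1 mg (fun k x => f1 _).
  have cg w : g k (w k) @[k --> U] --> st g w.
    by apply: (@ultra_cvg R U UU (fun k => g k (w k)) 1) => k; exact: f1.
  have bst : bmf (st g).
    split => //; exists 1 => w; rewrite -(cvg_lim _ (cvg_norm (cg w)))//; apply: limr_le.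
      by apply/cvg_ex; eexists; apply: cvg_norm; exact: cg.
    by apply: nearW => k; exact: f1.
  have bfY : bmf (fun w => f (lin l Y w)).
    split; last by exists 1.
    by apply: measurableT_comp; [exact: continuous_measurable_fun|exact: measurable_lin].
  (* Off the finitely many null sets the integrands agree by continuity of [f]; on them they differ
     by at most [2], which twice the sum of indicators dominates. *)
  have -> : Ex mu (fun w => f (lin l Y w)) = Ex mu (st g).
    apply/eqP; rewrite -subr_eq0 -normr_le0 -ExB//.
    have -> : 0 = Ex mu (fun w => 2 * \sum_(p <- l) \1_(N p.2) w).
      rewrite ExZ; last by apply: bmf_sum => p; exact: bmf_indic.
      rewrite Ex_sum; last by move=> p; exact: bmf_indic.
      by rewrite big1 ?mulr0// => p _; rewrite Ex_indic.
    apply: Ex_abs; first exact: bmfB.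
      by apply: bmfZ; apply: bmf_sum => p; exact: bmf_indic.
    move=> w; have s0 (s : seq (R * R)) : 0 <= \sum_(p <- s) \1_(N p.2) w :> R.
      by apply: sumr_ge0 => p _; rewrite indicE.
    have [h|h] := pselect (forall p, p \in l -> ~ N p.2 w); last first.
      apply: (@le_trans _ _ 2).
        rewrite (le_trans (ler_normB _ _))//.
        suff : `|st g w| <= 1 by have := f1 (lin l Y w); lra.
        by have := bst.2 => -[K]; rewrite -(cvg_lim _ (cvg_norm (cg w)))// => _;
          apply: limr_le; [apply/cvg_ex; eexists; apply: cvg_norm; exact: cg | apply: nearW => k; exact: f1].
      have [p /not_implyP[pl /contrapT Np]] := (existsNP _).2 h.
      rewrite ler_peMr// (big_rem p pl)/= indicE mem_set// lerDl; exact: s0.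
    rewrite (_ : st g w = f (lin l Y w)) ?subrr ?normr0 ?mulr_ge0//.
    apply: cvg_lim => //; rewrite /g.
    have hh := continuous_cvg _ (cf (lin l Y w)) (linXY l w h). exact: hh.
  rewrite es; apply: (@ultra_cvg R U UU _ (1 * 1)) => k.
  by apply: (posfun_abs (pI k)) => //; split => //; exists 1.
exists (@Realization R _ S (as_prob muT) Y mY) => l.
have /ccvg_ReIm [h1 h2] := cPhi l.
apply/eqP; rewrite eq_complex /rcf /=; apply/andP; split; apply/eqP.
  apply: (@cvg_unique _ _ (complex.Re (Phi_ k l) @[k --> U])) => //.
  rewrite (_ : (fun k => _) = fun k => I (fun x => cos (lin l (fun t => @X k t) x))).
    by apply: key; [exact: continuous_cos|exact: cos_max].
  by apply: funext => k; rewrite -rP.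
apply: (@cvg_unique _ _ (complex.Im (Phi_ k l) @[k --> U])) => //.
rewrite (_ : (fun k => _) = fun k => I (fun x => sin (lin l (fun t => @X k t) x))).
  by apply: key; [exact: continuous_sin|exact: sin_max].
by apply: funext => k; rewrite -rP.
Qed.

End realizable_limit.

(** * Small-time behaviour of a time-stable process *)

Section lists.
Variable R : realType.

(* A list [(c_1, t_1), ...] stands for the linear functional
   [X |-> c_1 X t_1 + ...]; [scl u c] scales times by [u] and weights by [c]. *)
Definition scl (u c : R) (l : seq (R * R)) : seq (R * R) :=
  [seq (c * p.1, u * p.2) | p <- l].

Lemma scl_scl u c u' c' l : scl u c (scl u' c' l) = scl (u * u') (c * c') l.
Proof. by rewrite /scl -map_comp; apply: eq_map => p /=; rewrite !mulrA. Qed.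

Lemma scl11 l : scl 1 1 l = l.
Proof. by rewrite /scl -[RHS]map_id; apply: eq_map => -[a b] /=; rewrite !mul1r. Qed.

Lemma lin_scl T (X : @process R T) u c l w :
  lin (scl u c l) X w = \sum_(p <- l) c * p.1 * X (u * p.2) w.
Proof. by rewrite /lin big_map. Qed.

Lemma pow2V_cvg0 : (2 ^+ k)^-1 @[k --> \oo] --> (0 : R).
Proof.
rewrite (_ : (fun k => _) = fun k : nat => (2^-1 : R) ^+ k); last first.
  by apply: funext => k; rewrite exprVn.
by apply: cvg_expr; rewrite ger0_norm// invf_lt1// ltr1n.
Qed.

Lemma chord_sqr (a b : R) :
  (cos a - cos b) ^+ 2 + (sin a - sin b) ^+ 2 = 2 * (1 - cos (a - b)).
Proof. by rewrite cosB; have := cos2Dsin2 a; have := cos2Dsin2 b; lra. Qed.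

Lemma chord_le2 (a b : R) : (cos a - cos b) ^+ 2 + (sin a - sin b) ^+ 2 <= 2 ^+ 2.
Proof. by rewrite chord_sqr; have := cos_geN1 (a - b); lra. Qed.

Lemma chord_le (a b c : R) : `|a - b| <= c ->
  (cos a - cos b) ^+ 2 + (sin a - sin b) ^+ 2 <= c ^+ 2.
Proof.
move=> abc; rewrite chord_sqr; have := one_sub_cos_le (a - b).
have : (a - b) ^+ 2 <= c ^+ 2.
  by rewrite -[(a - b) ^+ 2]real_normK ?num_real// ler_sqr ?nnegrE// (le_trans _ abc).
lra.
Qed.

End lists.

Section stable_process.
Variables (R : realType) (d : measure_display) (T : measurableType d).
Variables (P : probability T R) (X : @process R T).
Local Notation C := R[i].

Definition phi (l : seq (R * R)) : C := cf P (lin l X).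

Hypothesis mX : forall t, measurable_fun setT (X t).
Hypothesis scX : forall t eps delta : R, 0 < eps -> 0 < delta -> exists eta : R,
  0 < eta /\ forall s, `|s - t| < eta ->
    fine (P [set w | eps < `|X s w - X t w|]) < delta.
Hypothesis tsX : forall n l, (0 < n)%N -> phi (scl n%:R 1 l) = phi l ^+ n.

Let mlin l : measurable_fun setT (lin l X). Proof. exact: measurable_lin. Qed.

Lemma phi_le1 l : cn (phi l) <= 1. Proof. exact: cf_le1. Qed.

Let mdiff s t (eps : R) : measurable [set w | eps < `|X s w - X t w|].
Proof.
apply: (@measurable_gt_set _ _ _ (fun w => `|X s w - X t w|)).
by apply: measurableT_comp => //; exact: measurable_funB.
Qed.

Lemma times_cont (l : seq (R * R)) (u0 eps kap : R) : 0 < eps -> 0 < kap ->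
  exists eta : R, 0 < eta /\ forall u, `|u - u0| < eta ->
  \sum_(p <- l) fine (P [set w | eps < `|X (u * p.2) w - X (u0 * p.2) w|]) <= kap.
Proof.
move=> eps0; elim: l kap => [|p l IH] kap kap0.
  by exists 1; split => // u _; rewrite big_nil ltW.
have k2 : 0 < kap / 2 by rewrite divr_gt0.
have [e1 [e10 h1]] := IH _ k2; have [e2 [e20 h2]] := scX (u0 * p.2) eps0 k2.
have p0 : 0 < 1 + `|p.2| by rewrite ltr_pwDl.
exists (Num.min e1 (e2 / (1 + `|p.2|))); split.
  by rewrite lt_min e10 divr_gt0.
move=> u; rewrite lt_min => /andP[u1 u2]; rewrite big_cons.
rewrite [leRHS](_ : kap = kap / 2 + kap / 2); last by field.
apply: lerD; last exact: h1.
apply/ltW/h2; rewrite -mulrBl normrM.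
rewrite ltr_pdivlMr// in u2; apply: le_lt_trans u2.
by rewrite ler_wpM2l// lerDr.
Qed.

(** Uniformity over [|c| <= 1] is essential: [small_time] needs one time scale for all frequencies
    up to [M]. *)
Lemma phi_cont (l : seq (R * R)) (u0 e : R) : 0 < e -> exists eta : R, 0 < eta /\
  forall u c, `|u - u0| < eta -> `|c| <= 1 ->
  cn (phi (scl u c l) - phi (scl u0 c l)) <= e.
Proof.
move=> e0; pose s := 1 + \sum_(p <- l) `|p.1|.
have s0 : 0 < s by rewrite ltr_pwDl// sumr_ge0.
(* If every increment is at most [e / 2 / s], the weighted sum moves by at most [e / 2]. The other
   half of [e] pays for the exceptional events, on which a chord of the unit circle is at most
   [2]. *)
have d0 : 0 < e / 2 / s by rewrite !divr_gt0.
have k0 : 0 < e / 4 by rewrite divr_gt0.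
have [eta [eta0 h]] := times_cont l u0 d0 k0; exists eta; split => // u c uu c1.
pose A (p : R * R) := [set w | e / 2 / s < `|X (u * p.2) w - X (u0 * p.2) w|].
pose g w := e / 2 + 2 * \sum_(p <- l) \1_(A p) w : R.
have bA p : bmf (\1_(A p) : T -> R) by apply: bmf_indic; exact: mdiff.
have bs : bmf (fun w => \sum_(p <- l) \1_(A p) w : R) by apply: bmf_sum.
apply: (@le_trans _ _ (Ex P g)).
  have s1 w : 0 <= \sum_(p <- l) \1_(A p) w :> R.
    by apply: sumr_ge0 => p _; rewrite indicE.
  have e2 : 0 <= e / 2 by rewrite divr_ge0// ltW.
  have ge w : e / 2 <= g w by rewrite /g lerDl mulr_ge0.
  have g0 w : 0 <= g w by exact: le_trans (ge w).
  apply: cf_sub_le => //.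
    by apply: bmfD; [exact: bmf_cst|exact: bmfZ].
  move=> w; have [hA|hA] := pselect (forall p, p \in l -> ~ A p w); last first.
    apply: le_trans (chord_le2 _ _) _; rewrite ler_sqr ?nnegrE//.
    have [p /not_implyP[pl /contrapT Ap]] := (existsNP _).2 hA.
    have : 1 <= \sum_(p <- l) \1_(A p) w :> R.
      by rewrite (big_rem p pl)/= indicE mem_set// lerDl sumr_ge0// => q _; rewrite indicE.
    by rewrite /g; lra.
  apply: (@le_trans _ _ ((e / 2) ^+ 2)); last first.
    by rewrite ler_sqr ?nnegrE.
  apply: chord_le; rewrite !lin_scl -sumrB.
  apply: (@le_trans _ _ (\sum_(p <- l) `|p.1| * (e / 2 / s))).
    apply: le_trans (ler_norm_sum _ _ _) _; rewrite big_seq [leRHS]big_seq.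
    apply: ler_sum => p pl; rewrite -mulrBr !normrM.
    have /negP := hA p pl; rewrite /A /= -leNgt => h1.
    by rewrite ler_pM// ?mulr_ge0// ler_piMl.
  rewrite -mulr_suml mulrCA ler_piMr// ler_pdivrMr// mul1r /s.
  by rewrite lerDr.
rewrite /g ExD; [|exact: bmf_cst|exact: bmfZ].
rewrite Ex_prob_cst ExZ// Ex_sum//.
have -> : \sum_(p <- l) Ex P (\1_(A p)) = \sum_(p <- l) fine (P (A p)).
  by apply: eq_bigr => p _; rewrite Ex_indic//; exact: mdiff.
by have := h u uu; rewrite -/A; lra.
Qed.

Lemma Ex_cos_double_ge (Y : T -> R) : measurable_fun setT Y ->
  1 - Ex P (fun w => cos (2 * Y w)) <= 4 * (1 - Ex P (fun w => cos (Y w))).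
Proof.
move=> mY; have b1 : bmf (fun w => cos (Y w)) by exact: bmf_cos.
have b2 : bmf (fun w => cos (2 * Y w)) by apply: bmf_cos; exact: measurable_funM.
have E1 (Z : T -> R) : bmf Z -> 1 - Ex P Z = Ex P (fun w => 1 - Z w).
  by move=> bZ; rewrite ExB ?Ex_prob_cst//; exact: bmf_cst.
rewrite !E1// -ExZ; last by apply: bmfB => //; exact: bmf_cst.
apply: Ex_le.
- by apply: bmfB => //; exact: bmf_cst.
- by apply: bmfZ; apply: bmfB => //; exact: bmf_cst.
move=> w; rewrite mulr_natl cos_mulr2n; have := cos_le1 (Y w); have := cos_geN1 (Y w).
by set c := cos _; rewrite -mulr_natl; nra.
Qed.

(** At time [0] stability reads [phi = phi ^ 2], so [phi] is [0] or [1]. It is near [1], hence [1],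
    at small frequencies, and [Ex_cos_double_ge] carries the value [1] from a frequency to its
    double. *)
Lemma phi_time0 (l : seq (R * R)) (c : R) : phi (scl 0 c l) = 1.
Proof.
have single (th : R) : phi [:: (th, 0)] = 1.
  have idem (a : R) : phi [:: (a, 0)] = 0 \/ phi [:: (a, 0)] = 1.
    have := @tsX 2 [:: (a, 0)] isT; rewrite /scl /= mulr0 mul1r expr2 => e.
    have : phi [:: (a, 0)] * (1 - phi [:: (a, 0)]) = 0 by rewrite mulrBr mulr1 -e subrr.
    by move=> /eqP; rewrite mulf_eq0 subr_eq0 => /orP[/eqP->|/eqP<-]; [left|right].
  have ReE (a : R) : complex.Re (phi [:: (a, 0)]) = Ex P (fun w => cos (a * X 0 w)).
    by apply: eq_Ex => w; rewrite lin1.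
  have mc (a : R) : measurable_fun setT (fun w => a * X 0 w) by exact: measurable_funM.
  have c1 : Ex P (fun w => cos (th / 2 ^+ k * X 0 w)) @[k --> \oo] --> Ex P (fun=> 1).
    apply: (@Ex_cvg _ _ _ _ (fun k w => cos (th / 2 ^+ k * X 0 w)) _ 1).
    - by move=> k; exact: (bmf_cos (mc _)).1.
    - by move=> k w; exact: cos_max.
    move=> w.
    have h0 : th / 2 ^+ k * X 0 w @[k --> \oo] --> th * 0 * X 0 w.
      by apply: cvgMr_tmp; apply: cvgMl_tmp; exact: pow2V_cvg0.
    have hh := continuous_cvg _ (@continuous_cos R (th * 0 * X 0 w)) h0.
    by move: hh; rewrite mulr0 mul0r cos0; apply.
  rewrite Ex_prob_cst in c1.
  have [m hm] : exists m, 1 / 2 < Ex P (fun w => cos (th / 2 ^+ m * X 0 w)).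
    have /filter_ex [m hm] : \forall m \near \oo, 1 / 2 < Ex P (fun w => cos (th / 2 ^+ m * X 0 w)).
      have := cvgr_gt _ c1 (1 / 2); apply; lra.
    by exists m.
  have em : Ex P (fun w => cos (th / 2 ^+ m * X 0 w)) = 1.
    move: hm; rewrite -ReE; case: (idem (th / 2 ^+ m)) => ->//=; lra.
  have step j : (j <= m)%N -> Ex P (fun w => cos (th / 2 ^+ (m - j) * X 0 w)) = 1.
    elim: j => [|j IH] jm; first by rewrite subn0.
    have := Ex_cos_double_ge (mc (th / 2 ^+ (m - j))); rewrite IH ?(ltnW jm)//.
    rewrite subrr mulr0 => h.
    have e2 : Ex P (fun w => cos (2 * (th / 2 ^+ (m - j) * X 0 w))) =
        Ex P (fun w => cos (th / 2 ^+ (m - j.+1) * X 0 w)).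
      apply: eq_Ex => w; congr cos; have -> : (m - j = (m - j.+1).+1)%N by rewrite subnSK.
      rewrite exprS; field; rewrite expf_neq0//.
    rewrite e2 in h; apply/eqP; rewrite eq_le; apply/andP; split; last by lra.
    rewrite -[leRHS](Ex_prob_cst P); apply: Ex_le; [exact: bmf_cos|exact: bmf_cst|].
    by move=> w; exact: cos_le1.
  have := step m (leqnn m); rewrite subnn expr0 divr1 -ReE.
  by case: (idem th) => ->//= /eqP; rewrite eq_sym oner_eq0.
rewrite -(single (\sum_(p <- l) c * p.1)); apply: eq_cf => w.
rewrite lin1 lin_scl mulr_suml; apply: eq_bigr => p _; by rewrite mul0r.
Qed.

Lemma phi_root (n : nat) l : phi (scl n.+1%:R^-1 1 l) ^+ n.+1 = phi l.
Proof.
by rewrite -tsX// scl_scl mulfV ?pnatr_eq0// mulr1 scl11.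
Qed.

(** [phi l] is a power of its value at a small fraction of the times, and that value is close to the
    value [1] at time [0]. *)
Lemma cn_phi_gt0 l : 0 < cn (phi l).
Proof.
have e2 : 0 < 1 / 2 :> R by lra.
have [eta [eta0 h]] := phi_cont l 0 e2.
have [n hn] : exists n, n.+1%:R^-1 < eta.
  have /filter_ex [n hn] : \forall n \near \oo, n.+1%:R^-1 < eta.
    by have := cvgr_lt _ (@invSn_cvg0 R) eta; apply.
  by exists n.
have := h n.+1%:R^-1 1; rewrite subr0 ger0_norm ?invr_ge0// normr1 phi_time0.
move=> /(_ hn (lexx _)) hz.
rewrite -(phi_root n) cnX exprn_gt0//.
set z := phi _ in hz *.
have : cn (z + - (z - 1)) <= cn z + cn (z - 1).
  by apply: le_trans (cnD _ _) _; rewrite cnN.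
have -> : z + - (z - 1) = 1 by ring.
by rewrite cn1; lra.
Qed.

(** Taking the logarithm of the modulus avoids choosing a branch of the complex logarithm, and
    suffices to isolate the Gaussian part. *)
Definition Hlog l : R := ln (cn (phi l)).

Lemma expR_Hlog l : expR (Hlog l) = cn (phi l).
Proof. by rewrite /Hlog lnK// posrE cn_phi_gt0. Qed.

Lemma Hlog_le0 l : Hlog l <= 0.
Proof. by rewrite -ler_expR expR_Hlog expR0 phi_le1. Qed.

Lemma Hlog_nat n l : Hlog (scl n%:R 1 l) = n%:R * Hlog l.
Proof.
case: n => [|n]; first by rewrite mul0r /Hlog phi_time0 cn1 ln1.
apply: expR_inj; rewrite expR_Hlog tsX// cnX -expR_Hlog.
by rewrite expRM_natl.
Qed.

Lemma Hlog_rat m n l : Hlog (scl (m%:R / n.+1%:R) 1 l) = m%:R / n.+1%:R * Hlog l.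
Proof.
have n0 : n.+1%:R != 0 :> R by rewrite pnatr_eq0.
apply: (mulfI n0); rewrite -Hlog_nat scl_scl mulrCA mulfV// !mulr1 Hlog_nat.
by rewrite mulrA mulrCA mulfV// mulr1.
Qed.

(** From rational to real dilations by continuity in time, along the truncations [v n] of [u] to
    multiples of [1 / (n + 1)]. *)
Lemma Hlog_real (u : R) l : 0 <= u -> Hlog (scl u 1 l) = u * Hlog l.
Proof.
move=> u0; pose v n : R := (Num.truncn (u * n.+1%:R))%:R / n.+1%:R.
have vu : v n @[n --> \oo] --> u.
  apply/cvgrPdist_le => e e0.
  have := @invSn_cvg0 R; move=> /cvgr0_norm_le /(_ _ e0); apply: filterS => n.
  rewrite ger0_norm ?invr_ge0//; apply: le_trans.
  have n0 : 0 < n.+1%:R :> R by rewrite ltr0n.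
  have /andP[h1 h2] := truncn_itv (mulr_ge0 u0 (ltW n0)).
  rewrite -[X in _ < X]natr1 in h2.
  have -> : u - v n = (u * n.+1%:R - (Num.truncn (u * n.+1%:R))%:R) / n.+1%:R.
    by rewrite mulrBl mulfK ?gt_eqF.
  rewrite normrM normfV (gtr0_norm n0) -[leRHS]mul1r ler_wpM2r ?invr_ge0 ?ltW//.
  by rewrite ger0_norm; lra.
have c1 : Hlog (scl (v n) 1 l) @[n --> \oo] --> u * Hlog l.
  rewrite (_ : (fun n => _) = fun n => v n * Hlog l); first exact: cvgMr_tmp.
  by apply: funext => n; rewrite Hlog_rat.
have c2 : Hlog (scl (v n) 1 l) @[n --> \oo] --> Hlog (scl u 1 l).
  apply: (@continuous_cvg _ _ _ _ _ (fun n => cn (phi (scl (v n) 1 l))) (@ln R) (cn (phi (scl u 1 l)))).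
    by apply: continuous_ln; exact: cn_phi_gt0.
  apply/cvgrPdist_le => e e0; have [eta [eta0 h]] := phi_cont l u e0.
  move/cvgrPdist_lt : vu => /(_ _ eta0); apply: filterS => n; rewrite distrC => hn.
  have := h (v n) 1 hn; rewrite normr1 => /(_ (lexx _)); apply: le_trans.
  set a := phi _; set b := phi _.
  have h1 : cn a <= cn b + cn (b - a).
    by have := cnD b (- (b - a)); rewrite cnN opprB [b + _]addrC subrK.
  have h2 : cn b <= cn a + cn (b - a).
    by have := cnD a (b - a); rewrite [a + _]addrC subrK.
  by rewrite ler_norml; apply/andP; split; lra.
exact: (cvg_unique _ c2 c1).
Qed.

Local Notation p2 k := ((2 ^+ k)^-1 : R).

Lemma phi1_cont0 (t e : R) : 0 < e -> exists delta : R, 0 < delta /\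
  forall th, `|th| <= delta -> cn (phi [:: (th, t)] - 1) <= e.
Proof.
move=> e0.
pose g k w := Num.min 2 (k.+1%:R^-1 * `|X t w|) : R.
have mg k : measurable_fun setT (g k).
  apply: measurable_minr => //; apply: measurable_funM => //.
  exact: measurableT_comp.
have g0 k w : 0 <= g k w.
  by rewrite /g le_min ler0n mulr_ge0// invr_ge0.
have g2 k w : `|g k w| <= 2 by rewrite ger0_norm// /g ge_min lexx.
have : Ex P (g k) @[k --> \oo] --> Ex P (fun=> 0).
  apply: (@Ex_cvg _ _ _ _ g _ 2) => // w.
  have c : k.+1%:R^-1 * `|X t w| @[k --> \oo] --> (0 : R).
    by rewrite -[X in _ --> X](mul0r `|X t w|); apply: cvgMr_tmp; exact: invSn_cvg0.
  apply: (squeeze_cvgr _ (cvg_cst 0) c); apply: nearW => k.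
  by rewrite g0 /g ge_min lexx orbT.
rewrite Ex_prob_cst => /cvgr0_norm_le /(_ _ e0) [k _ /(_ k (leqnn k))] /= hk.
exists k.+1%:R^-1; split; first by rewrite invr_gt0 ltr0n.
move=> th thk; apply: le_trans (le_trans (ler_norm _) hk).
have -> : phi [:: (th, t)] - 1 = phi [:: (th, t)] - cf P (fun=> 0) by rewrite cf0.
apply: cf_sub_le => //.
  by split => //; exists 2.
move=> w; rewrite /g lin1 /Num.min; case: ifP => _; first exact: chord_le2.
by apply: chord_le; rewrite subr0 normrM ler_wpM2r.
Qed.

(** Put [N = 2 ^ (k - k0)] and factor [z ^ N - 1 = (z - 1) (1 + z + ... + z ^ (N - 1))]. By
    stability [z ^ j] is [phi] at time [j t / 2 ^ k], which is close to [1] for [j <= N]; so the sum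
    has modulus at least [3 N / 4], and [4 / 3] is rounded up to [2]. *)
Lemma small_time (t M : R) : 0 < M -> exists k0 : nat, forall k (th : R),
  (k0 <= k)%N -> `|th| <= M ->
  2 ^+ k * cn (phi [:: (th, p2 k * t)] - 1) <=
  2 * 2 ^+ k0 * cn (phi [:: (th, p2 k0 * t)] - 1).
Proof.
move=> M0; have e4 : 0 < 1 / 4 :> R by lra.
have [eta [eta0 h]] := phi_cont [:: (M, t)] 0 e4.
have [k0 hk0] : exists k0, p2 k0 < eta.
  have /filter_ex [n hn] : \forall n \near \oo, p2 n < eta.
    by have := cvgr_lt _ (@pow2V_cvg0 R) eta; apply.
  by exists n.
exists k0 => k th k0k thM.
(* The frequency [th] is reached from the fixed weight [M] through the factor [c = th / M], of
   modulus at most [1]. *)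
have near1 u : 0 <= u < eta -> cn (phi [:: (th, u * t)] - 1) <= 1 / 4.
  move=> /andP[u0 ue]; have := h u (th / M).
  rewrite phi_time0 /scl /= divfK ?gt_eqF// subr0 ger0_norm//; apply => //.
  by rewrite normrM normfV (gtr0_norm M0) ler_pdivrMr// mul1r.
pose N := (2 ^ (k - k0))%N; set z := phi [:: (th, p2 k * t)].
have N0 : 0 < N%:R :> R by rewrite ltr0n expn_gt0.
have pk : 2 ^+ k = N%:R * 2 ^+ k0 :> R by rewrite /N natrX -exprD subnK.
have p20 j : 0 < 2 ^+ j :> R by rewrite exprn_gt0.
have zj j : (0 < j)%N -> z ^+ j = phi [:: (th, j%:R * p2 k * t)].
  by move=> j0; rewrite -tsX// /scl /= mul1r mulrA.
have zN : z ^+ N = phi [:: (th, p2 k0 * t)].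
  rewrite zj; last by rewrite expn_gt0.
  by rewrite pk invfM mulrA mulfV ?mul1r// gt_eqF.
have Rez j : (j <= N)%N -> 3 / 4 <= complex.Re (z ^+ j).
  case: j => [|j] jN; first by rewrite expr0 /=; lra.
  have : cn (z ^+ j.+1 - 1) <= 1 / 4.
    rewrite zj//; apply: near1; apply/andP; split; first by rewrite mulr_ge0// invr_ge0 ltW.
    apply: le_lt_trans hk0; rewrite pk invfM mulrA ler_piMl ?invr_ge0 ?(ltW (p20 _))//.
    by rewrite ler_pdivrMr// mul1r ler_nat.
  move=> hz; have := abs_Re_le (z ^+ j.+1 - 1); rewrite raddfB/= ler_norml => /andP[h1 _].
  have -> : complex.Re (z ^+ j.+1) = complex.Re (z ^+ j.+1) - 1 + 1 by ring.
  by lra.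
have ReS : 3 / 4 * N%:R <= complex.Re (\sum_(j < N) z ^+ j).
  rewrite raddf_sum /=; apply: (@le_trans _ _ (\sum_(j < N) (3 / 4 : R))).
    by rewrite sumr_const card_ord -[leRHS]mulr_natr.
  by apply: ler_sum => j _; apply: Rez; exact: ltnW.
have cnS : 3 / 4 * N%:R <= cn (\sum_(j < N) z ^+ j).
  by apply: le_trans ReS _; apply: le_trans (abs_Re_le _); exact: ler_norm.
have e : cn (z ^+ N - 1) = cn (z - 1) * cn (\sum_(j < N) z ^+ j).
  by rewrite subrX1 cnM.
rewrite -zN e pk.
have c0 := cn_ge0 (z - 1); have k00 := p20 k0.
have h1 : cn (z - 1) * (3 / 4 * N%:R) <= cn (z - 1) * cn (\sum_(j < N) z ^+ j).
  by rewrite ler_wpM2l.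
set u := cn (z - 1) in h1 c0 *; set v := cn _ in h1 *; set a := 2 ^+ k0 in k00 *.
have h2 : u * N%:R <= 2 * (u * v).
  move: h1 (mulr_ge0 c0 (ltW N0)); rewrite mulrCA; move: (u * N%:R) (u * v) => q r.
  by lra.
have h3 := ler_wpM2l (ltW k00) h2.
have -> : N%:R * a * u = a * (u * N%:R) by ring.
by have -> : 2 * a * (u * v) = a * (2 * (u * v)) by ring.
Qed.

Lemma one_sub_Re_le (Y : T -> R) : measurable_fun setT Y ->
  1 - Ex P (fun w => cos (Y w)) <= cn (cf P Y - 1).
Proof.
move=> mY; apply: le_trans (abs_Re_le _); rewrite raddfB /= distrC.
exact: ler_norm.
Qed.

(** No mass of the measures [2 ^ k P (D_k in .)] escapes to infinity; this makes the limit vector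
    finite almost everywhere. *)
Lemma dyadic_tail (t e : R) : 0 < e -> exists A k0, 0 < A /\ forall k, (k0 <= k)%N ->
  2 ^+ k * fine (P [set w | A <= `|X (p2 k * t) w|]) <= e.
Proof.
move=> e0; have [k0 h] := @small_time t 1 ltr01.
have p20 j : 0 < 2 ^+ j :> R by rewrite exprn_gt0.
have e1 : 0 < e / 4 / 2 ^+ k0 by rewrite !divr_gt0.
have [de [de0 hde]] := phi1_cont0 (p2 k0 * t) e1.
pose a := Num.min de 1; have a0 : 0 < a by rewrite lt_min de0 ltr01.
exists (4 / a), k0; split => [|k k0k]; first by rewrite divr_gt0.
have -> : [set w | 4 / a <= `|X (p2 k * t) w|] = [set w | 4 <= a * `|X (p2 k * t) w|].
  by apply/seteqP; split => w /=; rewrite ler_pdivrMr// mulrC.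
have : fine (P [set w | 4 <= a * `|X (p2 k * t) w|]) <= 2 * (e / 2 / 2 ^+ k).
  apply: tail_bound => // th tha.
  have tha1 : `|th| <= 1 by apply: le_trans tha _; rewrite /a ge_min lexx orbT.
  have thde : `|th| <= de by apply: le_trans tha _; rewrite /a ge_min lexx.
  apply: le_trans (one_sub_Re_le _) _; first exact: measurable_funM.
  rewrite ler_pdivlMr// mulrC.
  rewrite (_ : cf _ _ = phi [:: (th, p2 k * t)]); last by apply: eq_cf => w; rewrite lin1.
  apply: le_trans (h k th k0k tha1) _.
  have := ler_wpM2l (ltW (p20 k0)) (hde th thde).
  rewrite [X in _ <= X -> _]mulrC divfK ?gt_eqF//; lra.
move=> h1; apply: le_trans (ler_wpM2l (ltW (p20 k)) h1) _.
rewrite le_eqVlt; apply/orP; left; apply/eqP; by field; rewrite expf_neq0.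
Unshelve. all: by [].
Qed.

(** The condition [|x| >= 1] is written [4 <= 4 * |x|] so as to match [tail_bound] with [a = 4]. *)
Lemma min1_sqr_le (x : R) : Num.min 1 (x ^+ 2) <= (4 <= 4 * `|x|)%R%:R + 8 * (1 - cos x).
Proof.
have c0 := one_sub_cos_ge0 x; have [h|h] := leP 4 (4 * `|x|).
  by rewrite ge_min /= mulr1n; apply/orP; left; lra.
rewrite /= mulr0n add0r ge_min; apply/orP; right.
by have := @one_sub_cos_ge R x; lra.
Qed.

Lemma measurable_min1_sqr t : measurable_fun setT (fun w => Num.min 1 (X t w ^+ 2)).
Proof. by apply: measurable_minr => //; exact: measurable_funX. Qed.

Lemma min1_sqr_itv (x : R) : 0 <= Num.min 1 (x ^+ 2) <= 1.
Proof. by rewrite le_min ler01 sqr_ge0 ge_min lexx. Qed.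

Lemma bmf_min1_sqr t : bmf (fun w => Num.min 1 (X t w ^+ 2)).
Proof.
split; first exact: measurable_min1_sqr.
by exists 1 => w; have /andP[h0 h1] := min1_sqr_itv (X t w); rewrite ger0_norm.
Qed.

(** Supplies the uniform bound on the total masses of the weighted functionals. *)
Lemma dyadic_mass (t : R) : exists B : R, forall k,
  2 ^+ k * Ex P (fun w => Num.min 1 (X (p2 k * t) w ^+ 2)) <= B.
Proof.
have h4 : 0 < 4 :> R by [].
have [k0 h] := small_time t h4.
have p20 j : 0 < 2 ^+ j :> R by rewrite exprn_gt0.
have c2 l : cn (phi l - 1) <= 2.
  by apply: le_trans (cnD _ _) _; rewrite cnN cn1; have := phi_le1 l; lra.
(* With [eta = 4 * 2 ^ k0 / 2 ^ k], the tail contributes [2 eta] and the cosine term [8 eta], which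
   gives [10 eta]. For [k < k0] the crude bound [2 ^ k] is enough. *)
exists (40 * 2 ^+ k0) => k.
have [k0k|kk0] := leqP k0 k; last first.
  apply: (@le_trans _ _ (2 ^+ k * 1)).
    rewrite ler_wpM2l ?(ltW (p20 _))// -[leRHS](Ex_prob_cst P); apply: Ex_le.
    - exact: bmf_min1_sqr.
    - exact: bmf_cst.
    by move=> w; have /andP[] := min1_sqr_itv (X (p2 k * t) w).
  rewrite mulr1; apply: (@le_trans _ _ (2 ^+ k0)).
    by rewrite ler_eXn2l ?(ltnW kk0)// ltr1n.
  by have := p20 k0; lra.
have hz th : `|th| <= 4 -> 1 - Ex P (fun w => cos (th * X (p2 k * t) w)) <= 4 * 2 ^+ k0 / 2 ^+ k.
  move=> th4; apply: le_trans (one_sub_Re_le _) _; first exact: measurable_funM.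
  rewrite ler_pdivlMr// mulrC.
  rewrite (_ : cf _ _ = phi [:: (th, p2 k * t)]); last by apply: eq_cf => w; rewrite lin1.
  apply: le_trans (h k th k0k th4) _.
  have := ler_wpM2l (ltW (p20 k0)) (c2 [:: (th, p2 k0 * t)]); lra.
have mE : measurable [set w | 4 <= 4 * `|X (p2 k * t) w|].
  apply: (@measurable_ge_set _ _ _ (fun w => 4 * `|X (p2 k * t) w|)).
  by apply: measurable_funM => //; exact: measurableT_comp.
have := tail_bound (mX (p2 k * t)) h4 hz; rewrite -(Ex_indic P mE) => ht.
have b1 : bmf (fun w => cos (1 * X (p2 k * t) w)) by apply: bmf_cos; exact: measurable_funM.
have : Ex P (fun w => Num.min 1 (X (p2 k * t) w ^+ 2)) <=
    Ex P (fun w => \1_[set w | 4 <= 4 * `|X (p2 k * t) w|] w + 8 * (1 - cos (1 * X (p2 k * t) w))).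
  apply: Ex_le; first exact: bmf_min1_sqr.
    apply: bmfD; first exact: bmf_indic.
    by apply: bmfZ; apply: bmfB => //; exact: bmf_cst.
  move=> w; apply: le_trans (min1_sqr_le _) _; rewrite mul1r lerD2r indicE.
  rewrite (_ : (w \in _) = (4 <= 4 * `|X (p2 k * t) w|))//.
  by apply/idP/idP => [/set_mem//|hw]; exact/mem_set.
rewrite ExD; [|exact: bmf_indic|by apply: bmfZ; apply: bmfB => //; exact: bmf_cst].
rewrite ExZ; last by apply: bmfB => //; exact: bmf_cst.
rewrite ExB//; last exact: bmf_cst.
rewrite Ex_prob_cst => h1; have h1' : `|1| <= 4 :> R by rewrite normr1 ler1n.
have h2 := hz 1 h1'.
have h3 : Ex P (fun w => Num.min 1 (X (p2 k * t) w ^+ 2)) <= 40 * 2 ^+ k0 / 2 ^+ k by lra.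
by move: (ler_wpM2l (ltW (p20 k)) h3); rewrite mulrCA mulfV ?gt_eqF// mulr1.
Qed.

Lemma dyadic_drift (t : R) : exists B : R, forall k,
  `|2 ^+ k * Ex P (fun w => sin (X (p2 k * t) w))| <= B.
Proof.
have [k0 h] := @small_time t 1 ltr01.
have p20 j : 0 < 2 ^+ j :> R by rewrite exprn_gt0.
have c2 l : cn (phi l - 1) <= 2.
  by apply: le_trans (cnD _ _) _; rewrite cnN cn1; have := phi_le1 l; lra.
exists (4 * 2 ^+ k0) => k; rewrite normrM (ger0_norm (ltW (p20 _))).
have hs : `|Ex P (fun w => sin (X (p2 k * t) w))| <= cn (phi [:: (1, p2 k * t)] - 1).
  apply: le_trans (abs_Im_le _); rewrite raddfB /= subr0.
  rewrite (_ : Ex _ _ = Ex P (fun w => sin (lin [:: (1, p2 k * t)] X w)))//.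
  by apply: eq_Ex => w; rewrite lin1 mul1r.
have [k0k|kk0] := leqP k0 k.
  apply: le_trans (ler_wpM2l (ltW (p20 k)) hs) _.
  apply: le_trans (h k 1 k0k _) _; first by rewrite normr1.
  by have := ler_wpM2l (ltW (p20 k0)) (c2 [:: (1, p2 k0 * t)]); lra.
have h1 : 2 ^+ k <= 2 ^+ k0 :> R by rewrite ler_eXn2l ?(ltnW kk0)// ltr1n.
have := le_trans hs (c2 _); have := normr_ge0 (Ex P (fun w => sin (X (p2 k * t) w))).
move: `|Ex P _| => E E0 E2.
have : 2 ^+ k * E <= 2 ^+ k0 * 2 by rewrite ler_pM// ltW.
by have := p20 k0; lra.
Qed.

End stable_process.

(** The accompanying-law limit: the hypotheses say that [2 ^ k (z_k - 1)] tends to [a + i b]. The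
    condition [a <= 0] of [power_cvg] holds because [cos - 1] is nonpositive. *)
Lemma cf_pow2_cvg (R : realType) d (T : measurableType d) (P : probability T R)
  (U : set_system nat) (FU : ProperFilter U) (Y : nat -> T -> R) (a b : R) :
  \oo `<=` U -> (forall k, measurable_fun setT (Y k)) ->
  2 ^+ k * Ex P (fun w => cos (Y k w) - 1) @[k --> U] --> a ->
  2 ^+ k * Ex P (fun w => sin (Y k w)) @[k --> U] --> b ->
  ccvg U (fun k => cf P (Y k) ^+ (2 ^ k)) (cE (a +i* b)).
Proof.
move=> Uoo mY ca cb; pose z k := cf P (Y k); pose w k : R[i] := (2 ^+ k)%:C * (z k - 1).
have n0 k : (0 < 2 ^ k)%N by rewrite expn_gt0.
have nV : (2 ^ k)%N%:R^-1 @[k --> U] --> (0 : R).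
  have c : (2 ^ k)%N%:R^-1 @[k --> \oo] --> (0 : R).
    rewrite (_ : (fun k => _) = fun k : nat => (2 ^+ k)^-1); first exact: pow2V_cvg0.
    by apply: funext => k; rewrite natrX.
  by move=> A /c; exact: Uoo.
have c2 k : (2 ^+ k)%:C = (2 ^ k)%N%:R :> R[i] by rewrite rmorphXn natrX rmorph_nat.
have zE k : z k = 1 + (2 ^ k)%N%:R^-1 * w k.
  have N0 : (2 ^ k)%N%:R != 0 :> R[i] by rewrite pnatr_eq0 expn_eq0.
  rewrite /w c2; move: N0; move: ((2 ^ k)%N%:R : R[i]) (z k) => N zk N0.
  by rewrite mulKf// addrC subrK.
have z1 k : cn (z k) <= 1 by exact: cf_le1.
have bB k : Ex P (fun v => cos (Y k v) - 1) = Ex P (fun v => cos (Y k v)) - 1.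
  by rewrite ExB ?Ex_prob_cst//; [exact: bmf_cos|exact: bmf_cst].
have wc : ccvg U w (a +i* b).
  apply/ccvg_ReIm; split.
    apply: cvg_trans ca; apply: near_eq_cvg; apply: nearW => k.
    by rewrite bB /w /z /cf /= mul0r subr0.
  apply: cvg_trans cb; apply: near_eq_cvg; apply: nearW => k.
  by rewrite /w /z /cf /= mul0r addr0 subr0.
apply: (power_cvg _ n0 nV zE z1 _ wc); rewrite -(cvg_lim _ ca)//.
apply: limr_le; first by apply/cvg_ex; exists a.
apply: nearW => k; rewrite mulr_ge0_le0 ?exprn_ge0// bB subr_le0.
rewrite -[leRHS](Ex_prob_cst P); apply: Ex_le; [exact: bmf_cos|exact: bmf_cst|].
by move=> v; exact: cos_le1.
Qed.

(** * Levy-Khintchine representation *)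

Section rho.
Variables (R : realType) (m : nat).
Local Notation V := (m.-tuple R).
Implicit Types x y : V.

Definition rho x : R := Num.min 1 (sqnorm x).

Lemma sqnormE x : sqnorm x = \sum_(i < m) tnth x i ^+ 2.
Proof. by apply: eq_bigr => i _; rewrite expr2. Qed.

Lemma sqnorm_ge0 x : 0 <= sqnorm x.
Proof. by rewrite sqnormE sumr_ge0// => i _; exact: sqr_ge0. Qed.

Lemma coord_sqr_le x i : tnth x i ^+ 2 <= sqnorm x.
Proof.
rewrite sqnormE (bigD1 i)//= lerDl sumr_ge0// => j _; exact: sqr_ge0.
Qed.

Lemma rho_ge0 x : 0 <= rho x.
Proof. by rewrite /rho le_min ler01 sqnorm_ge0. Qed.

Lemma rho_le1 x : rho x <= 1. Proof. by rewrite /rho ge_min lexx. Qed.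

Lemma rho_le_sqnorm x : rho x <= sqnorm x.
Proof. by rewrite /rho ge_min lexx orbT. Qed.

Lemma rho_small x : sqnorm x <= 1 -> rho x = sqnorm x.
Proof. by move=> h; rewrite /rho; apply/min_idPr. Qed.

Lemma rho_eq0 x : (rho x == 0) = (sqnorm x == 0).
Proof.
rewrite /rho; have [h|h] := leP (sqnorm x) 1 => //.
by rewrite oner_eq0; apply/esym/negbTE; rewrite gt_eqF// (lt_trans ltr01).
Qed.

Lemma sqnorm0_coord x : sqnorm x = 0 -> forall i, tnth x i = 0.
Proof.
move=> x0 i; apply/eqP; rewrite -sqrf_eq0 eq_le sqr_ge0 andbT -x0.
exact: coord_sqr_le.
Qed.

Lemma rho_le_sum x : rho x <= \sum_(i < m) Num.min 1 (tnth x i ^+ 2).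
Proof.
have [h|/existsNP[i /negP]] := pselect (forall i, tnth x i ^+ 2 <= 1).
  apply: le_trans (rho_le_sqnorm x) _; rewrite sqnormE; apply: ler_sum => i _.
  by rewrite le_min h lexx.
rewrite -ltNge => hi; apply: le_trans (rho_le1 x) _.
rewrite (bigD1 i)//= [X in _ <= X + _](_ : _ = 1); last by apply/min_idPl/ltW.
by rewrite lerDl sumr_ge0// => j _; rewrite le_min ler01 sqr_ge0.
Qed.

Lemma measurable_sqnorm : measurable_fun setT (@sqnorm R m).
Proof.
rewrite (_ : @sqnorm R m = fun x => \sum_(i <- index_enum 'I_m) tnth x i * tnth x i)//.
elim: (index_enum _) => [|i r IH].
  under eq_fun do [rewrite big_nil]; exact: measurable_cst.
under eq_fun do [rewrite big_cons]; apply: measurable_funD => //.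
by apply: measurable_funM => //; exact: measurable_tnth.
Qed.

Lemma measurable_rho : measurable_fun setT rho.
Proof. by apply: measurable_minr => //; exact: measurable_sqnorm. Qed.

(* Continuity along the filter [U]: tuples carry no topology in the library. *)
Definition fconv (U : set_system nat) (f : V -> R) := forall (x_ : nat -> V) x,
  (forall i, tnth (x_ k) i @[k --> U] --> tnth x i) -> f (x_ k) @[k --> U] --> f x.

Section fconv.
Variables (U : set_system nat) (FU : ProperFilter U).

Lemma fconv_sqnorm : fconv U (@sqnorm R m).
Proof. by move=> x_ x h; apply: cvg_sum => i; apply: cvgM; exact: h. Qed.

Lemma min1_lip (a b : R) : `|Num.min 1 a - Num.min 1 b| <= `|a - b|.
Proof.
rewrite ler_norml; have := ler_norm (a - b); have := ler_norm (b - a).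
rewrite distrC /Num.min; have := normr_ge0 (b - a); move: `|b - a| => c c0 h1 h2.
by case: ltP => ha; case: ltP => hb; apply/andP; split; lra.
Qed.

Lemma fconv_rho : fconv U rho.
Proof.
move=> x_ x h; apply/cvgrPdist_le => e e0.
have /cvgrPdist_le/(_ _ e0) := fconv_sqnorm h; apply: filterS => k.
by apply: le_trans; exact: min1_lip.
Qed.

End fconv.
End rho.

Section levy_khintchine.
Variables (R : realType) (d : measure_display) (T : measurableType d).
Variables (P : probability T R) (X : @process R T).
Hypothesis mX : forall t, measurable_fun setT (X t).
Hypothesis scX : forall t eps delta : R, 0 < eps -> 0 < delta -> exists eta : R,
  0 < eta /\ forall s, `|s - t| < eta ->
    fine (P [set w | eps < `|X s w - X t w|]) < delta.
Hypothesis tsX : forall n l, (0 < n)%N -> phi P X (scl n%:R 1 l) = phi P X l ^+ n.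
Variables (U : set_system nat) (UU : UltraFilter U) (Uoo : \oo `<=` U).
Variables (m : nat) (t : m.-tuple R).
Local Notation V := (m.-tuple R).
Local Notation p2 k := ((2 ^+ k)^-1 : R).

Definition Dv (k : nat) (w : T) : V := [tuple X (p2 k * tnth t i) w | i < m].

Lemma DvE k w i : tnth (Dv k w) i = X (p2 k * tnth t i) w.
Proof. by rewrite tnth_mktuple. Qed.

Lemma measurable_Dv k : measurable_fun setT (Dv k).
Proof.
apply/measurable_fun_tnthP => i; rewrite (_ : _ \o _ = X (p2 k * tnth t i))//.
by apply: funext => w /=; rewrite DvE.
Qed.

Let I k (f : T -> R) := 2 ^+ k * Ex P (fun w => rho (Dv k w) * f w).

Let p20 j : 0 < 2 ^+ j :> R. Proof. by rewrite exprn_gt0. Qed.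

Let bmf_rho k : bmf (fun w => rho (Dv k w)).
Proof.
split; first exact: (measurableT_comp (@measurable_rho R m) (measurable_Dv k)).
by exists 1 => w; rewrite ger0_norm ?rho_ge0 ?rho_le1.
Qed.

Let pI_ex : exists K, forall k, posfun (I k) K.
Proof.
have B i := cid (dyadic_mass mX scX tsX (tnth t i)).
exists (\sum_(i < m) sval (B i)) => k; split.
- move=> f g bf bg; rewrite /I -mulrDr -ExD; [|exact: bmfM..].
  by congr (_ * _); apply: eq_Ex => w; rewrite mulrDr.
- move=> c f bf; rewrite /I [RHS]mulrCA -(ExZ _ _ (bmfM (bmf_rho k) bf)).
  by congr (_ * _); apply: eq_Ex => w; rewrite mulrCA.
- move=> f bf f0; rewrite /I mulr_ge0 ?(ltW (p20 _))// Ex_ge0// => w.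
  by rewrite mulr_ge0// rho_ge0.
apply: (@le_trans _ _ (\sum_(i < m) 2 ^+ k * Ex P (fun w => Num.min 1 (X (p2 k * tnth t i) w ^+ 2)))).
  rewrite -mulr_sumr -Ex_sum; last by move=> i; exact: bmf_min1_sqr.
  rewrite /I ler_wpM2l ?(ltW (p20 _))//; apply: Ex_le.
  - by apply: bmfM => //; exact: bmf_cst.
  - by apply: bmf_sum => i; exact: bmf_min1_sqr.
  move=> w; rewrite mulr1; apply: le_trans (rho_le_sum _) _.
  by rewrite le_eqVlt; apply/orP; left; apply/eqP; apply: eq_bigr => i _; rewrite DvE.
by apply: ler_sum => i _; case: (B i) => Bi /=; exact.
Qed.

(* Equals [0] where [rho] vanishes, i.e. at the origin. *)
Definition rdiv (f : V -> R) (x : V) : R := f x / rho x.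

Lemma rdiv_bound f K : (forall x, `|f x| <= K * rho x) -> forall x, `|rdiv f x| <= `|K|.
Proof.
move=> fK x; rewrite /rdiv normrM normfV (ger0_norm (rho_ge0 x)).
have := rho_ge0 x; rewrite le_eqVlt => /predU1P[<-|r0].
  by rewrite invr0 mulr0.
by rewrite ler_pdivrMr// (le_trans (fK x))// ler_wpM2r ?(ltW r0)// ler_norm.
Qed.

Lemma rdivK f K x : (forall x, `|f x| <= K * rho x) -> rho x * rdiv f x = f x.
Proof.
move=> fK; have [r0|r0] := eqVneq (rho x) 0; last by rewrite /rdiv mulrCA mulfV ?mulr1.
have := fK x; rewrite r0 mulr0 normr_le0 => /eqP ->.
by rewrite mul0r.
Qed.

Lemma measurable_rdiv f : measurable_fun setT f -> measurable_fun setT (rdiv f).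
Proof.
move=> mf; rewrite (_ : rdiv f = fun x => f x * (rho x `^ (-1))).
  apply: measurable_funM => //.
  exact: (measurableT_comp (measurable_powR (-1)) (@measurable_rho R m)).
by apply: funext => x; rewrite powR_inv1// rho_ge0.
Qed.

(** [M] is the Loeb measure of the [rho]-weighted functionals and [Y] the standard part of [D_k].
    Integrands that are [o (|x|^2)] pass to the limit exactly; for nonnegative ones only an
    inequality survives, because infinitesimal increments of positive weighted mass are sent to
    [Y = 0], where [rdiv f] vanishes. *)
Theorem dyadic_limit : exists (dS : measure_display) (S : measurableType dS)
  (M : {finite_measure set S -> \bar R}) (Y : S -> V),
  [/\ measurable_fun setT Y,
   (forall f K, measurable_fun setT f -> fconv U f -> (forall x, `|f x| <= K * rho x) ->
     (forall e, 0 < e -> exists de, 0 < de /\ forall x, sqnorm x <= de -> `|f x| <= e * sqnorm x) ->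
     2 ^+ k * Ex P (fun w => f (Dv k w)) @[k --> U] --> Ex M (fun w => rdiv f (Y w))) &
   (forall f K L, measurable_fun setT f -> fconv U f -> (forall x, `|f x| <= K * rho x) ->
     (forall x, 0 <= f x) ->
     2 ^+ k * Ex P (fun w => f (Dv k w)) @[k --> U] --> L ->
     Ex M (fun w => rdiv f (Y w)) <= L)].
Proof.
have [K pI] := pI_ex.
have [M MP] := @loeb_integral U UU (fun=> d) (fun=> T) Uoo R I K pI.
set S := g_sigma_algebraType _ in M MP.
pose b i := st (fun k (w : T) => squash (tnth (Dv k w) i)) : S -> R.
have mD i k : measurable_fun setT (fun w => tnth (Dv k w) i).
  by have /measurable_fun_tnthP/(_ i) := measurable_Dv k.
have [mb bb] : (forall i, measurable_fun setT (b i)) /\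
    (forall i w, squash (tnth (Dv k (w k)) i) @[k --> U] --> b i w).
  split => [i|i w].
    apply: (MP (fun k (x : T) => squash (tnth (Dv k x) i)) 1 _ _).1 => [k|k x]; last exact: squash_le1.
    apply: measurableT_comp => //; apply: continuous_measurable_fun.
    exact: continuous_squash.
  apply: (@ultra_cvg R U UU (fun k => squash (tnth (Dv k (w k)) i)) 1) => k; exact: squash_le1.
pose Y w : V := [tuple unsquash (b i w) | i < m].
have mY : measurable_fun setT Y.
  apply/measurable_fun_tnthP => i; rewrite (_ : _ \o _ = fun w => unsquash (b i w)).
    by apply: measurableT_comp => //; exact: measurable_unsquash.
  by apply: funext => w /=; rewrite tnth_mktuple.
pose N i : set S := [set w | 1 <= `|b i w|].
have mN i : measurable (N i).
  apply: measurable_ge_set.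
  by apply: (measurableT_comp (@normr_measurable R setT) (mb i)).
have XY i w : ~ N i w -> tnth (Dv k (w k)) i @[k --> U] --> tnth (Y w) i.
  move=> /negP; rewrite -ltNge => bw; rewrite /Y tnth_mktuple unsquashE//.
  rewrite (_ : (fun k => _) = fun k => squash (tnth (Dv k (w k)) i) / (1 - `|squash (tnth (Dv k (w k)) i)|)).
    apply: cvgM => //; apply: cvgV; first by rewrite gt_eqF// subr_gt0.
    by apply: cvgB; [exact: cvg_cst | apply: cvg_norm; exact: bb].
  by apply: funext => k; rewrite squashK.
(* As for processes, infinite coordinates force [|D_k| >= A] for [U]-many [k]; since [rho <= 1], the
   weighted mass of that event is at most the one bounded by [dyadic_tail]. *)
have MN i : fine (M (N i)) = 0.
  apply/eqP; rewrite eq_le fine_ge0// andbT; apply/ler_addgt0Pr => e e0; rewrite add0r.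
  have [A [k0 [A0 hA]]] := dyadic_tail mX scX tsX (tnth t i) e0.
  pose B k : set T := [set w | A <= `|tnth (Dv k w) i|].
  have mB k : measurable (B k).
    apply: (@measurable_ge_set _ _ _ (fun w => `|tnth (Dv k w) i|)).
    exact: measurableT_comp.
  have B1 (k : nat) (x : T) : `|\1_(B k) x : R| <= 1 by exact: abs_indic_le1.
  have [ms es] := MP (fun k => \1_(B k)) 1 (fun k => (bmf_indic R (mB k)).1) B1.
  have cB (w : S) : \1_(B k) (w k) @[k --> U] --> st (fun k => \1_(B k) : T -> R) w.
    by apply: (@ultra_cvg R U UU (fun k => \1_(B k) (w k)) 1) => k; exact: B1.
  rewrite -Ex_indic//; apply: (@le_trans _ _ (Ex M (st (fun k => \1_(B k) : T -> R)))).
    apply: Ex_le.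
    - exact: bmf_indic.
    - split => //; exists 1 => w.
      rewrite -(cvg_lim _ (cvg_norm (cB w)))//; apply: limr_le.
        by apply/cvg_ex; eexists; apply: cvg_norm; exact: cB.
      exact: nearW.
    move=> w; rewrite indicE; have [/set_mem Nw|_] := boolP (w \in N i); last first.
      by apply: limr_ge; [apply/cvg_ex; eexists; exact: cB|apply: nearW => k; rewrite indicE].
    rewrite (_ : st _ w = 1)//; apply: cvg_lim => //; apply: cvg_near_cst.
    have M0 : 0 <= A by exact: ltW.
    have M1 : A / (1 + A) < 1 by rewrite ltr_pdivrMr ?mul1r; lra.
    have : \forall k \near U, A / (1 + A) < `|squash (tnth (Dv k (w k)) i)|.
      have := cvgr_gt _ (cvg_norm (bb i w)) (A / (1 + A)); apply.
      exact: lt_le_trans Nw.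
    by apply: filterS => k /(squash_big M0) h; rewrite indicE mem_set// /B /= ltW.
  rewrite es; apply: limr_le.
    by apply: (@ultra_cvg R U UU _ (1 * K)) => k; apply: (posfun_abs (pI k)) => //; exact: bmf_indic.
  have : U [set k | (k0 <= k)%N] by apply: Uoo; exact: nbhs_infty_ge.
  apply: filterS => k /hA; apply: le_trans; rewrite /I ler_wpM2l ?(ltW (p20 _))//.
  have -> : [set w | A <= `|X (p2 k * tnth t i) w|] = B k.
    by apply/seteqP; split => w; rewrite /B /= DvE.
  rewrite -Ex_indic//; apply: Ex_le.
  - by apply: bmfM => //; exact: bmf_indic.
  - exact: bmf_indic.
  by move=> w; rewrite ler_piMl ?rho_le1// indicE.
pose g f k (w : T) := rdiv f (Dv k w).
have gI (f : V -> R) K' k : (forall x, `|f x| <= K' * rho x) -> I k (g f k) = 2 ^+ k * Ex P (fun w => f (Dv k w)).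
  by move=> fK; rewrite /I; congr (_ * _); apply: eq_Ex => w; rewrite /g (rdivK _ fK).
have gst (f : V -> R) K' : measurable_fun setT f -> (forall x, `|f x| <= K' * rho x) ->
    [/\ bmf (st (g f)), 2 ^+ k * Ex P (fun w => f (Dv k w)) @[k --> U] --> Ex M (st (g f)),
     (forall w, g f k (w k) @[k --> U] --> st (g f) w) & bmf (fun w => rdiv f (Y w))].
  move=> mf fK; have gb k w : `|g f k w| <= `|K'| by exact: rdiv_bound.
  have mg k : measurable_fun setT (g f k).
    exact: (measurableT_comp (measurable_rdiv mf) (measurable_Dv k)).
  have [ms es] := MP (g f) `|K'| mg gb.
  have cg w : g f k (w k) @[k --> U] --> st (g f) w.
    by apply: (@ultra_cvg R U UU (fun k => g f k (w k)) `|K'|) => k; exact: gb.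
  split => //.
  - split => //; exists `|K'| => w.
    rewrite -(cvg_lim _ (cvg_norm (cg w)))//; apply: limr_le.
      by apply/cvg_ex; eexists; apply: cvg_norm; exact: cg.
    by apply: nearW => k.
  - rewrite es (_ : (fun k => _) = fun k => I k (g f k)); last first.
      by apply: funext => k; rewrite (gI _ _ _ fK).
    apply: (@ultra_cvg R U UU _ (`|K'| * K)) => k.
    by apply: (posfun_abs (pI k)) => //; split => //; exists `|K'|.
  - split; last by exists `|K'| => w; exact: rdiv_bound.
    exact: (measurableT_comp (measurable_rdiv mf) mY).
have good (f : V -> R) K' (w : S) : (forall x, `|f x| <= K' * rho x) -> fconv U f ->
    (forall i, ~ N i w) -> sqnorm (Y w) != 0 -> g f k (w k) @[k --> U] --> rdiv f (Y w).
  move=> fK cf Nw Y0; apply: cvgM; first by apply: cf => i; exact: XY.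
  apply: cvgV; first by rewrite rho_eq0.
  by apply: fconv_rho => i; exact: XY.
have zero (f : V -> R) K' (w : S) : (forall x, `|f x| <= K' * rho x) -> sqnorm (Y w) = 0 -> rdiv f (Y w) = 0.
  move=> fK Y0; rewrite /rdiv; have /eqP -> : rho (Y w) == 0 by rewrite rho_eq0 Y0.
  by rewrite invr0 mulr0.
have null : 0 = Ex M (fun w => \sum_(i < m) \1_(N i) w).
  rewrite Ex_sum; last by move=> p; exact: bmf_indic.
  by rewrite big1// => p _; rewrite Ex_indic.
have Nsum (w : S) : ~ (forall i, ~ N i w) -> 1 <= \sum_(i < m) \1_(N i) w :> R.
  move=> h; have [i /contrapT Ni] := (existsNP _).2 h.
  by rewrite (bigD1 i)//= indicE mem_set// lerDl sumr_ge0// => j _; rewrite indicE.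
have bN : bmf (fun w => \sum_(i < m) \1_(N i) w : R) by apply: bmf_sum => i; exact: bmf_indic.
have N0 (w : S) : 0 <= \sum_(i < m) \1_(N i) w :> R by apply: sumr_ge0 => i _; rewrite indicE.
exists _, S, M, Y; split => //.
  move=> f K' mf cf fK fo; have [bst cst cg bY] := gst f K' mf fK.
  suff -> : Ex M (fun w => rdiv f (Y w)) = Ex M (st (g f)) by [].
  apply/eqP; rewrite -subr_eq0 -normr_le0 -ExB//.
  have [c1 hc1] := bst.2; have [c2 hc2] := bY.2.
  have -> : 0 = Ex M (fun w => (c2 + c1) * \sum_(i < m) \1_(N i) w) :> R.
    by rewrite ExZ// -null mulr0.
  apply: Ex_abs; [exact: bmfB|exact: bmfZ|] => w.
  have [Nw|Nw] := pselect (forall i, ~ N i w); last first.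
    apply: le_trans (ler_normB _ _) _; apply: le_trans (lerD (hc2 w) (hc1 w)) _.
    rewrite ler_peMr ?Nsum// (le_trans (normr_ge0 (rdiv f (Y w) - st (g f) w)))//.
    by apply: le_trans (ler_normB _ _) _; exact: lerD.
  rewrite (_ : rdiv f (Y w) = st (g f) w).
    rewrite subrr normr0 mulr_ge0// (le_trans (normr_ge0 (rdiv f (Y w) - st (g f) w)))//.
    by apply: le_trans (ler_normB _ _) _; exact: lerD.
  (* Away from [Y = 0] continuity gives the limit of [f / rho]. At [Y = 0] the increments are
     infinitesimal, and the smallness of [f] forces the limit [0], the value of [rdiv f] at the
     origin. *)
  apply/esym; have [Y0|Y0] := eqVneq (sqnorm (Y w)) 0; last first.
    by apply: cvg_lim => //; exact: good fK cf Nw Y0.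
  rewrite (zero f K')//; apply: cvg_lim => //; apply/cvgrPdist_le => e e0.
  have [de [de0 hde]] := fo e e0.
  have sq0 : sqnorm (Dv k (w k)) @[k --> U] --> sqnorm (Y w) by apply: fconv_sqnorm => i; exact: XY.
  have d1 : 0 < Num.min de 1 by rewrite lt_min de0 ltr01.
  move: sq0; rewrite Y0 => /cvgr0_norm_le /(_ _ d1); apply: filterS => k.
  rewrite ger0_norm ?sqnorm_ge0// le_min => /andP[s1 s2].
  rewrite sub0r normrN /g /rdiv normrM normfV (ger0_norm (rho_ge0 _)) rho_small//.
  have := sqnorm_ge0 (Dv k (w k)); rewrite le_eqVlt => /predU1P[<-|r0].
    by rewrite invr0 mulr0 ltW.
  by rewrite ler_pdivrMr// hde.
(* Where [Y = 0] the left integrand is [0] while [st (g f)] is only nonnegative. This gap is where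
   the Gaussian part comes from. *)
move=> f K' L mf cf fK f0 fL; have [bst cst cg bY] := gst f K' mf fK.
have -> : L = Ex M (st (g f)) by exact: (cvg_unique _ fL cst).
have st0 w : 0 <= st (g f) w.
  apply: limr_ge; first by apply/cvg_ex; eexists; exact: cg.
  by apply: nearW => k; rewrite /g /rdiv divr_ge0// rho_ge0.
have [c2 hc2] := bY.2.
have -> : Ex M (st (g f)) = Ex M (fun w => st (g f) w + c2 * \sum_(i < m) \1_(N i) w).
  by rewrite ExD ?ExZ// -?null ?mulr0 ?addr0//; exact: bmfZ.
apply: Ex_le => //; first by apply: bmfD => //; exact: bmfZ.
move=> w; have c20 : 0 <= c2 by apply: le_trans (hc2 w).
have [Nw|Nw] := pselect (forall i, ~ N i w); last first.
  apply: le_trans (ler_norm _) _; apply: le_trans (hc2 w) _.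
  apply: (@le_trans _ _ (c2 * \sum_(i < m) \1_(N i) w)); first by rewrite ler_peMr// Nsum.
  by rewrite lerDr.
apply: (@le_trans _ _ (st (g f) w)); last by rewrite lerDl mulr_ge0.
have [Y0|Y0] := eqVneq (sqnorm (Y w)) 0; first by rewrite (zero f K').
rewrite le_eqVlt; apply/orP; left; apply/eqP/esym.
by apply: cvg_lim => //; exact: good fK cf Nw Y0.
Qed.

End levy_khintchine.

(** * Soft thresholding and test functions *)

Section soft_threshold.
Variable R : realType.
Implicit Types (x y e : R).

(* Soft thresholding: a continuous substitute for discarding jumps of size at
   most [e]. *)
Definition soft e x : R := Num.max 0 (x - e) - Num.max 0 (- x - e).

Lemma max0_lip (a b : R) : `|Num.max 0 a - Num.max 0 b| <= `|a - b|.
Proof.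
rewrite ler_norml; have := ler_norm (a - b); have := ler_norm (b - a).
rewrite distrC /Num.max; have := normr_ge0 (b - a); move: `|b - a| => c c0 h1 h2.
by case: ltP => ha; case: ltP => hb; apply/andP; split; lra.
Qed.

Lemma soft_lip e x y : `|soft e x - soft e y| <= 2 * `|x - y|.
Proof.
have -> : soft e x - soft e y = (Num.max 0 (x - e) - Num.max 0 (y - e)) -
    (Num.max 0 (- x - e) - Num.max 0 (- y - e)) by rewrite /soft; ring.
apply: le_trans (ler_normB _ _) _.
have h1 := max0_lip (x - e) (y - e); have h2 := max0_lip (- x - e) (- y - e).
have e1 : x - e - (y - e) = x - y by ring.
have e2 : - x - e - (- y - e) = - (x - y) by ring.
by rewrite e1 in h1; rewrite e2 normrN in h2; lra.
Qed.

Lemma soft_le e x : 0 <= e -> `|soft e x| <= `|x|.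
Proof.
move=> e0; rewrite /soft /Num.max ler_norml; have := ler_norm x; have := ler_norm (- x).
rewrite normrN; move: `|x| => c h1 h2.
by case: ltP => ha; case: ltP => hb; apply/andP; split; lra.
Qed.

Lemma soft_near e x : 0 <= e -> `|soft e x - x| <= e.
Proof.
move=> e0; rewrite /soft /Num.max ler_norml.
by case: ltP => ha; case: ltP => hb; apply/andP; split; lra.
Qed.

Lemma soft_eq0 e x : `|x| <= e -> soft e x = 0.
Proof.
rewrite ler_norml /soft /Num.max => /andP[h1 h2].
by case: ltP => ha; case: ltP => hb; lra.
Qed.

Lemma continuous_soft e : continuous (soft e).
Proof.
move=> x; apply/cvgrPdist_le => r r0; have r2 : 0 < r / 2 by rewrite divr_gt0.
have c : y @[y --> x] --> x by exact: cvg_id.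
move/cvgrPdist_le : c => /(_ _ r2); apply: filterS => y h.
by rewrite (le_trans (soft_lip _ _ _))//; lra.
Qed.

Lemma abs_sub_sin_le3 x : `|x - sin x| <= `|x| ^+ 3.
Proof.
wlog x0 : x / 0 <= x => [h|].
  have [/h//|x0] := leP 0 x.
  have := h (- x); rewrite sinN normrN oppr_ge0 => /(_ (ltW x0)).
  by rewrite -opprB normrN opprK addrC.
have [c /andP[c0 cx] ->] := sin_mvt x0.
have -> : x - cos c * x = x * (1 - cos c) by ring.
rewrite ger0_norm ?mulr_ge0 ?one_sub_cos_ge0// (ger0_norm x0) exprS ler_wpM2l//.
have := one_sub_cos_le c; have : c ^+ 2 <= x ^+ 2 by rewrite ler_sqr ?nnegrE.
by have := sqr_ge0 c; lra.
Qed.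

Lemma cos_taylor2 x : `|cos x - 1 + x ^+ 2 / 2| <= `|x| ^+ 3.
Proof.
have -> : cos x - 1 + x ^+ 2 / 2 = 2 * (x / 2 - sin (x / 2)) * (x / 2 + sin (x / 2)).
  by have := one_sub_cosE x; lra.
rewrite !normrM (@ger0_norm _ 2)//.
have h1 := abs_sub_sin_le (x / 2).
have h2 : `|x / 2 + sin (x / 2)| <= `|x|.
  apply: le_trans (ler_normD _ _) _; have := abs_sin_le (x / 2).
  by rewrite normrM (@ger0_norm _ 2^-1)//; lra.
have -> : `|x| ^+ 3 = `|x| ^+ 2 * `|x| by rewrite -exprSr.
rewrite ler_pM ?mulr_ge0//; rewrite real_normK ?num_real//.
by rewrite expr_div_n in h1; lra.
Qed.

End soft_threshold.

Section test_functions.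
Variables (R : realType) (m : nat).
Local Notation V := (m.-tuple R).
Implicit Types (x th : V).

Definition rad x : R := Num.sqrt (sqnorm x).

Lemma rad_ge0 x : 0 <= rad x. Proof. exact: sqrtr_ge0. Qed.

Lemma rad_sqr x : rad x ^+ 2 = sqnorm x.
Proof. by rewrite sqr_sqrtr// sqnorm_ge0. Qed.

Lemma coord_le_rad x i : `|tnth x i| <= rad x.
Proof.
rewrite -ler_sqr ?nnegrE ?rad_ge0// rad_sqr real_normK ?num_real//.
exact: coord_sqr_le.
Qed.

Definition wt th : R := \sum_(i < m) `|tnth th i|.

Lemma wt_ge0 th : 0 <= wt th. Proof. exact: sumr_ge0. Qed.

Lemma sum_wt_le th (c : R) (F : 'I_m -> R) : (forall i, `|F i| <= c) ->
  `|\sum_(i < m) tnth th i * F i| <= wt th * c.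
Proof.
move=> Fc; apply: le_trans (ler_norm_sum _ _ _) _.
rewrite /wt mulr_suml; apply: ler_sum => i _; rewrite normrM.
by rewrite ler_wpM2l.
Qed.

Lemma dot_le th x : `|dot th x| <= wt th * rad x.
Proof. by apply: sum_wt_le => i; exact: coord_le_rad. Qed.

(** Bounded continuous substitute for [dot th x], used as the centring function. Its discontinuous
    counterpart from the triplet is restored only at the end. *)
Definition sdot th x : R := \sum_(i < m) tnth th i * sin (tnth x i).

Lemma sdot_le th x : `|sdot th x| <= wt th * rad x.
Proof.
by apply: sum_wt_le => i; exact: le_trans (abs_sin_le _) (coord_le_rad _ _).
Qed.

Lemma sdot_bd th x : `|sdot th x| <= wt th.
Proof. by rewrite -[leRHS]mulr1; apply: sum_wt_le => i; exact: sin_max. Qed.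

Lemma sqr_le_rad (y c : R) x : 0 <= c -> `|y| <= c * rad x -> y ^+ 2 <= c ^+ 2 * sqnorm x.
Proof.
move=> c0 h; rewrite -rad_sqr -exprMn -[leLHS]real_normK ?num_real//.
by rewrite ler_sqr ?nnegrE// mulr_ge0// rad_ge0.
Qed.

Lemma bound_rho (y A B : R) x : 0 <= A -> 0 <= B -> `|y| <= A -> `|y| <= B * sqnorm x ->
  `|y| <= (A + B) * rho x.
Proof.
move=> A0 B0 yA yB; rewrite /rho; have s0 := sqnorm_ge0 x.
have [h|h] := leP 1 (sqnorm x).
  by rewrite mulr1 (le_trans yA)// lerDl.
by rewrite (le_trans yB)// ler_wpM2r// lerDr.
Qed.

(** The condition [o (|x|^2)] at the origin under which limits do not see the mass collapsing
    there. *)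
Definition flat (f : V -> R) := forall e, 0 < e -> exists de, 0 < de /\
  forall x, sqnorm x <= de -> `|f x| <= e * sqnorm x.

Lemma flat_cubic (f : V -> R) B : 0 <= B ->
  (forall x, `|f x| <= B * rad x * sqnorm x) -> flat f.
Proof.
move=> B0 fB e e0; have B1 : 0 < B + 1 by lra.
exists ((e / (B + 1)) ^+ 2); split; first by rewrite exprn_gt0// divr_gt0.
move=> x; rewrite -rad_sqr ler_sqr ?nnegrE ?rad_ge0//; last by rewrite divr_ge0// ltW.
rewrite ler_pdivlMr// => h; apply: le_trans (fB x) _; rewrite rad_sqr.
rewrite ler_wpM2r ?sqnorm_ge0//; have := rad_ge0 x; nra.
Qed.

Lemma measurable_coord i : measurable_fun setT (fun x : V => tnth x i).
Proof. exact: measurable_tnth. Qed.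

Lemma measurable_sumord (F : 'I_m -> V -> R) : (forall i, measurable_fun setT (F i)) ->
  measurable_fun setT (fun x => \sum_(i < m) F i x).
Proof.
move=> mF; elim: (index_enum _) => [|i r IH].
  under eq_fun do [rewrite big_nil]; exact: measurable_cst.
by under eq_fun do [rewrite big_cons]; apply: measurable_funD.
Qed.

Lemma measurable_sinc i : measurable_fun setT (fun x : V => sin (tnth x i)).
Proof.
apply: (measurableT_comp _ (measurable_coord i)).
apply: continuous_measurable_fun; exact: continuous_sin.
Qed.

Lemma measurable_sdot th : measurable_fun setT (sdot th).
Proof. by apply: measurable_sumord => i; apply: measurable_funM => //; exact: measurable_sinc. Qed.

Section fconv_rules.
Variables (U : set_system nat) (FU : ProperFilter U).

Lemma fconv_coord i : fconv U (fun x : V => tnth x i).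
Proof. by move=> x_ x h; exact: h. Qed.

Lemma fconv_comp (h : R -> R) (f : V -> R) : continuous h -> fconv U f -> fconv U (fun x => h (f x)).
Proof.
move=> ch cf x_ x hx; have hf := cf x_ x hx.
have hh := continuous_cvg _ (ch (f x)) hf; exact: hh.
Qed.

Lemma fconvD (f g : V -> R) : fconv U f -> fconv U g -> fconv U (fun x => f x + g x).
Proof. by move=> cf cg x_ x hx; apply: cvgD; [exact: cf|exact: cg]. Qed.

Lemma fconvM (f g : V -> R) : fconv U f -> fconv U g -> fconv U (fun x => f x * g x).
Proof. by move=> cf cg x_ x hx; apply: cvgM; [exact: cf|exact: cg]. Qed.

Lemma fconv_cst (c : R) : fconv U (fun _ : V => c).
Proof. by move=> x_ x hx; exact: cvg_cst. Qed.

Lemma fconvB (f g : V -> R) : fconv U f -> fconv U g -> fconv U (fun x => f x - g x).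
Proof. by move=> cf cg x_ x hx; apply: cvgB; [exact: cf|exact: cg]. Qed.

Lemma fconv_sumord (F : 'I_m -> V -> R) : (forall i, fconv U (F i)) ->
  fconv U (fun x => \sum_(i < m) F i x).
Proof. by move=> cF x_ x hx; apply: cvg_sum => i; exact: cF. Qed.

Lemma fconv_dot th : fconv U (dot th).
Proof.
by apply: fconv_sumord => i; apply: fconvM; [exact: fconv_cst|exact: fconv_coord].
Qed.

Lemma fconv_sinc i : fconv U (fun x : V => sin (tnth x i)).
Proof. by apply: fconv_comp; [exact: continuous_sin|exact: fconv_coord]. Qed.

Lemma fconv_sdot th : fconv U (sdot th).
Proof.
by apply: fconv_sumord => i; apply: fconvM; [exact: fconv_cst|exact: fconv_sinc].
Qed.

End fconv_rules.

(** Integrands of the real and imaginary parts of the exponent. [fsin] is flat, by its centring, but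
    [fcos] is of second order; [fcos2] cancels its quadratic term, and the term added there is what
    produces [Q]. *)
Definition fcos th x : R := cos (dot th x) - 1.
Definition fsin th x : R := sin (dot th x) - sdot th x.
Definition fcos2 th x : R := fcos th x + sdot th x ^+ 2 / 2.

Lemma measurable_fcos th : measurable_fun setT (fcos th).
Proof.
apply: measurable_funB => //.
apply: (measurableT_comp _ (measurable_dot th)).
by apply: continuous_measurable_fun; exact: continuous_cos.
Qed.

Lemma measurable_fsin th : measurable_fun setT (fsin th).
Proof.
apply: measurable_funB; last exact: measurable_sdot.
apply: (measurableT_comp _ (measurable_dot th)).
by apply: continuous_measurable_fun; exact: continuous_sin.
Qed.

Lemma measurable_fcos2 th : measurable_fun setT (fcos2 th).
Proof.
apply: measurable_funD; first exact: measurable_fcos.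
by apply: measurable_funM => //; apply: measurable_funX; exact: measurable_sdot.
Qed.

Lemma fcos_abs th x : `|fcos th x| <= (2 + wt th ^+ 2) * rho x.
Proof.
have w2 : 0 <= wt th ^+ 2 by exact: sqr_ge0.
have c0 := one_sub_cos_ge0 (dot th x).
apply: bound_rho => //; rewrite /fcos distrC ger0_norm//.
  by have := cos_geN1 (dot th x); lra.
have := one_sub_cos_le (dot th x); have := sqr_le_rad (wt_ge0 th) (dot_le th x).
by have := sqr_ge0 (dot th x); lra.
Qed.

Lemma fsin_abs th x : `|fsin th x| <= (1 + wt th + (2 * wt th ^+ 2 + 2 * wt th)) * rho x.
Proof.
have w0 := wt_ge0 th; have w2 : 0 <= wt th ^+ 2 by exact: sqr_ge0.
apply: bound_rho; [by lra|by lra| |].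
  apply: le_trans (ler_normB _ _) _; apply: lerD; [exact: sin_max|exact: sdot_bd].
have -> : fsin th x = - (dot th x - sin (dot th x)) + (dot th x - sdot th x) by rewrite /fsin; ring.
apply: le_trans (ler_normD _ _) _; rewrite normrN mulrDl; apply: lerD.
  apply: le_trans (abs_sub_sin_le _) _; rewrite -mulrA ler_wpM2l//.
  exact: sqr_le_rad (wt_ge0 th) (dot_le th x).
rewrite /dot /sdot -sumrB.
under eq_bigr do rewrite -mulrBr.
rewrite [2 * _]mulrC -mulrA; apply: sum_wt_le => i.
apply: le_trans (abs_sub_sin_le _) _; rewrite ler_wpM2l//; exact: coord_sqr_le.
Qed.

Lemma dot_sdot_le3 th x : `|dot th x - sdot th x| <= wt th * rad x * sqnorm x.
Proof.
rewrite /dot /sdot -sumrB; under eq_bigr do rewrite -mulrBr.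
rewrite -mulrA; apply: sum_wt_le => i.
apply: le_trans (abs_sub_sin_le3 _) _; rewrite -rad_sqr -exprS lerXn2r ?nnegrE ?rad_ge0//.
exact: coord_le_rad.
Qed.

Lemma cube_le_rad th x : `|dot th x| ^+ 3 <= wt th ^+ 3 * rad x * sqnorm x.
Proof.
rewrite -rad_sqr -mulrA -exprS -exprMn lerXn2r ?nnegrE ?mulr_ge0 ?rad_ge0 ?wt_ge0//.
exact: dot_le.
Qed.

Lemma fsin_flat th : flat (fsin th).
Proof.
have w0 := wt_ge0 th; have w3 : 0 <= wt th ^+ 3 by rewrite exprn_ge0.
apply: (@flat_cubic _ (wt th ^+ 3 + wt th)); first by lra.
move=> x; have -> : fsin th x = - (dot th x - sin (dot th x)) + (dot th x - sdot th x) by rewrite /fsin; ring.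
apply: le_trans (ler_normD _ _) _; rewrite normrN !mulrDl; apply: lerD; last exact: dot_sdot_le3.
exact: le_trans (abs_sub_sin_le3 _) (cube_le_rad _ _).
Qed.

Lemma fcos2_flat th : flat (fcos2 th).
Proof.
have w0 := wt_ge0 th; have w3 : 0 <= wt th ^+ 3 by rewrite exprn_ge0.
have w2 : 0 <= wt th ^+ 2 by exact: sqr_ge0.
pose B := wt th ^+ 3 + 2 * wt th ^+ 2.
apply: (@flat_cubic _ B); first by rewrite /B; lra.
move=> x.
have -> : fcos2 th x = (cos (dot th x) - 1 + dot th x ^+ 2 / 2) -
    (dot th x ^+ 2 - sdot th x ^+ 2) / 2 by rewrite /fcos2 /fcos; field.
have -> : B * rad x * sqnorm x = wt th ^+ 3 * rad x * sqnorm x + 2 * wt th ^+ 2 * rad x * sqnorm x.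
  by rewrite /B; ring.
apply: le_trans (ler_normB _ _) _; apply: lerD.
  exact: le_trans (cos_taylor2 _) (cube_le_rad _ _).
rewrite subr_sqr normrM (@ger0_norm _ 2^-1)// normrM.
have h1 : `|dot th x - sdot th x| <= 2 * wt th * sqnorm x.
  rewrite /dot /sdot -sumrB; under eq_bigr do rewrite -mulrBr.
  rewrite [2 * _]mulrC -mulrA; apply: sum_wt_le => i.
  apply: le_trans (abs_sub_sin_le _) _; rewrite ler_wpM2l//; exact: coord_sqr_le.
have h2 : `|dot th x + sdot th x| <= 2 * (wt th * rad x).
  apply: le_trans (ler_normD _ _) _.
  by have := dot_le th x; have := sdot_le th x; lra.
have := ler_pM (normr_ge0 _) (normr_ge0 _) h1 h2.
have -> : 2 * wt th * sqnorm x * (2 * (wt th * rad x)) = 2 * (2 * wt th ^+ 2 * rad x * sqnorm x) by ring.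
lra.
Qed.

Lemma sdot_sqr_abs th x : `|sdot th x ^+ 2| <= (wt th ^+ 2 + wt th ^+ 2) * rho x.
Proof.
have w2 : 0 <= wt th ^+ 2 by exact: sqr_ge0.
rewrite ger0_norm ?sqr_ge0//.
rewrite -[leLHS]ger0_norm ?sqr_ge0//; apply: bound_rho => //; rewrite ger0_norm ?sqr_ge0//.
  by rewrite -[leLHS]real_normK ?num_real// ler_sqr ?nnegrE ?wt_ge0// sdot_bd.
exact: sqr_le_rad (wt_ge0 th) (sdot_le th x).
Qed.

Lemma fcos2_abs th x : `|fcos2 th x| <= (2 + wt th ^+ 2 + (wt th ^+ 2 + wt th ^+ 2)) * rho x.
Proof.
apply: le_trans (ler_normD _ _) _; rewrite mulrDl; apply: lerD; first exact: fcos_abs.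
rewrite normrM (@ger0_norm _ 2^-1)//; have := sdot_sqr_abs th x.
by have := normr_ge0 (sdot th x ^+ 2); lra.
Qed.

(* Bounded substitute for the product of two coordinates, equal to it up to
   higher order at [0]. *)
Definition ss (i j : 'I_m) x : R := sin (tnth x i) * sin (tnth x j).

Lemma sin_sqr_le (y : R) : sin y ^+ 2 <= Num.min 1 (y ^+ 2).
Proof.
rewrite le_min; apply/andP; split.
  by rewrite -[leLHS]real_normK ?num_real// expr_le1// sin_max.
rewrite -[leLHS]real_normK ?num_real// -[leRHS]real_normK ?num_real//.
by rewrite ler_sqr ?nnegrE// abs_sin_le.
Qed.

Lemma sin_mul_le (a b : R) : `|sin a * sin b| <= Num.min 1 (a ^+ 2) + Num.min 1 (b ^+ 2).
Proof.
have h1 := sin_sqr_le a; have h2 := sin_sqr_le b.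
apply: (@le_trans _ _ (sin a ^+ 2 + sin b ^+ 2)); last exact: lerD.
rewrite normrM -[sin a ^+ 2]real_normK ?num_real// -[sin b ^+ 2]real_normK ?num_real//.
have := normr_ge0 (sin a); have := normr_ge0 (sin b); nra.
Qed.

Lemma ss_abs i j x : `|ss i j x| <= 2 * rho x.
Proof.
apply: le_trans (sin_mul_le _ _) _.
have h k : Num.min 1 (tnth x k ^+ 2) <= rho x.
  by rewrite /rho le_min ge_min lexx/= ge_min coord_sqr_le orbT.
by have := h i; have := h j; lra.
Qed.

Lemma measurable_ss i j : measurable_fun setT (ss i j).
Proof. by apply: measurable_funM; exact: measurable_sinc. Qed.

Definition vsoft (e : R) x : V := [tuple soft e (tnth x i) | i < m].

Lemma vsoftE e x i : tnth (vsoft e x) i = soft e (tnth x i).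
Proof. by rewrite tnth_mktuple. Qed.

Lemma measurable_vsoft e : measurable_fun setT (vsoft e).
Proof.
apply/measurable_fun_tnthP => i; rewrite (_ : _ \o _ = fun x => soft e (tnth x i)).
  apply: (measurableT_comp _ (measurable_coord i)).
  by apply: continuous_measurable_fun; exact: continuous_soft.
by apply: funext => x /=; rewrite vsoftE.
Qed.

Lemma fconv_vsoft U (FU : ProperFilter U) e (f : V -> R) : fconv U f -> fconv U (fun x => f (vsoft e x)).
Proof.
move=> cf x_ x hx; apply: cf => i; rewrite vsoftE.
rewrite (_ : (fun k => _) = fun k => soft e (tnth (x_ k) i)).
  have hh := continuous_cvg _ (@continuous_soft R e (tnth x i)) (hx i); exact: hh.
by apply: funext => k; rewrite vsoftE.
Qed.

Lemma sqnorm_vsoft e x : 0 <= e -> sqnorm (vsoft e x) <= sqnorm x.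
Proof.
move=> e0; rewrite !sqnormE; apply: ler_sum => i _; rewrite vsoftE.
rewrite -[leLHS]real_normK ?num_real// -[leRHS]real_normK ?num_real//.
by rewrite ler_sqr ?nnegrE// soft_le.
Qed.

Lemma rho_vsoft e x : 0 <= e -> rho (vsoft e x) <= rho x.
Proof.
move=> e0; rewrite /rho le_min ge_min lexx/= ge_min sqnorm_vsoft// orbT//.
Qed.

Lemma vsoft_eq0 e x : 0 <= e -> sqnorm x <= e ^+ 2 -> forall i, tnth (vsoft e x) i = 0.
Proof.
move=> e0 h i; rewrite vsoftE soft_eq0//; apply: le_trans (coord_le_rad x i) _.
by rewrite -ler_sqr ?nnegrE ?rad_ge0// rad_sqr.
Qed.

(** After thresholding the integrand vanishes near the origin, so flatness needs only [f 0 = 0]. In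
    particular [fcos] passes to the limit without a quadratic correction. *)
Lemma flat_vsoft e (f : V -> R) : 0 < e -> (forall x, (forall i, tnth x i = 0) -> f x = 0) ->
  flat (fun x => f (vsoft e x)).
Proof.
move=> e0 f0 r r0; exists (e ^+ 2); split; first by rewrite exprn_gt0.
move=> x hx; rewrite f0 ?normr0 ?mulr_ge0 ?sqnorm_ge0 ?(ltW r0)//.
by apply: vsoft_eq0 => //; exact: ltW.
Qed.

Lemma dot_zero th x : (forall i, tnth x i = 0) -> dot th x = 0.
Proof. by move=> h; rewrite /dot big1// => i _; rewrite h mulr0. Qed.

End test_functions.

Section zip_lists.
Variables (R : realType) (m : nat).
Local Notation V := (m.-tuple R).
Implicit Types (th t : V).

Definition zl th t : seq (R * R) := [seq (tnth th i, tnth t i) | i <- enum 'I_m].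

Lemma lin_zl T (X : @process R T) th t w :
  lin (zl th t) X w = \sum_(i < m) tnth th i * X (tnth t i) w.
Proof. by rewrite /lin big_map big_enum. Qed.

Lemma lin_scl_zl T (X : @process R T) u c th t w :
  lin (scl u c (zl th t)) X w = \sum_(i < m) c * tnth th i * X (u * tnth t i) w.
Proof. by rewrite lin_scl big_map big_enum. Qed.

Lemma sum_zl th t (F : R * R -> R) :
  \sum_(p <- zl th t) F p = \sum_(i < m) F (tnth th i, tnth t i).
Proof. by rewrite big_map big_enum. Qed.

Definition tscl (c : R) th : V := [tuple c * tnth th i | i < m].

Lemma scl1_zl c th t : scl 1 c (zl th t) = zl (tscl c th) t.
Proof.
rewrite /scl /zl -map_comp; apply: eq_map => i /=.
by rewrite tnth_mktuple mul1r.
Qed.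

Lemma quad_tscl (S : 'M[R]_m) c th : quad S (tscl c th) = c ^+ 2 * quad S th.
Proof.
rewrite /quad mulr_sumr; apply: eq_bigr => i _.
rewrite mulr_sumr; apply: eq_bigr => j _.
by rewrite !tnth_mktuple; ring.
Qed.

End zip_lists.

Lemma zl_list (R : realType) (l : seq (R * R)) :
  exists th t : (size l).-tuple R, zl th t = l.
Proof.
exists (map_tuple fst (in_tuple l)), (map_tuple snd (in_tuple l)).
rewrite /zl (eq_map (_ : _ =1 tnth (in_tuple l))); first exact: map_tnth_enum.
by move=> i; rewrite !tnth_map -surjective_pairing.
Qed.

Section representation.
Variables (R : realType) (d : measure_display) (T : measurableType d).
Variables (P : probability T R) (X : @process R T).
Hypothesis mX : forall t, measurable_fun setT (X t).
Hypothesis scX : forall t eps delta : R, 0 < eps -> 0 < delta -> exists eta : R,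
  0 < eta /\ forall s, `|s - t| < eta ->
    fine (P [set w | eps < `|X s w - X t w|]) < delta.
Hypothesis tsX : forall n l, (0 < n)%N -> phi P X (scl n%:R 1 l) = phi P X l ^+ n.
Variables (U : set_system nat) (UU : UltraFilter U) (Uoo : \oo `<=` U).
Local Notation p2 k := ((2 ^+ k)^-1 : R).

Let p20 j : 0 < 2 ^+ j :> R. Proof. by rewrite exprn_gt0. Qed.

Definition drift (s : R) : R := lim (2 ^+ k * Ex P (fun w => sin (X (p2 k * s) w)) @[k --> U]).

Lemma drift_cvg s : 2 ^+ k * Ex P (fun w => sin (X (p2 k * s) w)) @[k --> U] --> drift s.
Proof.
have [B hB] := dyadic_drift mX scX tsX s.
exact: (@ultra_cvg R U UU _ B).
Qed.

(** Limiting covariance of truncated increments. It contains both the Gaussian covariance and the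
    contribution of the jumps. *)
Definition sig (s1 s2 : R) : R :=
  lim (2 ^+ k * Ex P (fun w => sin (X (p2 k * s1) w) * sin (X (p2 k * s2) w)) @[k --> U]).

Lemma sig_cvg s1 s2 :
  2 ^+ k * Ex P (fun w => sin (X (p2 k * s1) w) * sin (X (p2 k * s2) w)) @[k --> U] --> sig s1 s2.
Proof.
have [B1 h1] := dyadic_mass mX scX tsX s1; have [B2 h2] := dyadic_mass mX scX tsX s2.
apply: (@ultra_cvg R U UU _ (B1 + B2)) => k.
rewrite normrM (ger0_norm (ltW (p20 k))); apply: le_trans (lerD (h1 k) (h2 k)).
rewrite -mulrDr ler_wpM2l ?(ltW (p20 _))// -ExD; [|exact: bmf_min1_sqr..].
apply: Ex_abs.
- by apply: bmfM; apply: bmf_sin.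
- by apply: bmfD; exact: bmf_min1_sqr.
by move=> w; exact: sin_mul_le.
Qed.

Lemma sigC s1 s2 : sig s1 s2 = sig s2 s1.
Proof.
apply: (congr1 (fun u : nat -> R => lim (u @ U))); apply: funext => k.
by congr (_ * _); apply: eq_Ex => w; exact: mulrC.
Qed.

Section tuple_rep.
Variables (m : nat) (t : m.-tuple R).
Local Notation V := (m.-tuple R).

Lemma bmf_dv (f : V -> R) k K : measurable_fun setT f -> (forall x, `|f x| <= K * rho x) ->
  bmf (fun w => f (Dv X t k w)).
Proof.
move=> mf fK; split; first exact: (measurableT_comp mf (measurable_Dv mX t k)).
exists `|K| => w; apply: le_trans (fK _) _.
apply: le_trans (_ : `|K| * rho (Dv X t k w) <= _).
  by rewrite ler_wpM2r ?rho_ge0// ler_norm.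
by rewrite ler_piMr// rho_le1.
Qed.

Lemma lin_dv th k w : lin (scl (p2 k) 1 (zl th t)) X w = dot th (Dv X t k w).
Proof.
by rewrite lin_scl_zl; apply: eq_bigr => i _; rewrite mul1r DvE.
Qed.

Lemma sdot_sqrE th (x : V) : sdot th x ^+ 2 =
  \sum_(i < m) \sum_(j < m) tnth th i * tnth th j * ss i j x.
Proof.
rewrite expr2 /sdot mulr_suml; apply: eq_bigr => i _.
rewrite mulr_sumr; apply: eq_bigr => j _; rewrite /ss; ring.
Qed.

(** [fcos] is [fcos2] minus half of [sdot ^ 2]. The first is flat and converges to its integral
    against [nu]; the second converges to the quadratic form of [sig]. Regrouping leaves
    [nu (fcos th)] and the form of [sig] minus the jump share [nu (ss i j)]. *)
Lemma levy_rep : exists (dS : measure_display) (S : measurableType dS)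
  (M : {finite_measure set S -> \bar R}) (Y : S -> V),
  let nu f := Ex M (fun w => rdiv f (Y w)) in
  let Q := \matrix_(i < m, j < m) (sig (tnth t i) (tnth t j) - nu (ss i j)) in
  [/\ measurable_fun setT Y,
   (forall f K, measurable_fun setT f -> fconv U f -> (forall x, `|f x| <= K * rho x) ->
     flat f -> 2 ^+ k * Ex P (fun w => f (Dv X t k w)) @[k --> U] --> nu f),
   (forall th, 0 <= quad Q th),
   (forall th, Hlog P X (zl th t) = - (quad Q th / 2) + nu (fcos th)) &
   (forall th, phi P X (zl th t) =
      cE (Hlog P X (zl th t) +i* (\sum_(i < m) tnth th i * drift (tnth t i) + nu (fsin th))))].
Proof.
have [dS [S [M [Y [mY lim1 lim2]]]]] := dyadic_limit mX scX tsX UU Uoo t.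
exists dS, S, M, Y; move=> nu Q.
have bnu (f : V -> R) K : measurable_fun setT f -> (forall x, `|f x| <= K * rho x) ->
    bmf (fun w => rdiv f (Y w)).
  move=> mf fK; split; last by exists `|K| => w; exact: rdiv_bound.
  exact: (measurableT_comp (measurable_rdiv mf) mY).
have bss i j : bmf (fun w => rdiv (@ss R m i j) (Y w)).
  by apply: bnu; [exact: measurable_ss|exact: ss_abs].
have nu_sqr th : nu (fun x => sdot th x ^+ 2) =
    \sum_(i < m) \sum_(j < m) tnth th i * tnth th j * nu (ss i j).
  rewrite /nu; transitivity (Ex M (fun w => \sum_(i < m) \sum_(j < m) tnth th i * tnth th j * rdiv (ss i j) (Y w))).
    apply: eq_Ex => w; rewrite /rdiv sdot_sqrE mulr_suml; apply: eq_bigr => i _.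
    by rewrite mulr_suml; apply: eq_bigr => j _; rewrite mulrA.
  rewrite Ex_sum; last by move=> i; apply: bmf_sum => j; exact: bmfZ.
  apply: eq_bigr => i _; rewrite Ex_sum; last by move=> j; exact: bmfZ.
  by apply: eq_bigr => j _; rewrite ExZ.
have Dsqr th : 2 ^+ k * Ex P (fun w => sdot th (Dv X t k w) ^+ 2) @[k --> U] -->
    \sum_(i < m) \sum_(j < m) tnth th i * tnth th j * sig (tnth t i) (tnth t j).
  rewrite (_ : (fun k => _) = fun k => \sum_(i < m) \sum_(j < m) tnth th i * tnth th j *
     (2 ^+ k * Ex P (fun w => sin (X (p2 k * tnth t i) w) * sin (X (p2 k * tnth t j) w)))).
    apply: cvg_sum => i; apply: cvg_sum => j; apply: cvgMl_tmp; exact: sig_cvg.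
  apply: funext => k.
  have bb i j : bmf (fun w => sin (X (p2 k * tnth t i) w) * sin (X (p2 k * tnth t j) w)).
    by apply: bmfM; apply: bmf_sin.
  rewrite (@eq_Ex _ _ _ _ _ (fun w => \sum_(i < m) \sum_(j < m) tnth th i * tnth th j *
     (sin (X (p2 k * tnth t i) w) * sin (X (p2 k * tnth t j) w)))); last first.
    move=> w; rewrite sdot_sqrE; apply: eq_bigr => i _; apply: eq_bigr => j _.
    by rewrite /ss !DvE.
  rewrite Ex_sum; last by move=> i; apply: bmf_sum => j; exact: bmfZ.
  rewrite mulr_sumr; apply: eq_bigr => i _; rewrite Ex_sum; last by move=> j; exact: bmfZ.
  rewrite mulr_sumr; apply: eq_bigr => j _; rewrite ExZ//; ring.
have quadE th : quad Q th = \sum_(i < m) \sum_(j < m) tnth th i * tnth th j * sig (tnth t i) (tnth t j) -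
    nu (fun x => sdot th x ^+ 2).
  rewrite nu_sqr -sumrB; apply: eq_bigr => i _; rewrite -sumrB; apply: eq_bigr => j _.
  by rewrite mxE; ring.
have sq_meas th : measurable_fun setT (fun x : V => sdot th x ^+ 2).
  by apply: measurable_funX; exact: measurable_sdot.
(* The one-sided limit for nonnegative integrands, applied to [sdot ^ 2]: the integral against [nu]
   cannot exceed the limit of the second moments. *)
have psd th : 0 <= quad Q th.
  rewrite quadE subr_ge0; apply: (lim2 (fun x => sdot th x ^+ 2) (wt th ^+ 2 + wt th ^+ 2)) => //.
  - by under [X in fconv _ X]eq_fun do [rewrite expr2]; apply: fconvM; exact: fconv_sdot.
  - by move=> x; exact: sdot_sqr_abs.
  - by move=> x; exact: sqr_ge0.
have Hlim th : 2 ^+ k * Ex P (fun w => fcos th (Dv X t k w)) @[k --> U] -->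
    - (quad Q th / 2) + nu (fcos th).
  have c1 : 2 ^+ k * Ex P (fun w => fcos2 th (Dv X t k w)) @[k --> U] --> nu (fcos2 th).
    apply: (lim1 _ (2 + wt th ^+ 2 + (wt th ^+ 2 + wt th ^+ 2))).
    - exact: measurable_fcos2.
    - apply: fconvD.
        apply: fconvB; last exact: fconv_cst.
        by apply: fconv_comp; [exact: continuous_cos|exact: fconv_dot].
      apply: fconvM; last exact: fconv_cst.
      by under [X in fconv _ X]eq_fun do [rewrite expr2]; apply: fconvM; exact: fconv_sdot.
    - exact: fcos2_abs.
    - exact: fcos2_flat.
  have e1 : nu (fcos2 th) = nu (fcos th) + nu (fun x => sdot th x ^+ 2) / 2.
    have b1 := bnu _ _ (measurable_fcos th) (fcos_abs th).
    have b2 := bnu _ _ (sq_meas th) (sdot_sqr_abs th).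
    rewrite /nu mulrC -ExZ// -ExD//; last exact: bmfZ.
    by apply: eq_Ex => w; rewrite /rdiv /fcos2; ring.
  have := cvgB c1 (cvgMr_tmp (b := 1/2) (Dsqr th)).
  rewrite (_ : _ - _ = - (quad Q th / 2) + nu (fcos th)); last by rewrite quadE e1; field.
  move=> c; apply: (cvg_trans _ (c _ _)); apply: near_eq_cvg; apply: nearW => k; rewrite !fctE.
  have b1 := bmf_dv k (measurable_fcos2 th) (fcos2_abs th).
  have b2 := bmf_dv k (sq_meas th) (sdot_sqr_abs th).
  rewrite -mulrA -mulrBr; congr (_ * _); rewrite mulrC -ExZ// -ExB//; last exact: bmfZ.
  by apply: eq_Ex => w; rewrite /fcos2; field.
have Ilim th : 2 ^+ k * Ex P (fun w => sin (dot th (Dv X t k w))) @[k --> U] -->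
    \sum_(i < m) tnth th i * drift (tnth t i) + nu (fsin th).
  have c1 : 2 ^+ k * Ex P (fun w => fsin th (Dv X t k w)) @[k --> U] --> nu (fsin th).
    apply: (lim1 _ (1 + wt th + (2 * wt th ^+ 2 + 2 * wt th))).
    - exact: measurable_fsin.
    - apply: fconvB; last exact: fconv_sdot.
      by apply: fconv_comp; [exact: continuous_sin|exact: fconv_dot].
    - exact: fsin_abs.
    - exact: fsin_flat.
  have c2 : \sum_(i < m) tnth th i * (2 ^+ k * Ex P (fun w => sin (X (p2 k * tnth t i) w))) @[k --> U] -->
      \sum_(i < m) tnth th i * drift (tnth t i).
    by apply: cvg_sum => i; apply: cvgMl_tmp; exact: drift_cvg.
  apply: (cvg_trans _ (cvgD c2 c1)); apply: near_eq_cvg; apply: nearW => k; rewrite !fctE.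
  have b1 := bmf_dv k (measurable_fsin th) (fsin_abs th).
  have b2 i : bmf (fun w => tnth th i * sin (X (p2 k * tnth t i) w)) by apply: bmfZ; exact: bmf_sin.
  rewrite (eq_bigr (fun i => 2 ^+ k * Ex P (fun w => tnth th i * sin (X (p2 k * tnth t i) w)))); last first.
    by move=> i _; rewrite mulrCA ExZ//; exact: bmf_sin.
  rewrite -mulr_sumr -mulrDr; congr (_ * _); rewrite -Ex_sum// -ExD//; last exact: bmf_sum.
  apply: eq_Ex => w; rewrite /fsin /sdot.
  rewrite [X in _ + (_ - X)](eq_bigr (fun i => tnth th i * sin (X (p2 k * tnth t i) w))).
    by ring.
  by move=> i _; rewrite DvE.
have phiE th : phi P X (zl th t) = cE ((- (quad Q th / 2) + nu (fcos th)) +i*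
      (\sum_(i < m) tnth th i * drift (tnth t i) + nu (fsin th))).
  have mdot k : measurable_fun setT (fun w => dot th (Dv X t k w)).
    exact: (measurableT_comp (measurable_dot th) (measurable_Dv mX t k)).
  (* Stability makes this power independent of [k], so its limit is [phi] itself. *)
  have zn k : cf P (fun w => dot th (Dv X t k w)) ^+ (2 ^ k) = phi P X (zl th t).
    have -> : cf P (fun w => dot th (Dv X t k w)) = phi P X (scl (p2 k) 1 (zl th t)).
      by apply: eq_cf => v; rewrite lin_dv.
    by rewrite -tsX ?expn_gt0// scl_scl natrX mulfV ?gt_eqF// mulr1 scl11.
  have : ccvg U (fun k => cf P (fun w => dot th (Dv X t k w)) ^+ (2 ^ k)) (cE ((- (quad Q th / 2) + nu (fcos th)) +i*
      (\sum_(i < m) tnth th i * drift (tnth t i) + nu (fsin th)))).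
    exact: (cf_pow2_cvg _ Uoo mdot (Hlim th) (Ilim th)).
  under [X in ccvg _ X _]eq_fun do rewrite zn.
  rewrite /ccvg; set L := cE _; set a := phi _ _ _ => c.
  have c0 : cn (a - L) @[k --> U] --> (0 : R) by exact: c.
  have e : cn (a - L) = 0 by apply: (cvg_unique _ (cvg_cst (cn (a - L))) c0).
  by apply/eqP; rewrite -subr_eq0; apply/eqP/Normc.eq0_normc.
have HlogE th : Hlog P X (zl th t) = - (quad Q th / 2) + nu (fcos th).
  by apply: expR_inj; rewrite (expR_Hlog mX scX tsX) phiE cn_cE.
split => //; by move=> th; rewrite HlogE.
Qed.

End tuple_rep.
End representation.

(** * The Gaussian part *)

Section bilinear.
Variables (R : realType) (m : nat) (S : 'M[R]_m).
Local Notation V := (m.-tuple R).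

Definition bilin (x y : V) : R := \sum_(i < m) \sum_(j < m) tnth x i * S i j * tnth y j.

Lemma bilinDl x x' y : bilin (tadd x x') y = bilin x y + bilin x' y.
Proof.
rewrite /bilin -big_split; apply: eq_bigr => i _; rewrite -big_split; apply: eq_bigr => j _ /=.
by rewrite tnth_mktuple; ring.
Qed.

Lemma bilinDr x y y' : bilin x (tadd y y') = bilin x y + bilin x y'.
Proof.
rewrite /bilin -big_split; apply: eq_bigr => i _; rewrite -big_split; apply: eq_bigr => j _ /=.
by rewrite tnth_mktuple; ring.
Qed.

Lemma bilin_delta i j : bilin (tdelta i 1) (tdelta j 1) = S i j.
Proof.
rewrite /bilin (bigD1 i)//= [X in _ + X]big1 ?addr0; last first.
  move=> k ki; rewrite big1// => l _.
  by rewrite tnth_mktuple (negbTE ki) !mul0r.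
rewrite (bigD1 j)//= big1 ?addr0; last first.
  by move=> k kj; rewrite [tnth (tdelta j 1) k]tnth_mktuple (negbTE kj) mulr0.
by rewrite !tnth_mktuple !eqxx mul1r mulr1.
Qed.

Lemma quad_bilin x : quad S x = bilin x x. Proof. by []. Qed.

End bilinear.

Section gaussian_part.
Variables (R : realType) (d : measure_display) (T : measurableType d).
Variables (P : probability T R) (X : @process R T).
Hypothesis mX : forall t, measurable_fun setT (X t).
Hypothesis scX : forall t eps delta : R, 0 < eps -> 0 < delta -> exists eta : R,
  0 < eta /\ forall s, `|s - t| < eta ->
    fine (P [set w | eps < `|X s w - X t w|]) < delta.
Hypothesis tsX : forall n l, (0 < n)%N -> phi P X (scl n%:R 1 l) = phi P X l ^+ n.
Variables (U : set_system nat) (UU : UltraFilter U) (Uoo : \oo `<=` U).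
Local Notation p2 k := ((2 ^+ k)^-1 : R).

Lemma lin_scl1 c l w : lin (scl 1 c l) X w = c * lin l X w.
Proof.
rewrite lin_scl /lin mulr_sumr; apply: eq_bigr => p _; by rewrite mul1r mulrA.
Qed.

Lemma Hlog_congr l l' : (forall w, lin l X w = lin l' X w) -> Hlog P X l = Hlog P X l'.
Proof. by move=> e; rewrite /Hlog /phi (eq_cf P e). Qed.

Definition Qseq l (k : nat) : R := -2 * Hlog P X (scl 1 k.+1%:R l) / k.+1%:R ^+ 2.

(** Defined from [phi] alone: the representation depends on the tuple of times, and this form
    ensures that its quadratic parts agree from one tuple to another. *)
Definition Qf l : R := lim (Qseq l k @[k --> \oo]).

Lemma Qf_congr l l' : (forall w, lin l X w = lin l' X w) -> Qf l = Qf l'.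
Proof.
move=> e; apply: (congr1 (fun u : nat -> R => lim (u @ \oo))); apply: funext => k.
rewrite /Qseq.
by rewrite (@Hlog_congr _ (scl 1 k.+1%:R l'))// => w; rewrite !lin_scl1 e.
Qed.

Lemma sqrV_cvg0 : (k.+1%:R ^+ 2)^-1 @[k --> \oo] --> (0 : R).
Proof.
rewrite (_ : (fun k => _) = fun k => (k.+1%:R^-1 * k.+1%:R^-1 : R)).
  by rewrite -[X in _ --> X](mulr0 0); apply: cvgM; exact: invSn_cvg0.
by apply: funext => k; rewrite expr2 invfM.
Qed.

Lemma wt_tscl m c (th : m.-tuple R) : wt (tscl c th) = `|c| * wt th.
Proof.
by rewrite /wt mulr_sumr; apply: eq_bigr => i _; rewrite tnth_mktuple normrM.
Qed.

Lemma fcos_tscl_bound m (k : nat) (th x : m.-tuple R) :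
  `|(k.+1%:R ^+ 2)^-1 * rdiv (fcos (tscl k.+1%:R th)) x| <= 2 + wt th ^+ 2.
Proof.
have k1 : 1 <= k.+1%:R ^+ 2 :> R by rewrite exprn_ege1// ler1n.
have k0 : 0 < k.+1%:R ^+ 2 :> R by lra.
rewrite normrM (@ger0_norm _ _^-1) ?invr_ge0 ?(ltW k0)// ler_pdivrMl//.
apply: le_trans (rdiv_bound (fcos_abs _) x) _.
rewrite wt_tscl exprMn real_normK ?num_real//.
have w2 := sqr_ge0 (wt th).
rewrite (ger0_norm (addr_ge0 _ (mulr_ge0 (ltW k0) w2)))// mulrDr lerD2r.
by rewrite -[leLHS]mul1r ler_wpM2r.
Qed.

Lemma fcos_tscl_cvg m (th x : m.-tuple R) :
  (k.+1%:R ^+ 2)^-1 * rdiv (fcos (tscl k.+1%:R th)) x @[k --> \oo] --> (0 : R).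
Proof.
have h : (k.+1%:R ^+ 2)^-1 * (2 * (rho x)^-1) @[k --> \oo] --> (0 : R).
  by rewrite -[X in _ --> X](mul0r (2 * (rho x)^-1)); apply: cvgMr_tmp; exact: sqrV_cvg0.
apply/cvgrPdist_lt => e e0; move/cvgr0_norm_lt : h => /(_ e e0); apply: filterS => k.
apply: le_lt_trans; rewrite sub0r normrN /rdiv !normrM ler_wpM2l//.
rewrite ler_wpM2r// (@ger0_norm _ 2)// /fcos distrC ger0_norm ?one_sub_cos_ge0//.
by have := cos_geN1 (dot (tscl k.+1%:R th) x); lra.
Qed.

(** Scaling the weights by [n] multiplies the quadratic part by [n ^ 2], whereas [fcos] stays
    bounded by [2] at each point. After division by [n ^ 2] the jump integral vanishes, dominated
    through [fcos_tscl_bound]. *)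
Lemma Qseq_rep m (t : m.-tuple R) (dS : measure_display) (S : measurableType dS)
  (M : {finite_measure set S -> \bar R}) (Y : S -> m.-tuple R) (Q : 'M[R]_m) :
  measurable_fun setT Y ->
  (forall th, Hlog P X (zl th t) = - (quad Q th / 2) + Ex M (fun w => rdiv (fcos th) (Y w))) ->
  forall th, Qseq (zl th t) k @[k --> \oo] --> quad Q th.
Proof.
move=> mY HE th.
have bY k : bmf (fun w => rdiv (fcos (tscl k.+1%:R th)) (Y w)).
  split; first exact: (measurableT_comp (measurable_rdiv (measurable_fcos _)) mY).
  by exists `|2 + wt (tscl k.+1%:R th) ^+ 2| => w; apply: rdiv_bound => x; exact: fcos_abs.
have c0 : Ex M (fun w => (k.+1%:R ^+ 2)^-1 * rdiv (fcos (tscl k.+1%:R th)) (Y w)) @[k --> \oo] --> Ex M (fun=> 0).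
  apply: (@Ex_cvg _ _ _ _ (fun k w => (k.+1%:R ^+ 2)^-1 * rdiv (fcos (tscl k.+1%:R th)) (Y w)) _ (2 + wt th ^+ 2)).
  - by move=> k; apply: measurable_funM => //; exact: (bY k).1.
  - by move=> k w; exact: fcos_tscl_bound.
  - by move=> w; exact: fcos_tscl_cvg.
rewrite Ex_cst mul0r in c0.
have c1 : quad Q th + (-2) * Ex M (fun w => (k.+1%:R ^+ 2)^-1 * rdiv (fcos (tscl k.+1%:R th)) (Y w)) @[k --> \oo] -->
    quad Q th + (-2) * 0.
  by apply: cvgD; [exact: cvg_cst|exact: cvgMl_tmp].
rewrite mulr0 addr0 in c1; apply: (cvg_trans _ c1); apply: near_eq_cvg; apply: nearW => k.
have k0 : k.+1%:R != 0 :> R by rewrite pnatr_eq0.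
rewrite /Qseq scl1_zl HE ExZ// quad_tscl; move: (k.+1%:R : R) k0 => c k0.
by field.
Qed.

Lemma Qseq_cvg l : Qseq l k @[k --> \oo] --> Qf l.
Proof.
have [th [t <-]] := zl_list l.
have [dS [S [M [Y [mY _ _ HE _]]]]] := levy_rep mX scX tsX UU Uoo t.
by have c := Qseq_rep (th := th) mY HE; rewrite /Qf (cvg_lim _ c).
Qed.

Lemma Qf_rep m (t : m.-tuple R) (dS : measure_display) (S : measurableType dS)
  (M : {finite_measure set S -> \bar R}) (Y : S -> m.-tuple R) (Q : 'M[R]_m) :
  measurable_fun setT Y ->
  (forall th, Hlog P X (zl th t) = - (quad Q th / 2) + Ex M (fun w => rdiv (fcos th) (Y w))) ->
  forall th, Qf (zl th t) = quad Q th.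
Proof. by move=> mY HE th; apply: cvg_lim => //; have c := Qseq_rep (th := th) mY HE; exact: c. Qed.

Lemma Qf_hom u l : 0 <= u -> Qf (scl u 1 l) = u * Qf l.
Proof.
move=> u0; apply: cvg_lim => //.
have c := cvgMl_tmp (a := u) (@Qseq_cvg l); apply: (cvg_trans _ (c _)).
apply: near_eq_cvg; apply: nearW => k; rewrite /Qseq.
have -> : scl 1 k.+1%:R (scl u 1 l) = scl u 1 (scl 1 k.+1%:R l).
  by rewrite !scl_scl !mul1r !mulr1.
have k0 : k.+1%:R != 0 :> R by rewrite pnatr_eq0.
rewrite (Hlog_real mX scX tsX)//; move: (k.+1%:R : R) k0 => b k0.
by field.
Qed.

Definition Ccov (s t : R) : R := (Qf [:: (1, s); (1, t)] - Qf [:: (1, s)] - Qf [:: (1, t)]) / 2.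

Lemma Ccov_hom u s t : 0 <= u -> Ccov (u * s) (u * t) = u * Ccov s t.
Proof.
move=> u0; rewrite /Ccov.
have h1 a : [:: (1, u * a)] = scl u 1 [:: (1, a)] :> seq (R * R) by rewrite /scl /= mulr1.
have h2 : [:: (1, u * s); (1, u * t)] = scl u 1 [:: (1, s); (1, t)] :> seq (R * R) by rewrite /scl /= mulr1.
rewrite h2 (h1 s) (h1 t) !Qf_hom//.
by move: (Qf [:: (1, s); (1, t)]) (Qf [:: (1, s)]) (Qf [:: (1, t)]) => a b c; ring.
Qed.

(** Polarisation in the directions [tdelta i] and [tdelta j]. The short lists in [Ccov] and the full
    list of [t] with these weights define the same linear form, so [Qf_congr] identifies their
    values. *)
Lemma Ccov_rep m (t : m.-tuple R) (Q : 'M[R]_m) : Q^T = Q ->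
  (forall th, Qf (zl th t) = quad Q th) ->
  forall i j, Q i j = Ccov (tnth t i) (tnth t j).
Proof.
move=> Qs HQ i j.
have lz th w : lin (zl th t) X w = dot th [tuple X (tnth t k) w | k < m].
  by rewrite lin_zl; apply: eq_bigr => k _; rewrite tnth_mktuple.
have e1 k : Qf [:: (1, tnth t k)] = Q k k.
  rewrite -bilin_delta -quad_bilin -HQ; apply: Qf_congr => w.
  by rewrite lin1 lz dot_delta tnth_mktuple.
have e2 : Qf [:: (1, tnth t i); (1, tnth t j)] = Q i i + Q i j + (Q j i + Q j j).
  rewrite -!bilin_delta -!bilinDr -bilinDl -quad_bilin -HQ; apply: Qf_congr => w.
  by rewrite lin_cons lin1 lz dotDl !dot_delta !tnth_mktuple.
have e3 : Q j i = Q i j by rewrite -[in LHS]Qs mxE.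
by rewrite /Ccov e2 !e1 e3; field.
Qed.

Lemma levy_Q_sym m (t : m.-tuple R) (f : 'I_m -> 'I_m -> R) : (forall i j, f i j = f j i) ->
  (\matrix_(i < m, j < m) (sig P X U (tnth t i) (tnth t j) - f i j))^T =
  \matrix_(i < m, j < m) (sig P X U (tnth t i) (tnth t j) - f i j).
Proof.
by move=> fs; apply/matrixP => i j; rewrite !mxE sigC fs.
Qed.

Lemma Ccov_quad m (t th : m.-tuple R) :
  \sum_(i < m) \sum_(j < m) tnth th i * tnth th j * Ccov (tnth t i) (tnth t j) = Qf (zl th t).
Proof.
have [dS [S [M [Y [mY _ _ HE _]]]]] := levy_rep mX scX tsX UU Uoo t.
set Q := \matrix_(i, j) _ in HE.
have Qs : Q^T = Q.
  by apply: levy_Q_sym => i j; apply: eq_Ex => w; congr rdiv; apply: funext => x; exact: mulrC.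
have QfE := Qf_rep mY HE.
rewrite QfE; apply: eq_bigr => i _; apply: eq_bigr => j _.
by rewrite -(Ccov_rep Qs QfE); ring.
Qed.

Lemma Qf_ge0 l : 0 <= Qf l.
Proof.
apply: limr_ge; first by apply/cvg_ex; eexists; exact: Qseq_cvg.
apply: nearW => k; rewrite /Qseq divr_ge0 ?sqr_ge0//.
by have := Hlog_le0 mX scX tsX (scl 1 k.+1%:R l); lra.
Qed.

Lemma phi_conj u c l : phi P X (scl u (- c) l) =
  complex.Re (phi P X (scl u c l)) -i* complex.Im (phi P X (scl u c l)).
Proof.
have e w : lin (scl u (- c) l) X w = - lin (scl u c l) X w.
  rewrite !lin_scl -sumrN; apply: eq_bigr => p _; by rewrite !mulNr.
rewrite /phi /cf /=; congr (_ +i* _); first by apply: eq_Ex => w; rewrite e cosN.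
rewrite -[RHS]mulN1r -ExZ; last by apply: bmf_sin; exact: measurable_lin.
by apply: eq_Ex => w; rewrite e sinN mulN1r.
Qed.

Lemma mul_conj (z : R[i]) : z * (complex.Re z -i* complex.Im z) = (cn z ^+ 2)%:C.
Proof.
rewrite cn_sqr; case: z => a b /=; apply/eqP; rewrite eq_complex /=.
by apply/andP; split; apply/eqP; ring.
Qed.

Lemma realizable_phi u c : realizable (fun l => phi P X (scl u c l)).
Proof.
have m t : measurable_fun setT (fun w => c * X (u * t) w) by exact: measurable_funM.
exists (@Realization R d T P (fun t w => c * X (u * t) w) m) => l.
apply: eq_cf => w; rewrite lin_scl /lin; apply: eq_bigr => p _ /=.
by rewrite mulrA (mulrC p.1).
Qed.

(** The product is [|phi|^2] at weights multiplied by [n = k + 1] and times by [1 / (2 n^2)], the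
    characteristic function of a symmetrised increment. The factor [2] in the time compensates the
    square, leaving [exp (Hlog (n l) / n^2)]. *)
Lemma gauss_approx k l : phi P X (scl (2 * k.+1%:R ^+ 2)^-1 k.+1%:R l) *
    phi P X (scl (2 * k.+1%:R ^+ 2)^-1 (- k.+1%:R) l) = (expR (- (Qseq l k / 2)))%:C.
Proof.
rewrite phi_conj mul_conj; congr (_%:C).
rewrite -(expR_Hlog mX scX tsX) -expRM_natl; congr expR.
have -> : scl (2 * k.+1%:R ^+ 2)^-1 k.+1%:R l = scl (2 * k.+1%:R ^+ 2)^-1 1 (scl 1 k.+1%:R l).
  by rewrite scl_scl mulr1 mul1r.
rewrite (Hlog_real mX scX tsX); last by rewrite invr_ge0 mulr_ge0// sqr_ge0.
have k0 : k.+1%:R != 0 :> R by rewrite pnatr_eq0.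
rewrite /Qseq; move: (k.+1%:R : R) k0 => b k0.
by field.
Qed.

(** Serves tightness in [realizable_gauss]. With [q] the Gaussian variance and [B] the mass of [M],
    the jump integral costs at most [(2 + n^2 th^2) B]; its constant term survives as a multiple of
    [1 / n^2]. *)
Lemma Qseq_single_bound t : exists K : R, 0 <= K /\ forall th k,
  Qseq [:: (th, t)] k <= K * (th ^+ 2 + (k.+1%:R ^+ 2)^-1).
Proof.
have [dS [S [M [Y [mY _ psd HE _]]]]] := levy_rep mX scX tsX UU Uoo [tuple t].
set Q := \matrix_(i, j) _ in psd HE.
pose B := fine (M setT); have B0 : 0 <= B by rewrite fine_ge0.
have q0 : 0 <= Q ord0 ord0.
  by have := psd [tuple 1]; rewrite /quad !big_ord1 /= tnth0 !mul1r mulr1.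
exists (Q ord0 ord0 + 4 * B); split; first lra.
move=> th k; have k0 : 0 < k.+1%:R ^+ 2 :> R by rewrite exprn_gt0.
rewrite /Qseq (@Hlog_congr _ (zl [tuple k.+1%:R * th] [tuple t])); last first.
  by move=> w; rewrite lin_scl1 lin1 lin_zl big_ord1 !tnth0 mulrA.
rewrite HE ler_pdivrMr//.
have qE : quad Q [tuple k.+1%:R * th] = k.+1%:R ^+ 2 * (Q ord0 ord0 * th ^+ 2).
  by rewrite /quad !big_ord1 !tnth0; ring.
have wE : wt [tuple k.+1%:R * th] ^+ 2 = k.+1%:R ^+ 2 * th ^+ 2.
  by rewrite /wt big_ord1 tnth0 real_normK ?num_real// exprMn.
have nuB : `|Ex M (fun w => rdiv (fcos [tuple k.+1%:R * th]) (Y w))| <= (2 + k.+1%:R ^+ 2 * th ^+ 2) * B.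
  rewrite -Ex_cst; apply: Ex_abs.
  - split; first exact: (measurableT_comp (measurable_rdiv (measurable_fcos _)) mY).
    by eexists => w; apply: rdiv_bound => x; exact: fcos_abs.
  - exact: bmf_cst.
  move=> w; apply: le_trans (rdiv_bound (fcos_abs _) _) _; rewrite wE.
  by rewrite ger0_norm// addr_ge0// mulr_ge0 ?sqr_ge0.
rewrite qE; move: nuB; rewrite ler_norml => /andP[h1 _].
move: h1; set e := Ex M _; move: (k.+1%:R ^+ 2 : R) k0 => a a0 h1; move: (Q _ _) q0 => q q0.
have -> : (q + 4 * B) * (th ^+ 2 + a^-1) * a = q * (a * th ^+ 2) + q + 4 * (B * (a * th ^+ 2)) + 4 * B.
  by field; rewrite gt_eqF.
have p1 : 0 <= q * (a * th ^+ 2) := mulr_ge0 q0 (mulr_ge0 (ltW a0) (sqr_ge0 th)).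
have p2 : 0 <= B * (a * th ^+ 2) := mulr_ge0 B0 (mulr_ge0 (ltW a0) (sqr_ge0 th)).
have -> : a * (q * th ^+ 2) = q * (a * th ^+ 2) by ring.
have : (2 + a * th ^+ 2) * B = 2 * B + B * (a * th ^+ 2) by ring.
by move: h1; set y := (2 + _) * B; lra.
Qed.

Theorem realizable_gauss : realizable (fun l => (expR (- (Qf l / 2)))%:C).
Proof.
apply: (@realizable_lim R U UU Uoo (fun k l => (expR (- (Qseq l k / 2)))%:C)).
- move=> k; have [r rP] := realizable_mul (realizable_phi (2 * k.+1%:R ^+ 2)^-1 k.+1%:R)
    (realizable_phi (2 * k.+1%:R ^+ 2)^-1 (- k.+1%:R)).
  by exists r => l; rewrite rP gauss_approx.
- move=> l; apply/ccvg_ReIm; split => /=; last exact: cvg_cst.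
  have c : - (Qseq l k / 2) @[k --> \oo] --> - (Qf l / 2).
    by apply: cvgN; apply: cvgMr_tmp; exact: Qseq_cvg.
  have hh := continuous_cvg _ (@continuous_expR R (- (Qf l / 2))) c.
  by move=> A /hh; exact: Uoo.
move=> t eta eta0; have [K [K0 hK]] := Qseq_single_bound t.
have K1 : 0 < K + 1 by lra.
exists (Num.min 1 (eta / (K + 1))); split; first by rewrite lt_min ltr01 divr_gt0.
apply: Uoo; have /cvgr0_norm_le /(_ (eta / (K + 1)) (divr_gt0 eta0 K1)) := sqrV_cvg0.
apply: filterS => k; rewrite ger0_norm ?invr_ge0 ?sqr_ge0// => hk th.
rewrite le_min => /andP[th1 th2] /=.
(* Tightness reduces to [1 - exp (- q / 2) <= q / 2], and [q] is at most [K] times twice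
   [eta / (K + 1)]. *)
have := expR_ge1Dx (- (Qseq [:: (th, t)] k / 2)).
have := hK th k; have tt : th ^+ 2 <= eta / (K + 1).
  rewrite -[leLHS]real_normK ?num_real// expr2; apply: le_trans th2.
  by rewrite ler_piMl.
have := ler_wpM2l K0 (lerD tt hk); have v0 : 0 <= eta / (K + 1) by rewrite divr_ge0// ltW.
have e1 : K * (eta / (K + 1) + eta / (K + 1)) <= 2 * eta.
  have : K * (eta / (K + 1)) <= eta by rewrite mulrCA ger_pMr// ler_pdivrMr// mul1r lerDl.
  by rewrite mulrDr; move: (K * _) => y; lra.
move=> h1 h2; have := le_trans h2 (le_trans h1 e1).
by move: (Qseq _ k) => q h3 h4; apply: le_trans (_ : q / 2 <= _); lra.
Qed.

End gaussian_part.

(** * The jump part *)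

Section complex_limits.
Variables (R : realType) (F : set_system nat) (FF : ProperFilter F).

Lemma ccvgM (z w : nat -> R[i]) a b : ccvg F z a -> ccvg F w b ->
  ccvg F (fun k => z k * w k) (a * b).
Proof.
move=> /ccvg_ReIm[z1 z2] /ccvg_ReIm[w1 w2]; apply/ccvg_ReIm.
have M (x : R[i]) (y : R[i]) : (complex.Re (x * y) = complex.Re x * complex.Re y - complex.Im x * complex.Im y) *
  (complex.Im (x * y) = complex.Re x * complex.Im y + complex.Im x * complex.Re y).
  by case: x => ? ?; case: y => ? ?.
split; rewrite M; under eq_fun do rewrite M.
  by apply: cvgB; apply: cvgM.
by apply: cvgD; apply: cvgM.
Qed.

Lemma ccvg_cE (x y : nat -> R) a b : x k @[k --> F] --> a -> y k @[k --> F] --> b ->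
  ccvg F (fun k => cE (x k +i* y k)) (cE (a +i* b)).
Proof.
move=> xa yb; apply: ccvgM; apply/ccvg_ReIm; split => /=.
- have hh := continuous_cvg _ (@continuous_expR R a) xa; exact: hh.
- exact: cvg_cst.
- have hh := continuous_cvg _ (@continuous_cos R b) yb; exact: hh.
- have hh := continuous_cvg _ (@continuous_sin R b) yb; exact: hh.
Qed.

Lemma ccvg_unique (z : nat -> R[i]) a b : ccvg F z a -> ccvg F z b -> a = b.
Proof.
move=> /ccvg_ReIm[z1 z2] /ccvg_ReIm[w1 w2]; apply/eqP; rewrite eq_complex.
by rewrite (cvg_unique _ z1 w1) ?eqxx ?(cvg_unique _ z2 w2) ?eqxx//; exact: Rhausdorff.
Qed.

Lemma cn_cexp_sub1 (a : R) : cn (cexp a - 1) <= `|a|.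
Proof.
rewrite -ler_sqr ?nnegrE ?cn_ge0// cn_sqr -cexp0 /cexp /=.
by apply: chord_le; rewrite subr0.
Qed.

End complex_limits.

Section jump_part.
Variables (R : realType) (d : measure_display) (T : measurableType d).
Variables (P : probability T R) (X : @process R T).
Hypothesis mX : forall t, measurable_fun setT (X t).
Hypothesis scX : forall t eps delta : R, 0 < eps -> 0 < delta -> exists eta : R,
  0 < eta /\ forall s, `|s - t| < eta ->
    fine (P [set w | eps < `|X s w - X t w|]) < delta.
Hypothesis tsX : forall n l, (0 < n)%N -> phi P X (scl n%:R 1 l) = phi P X l ^+ n.
Variables (U : set_system nat) (UU : UltraFilter U) (Uoo : \oo `<=` U).
Local Notation p2 k := ((2 ^+ k)^-1 : R).

Let p20 j : 0 < 2 ^+ j :> R. Proof. by rewrite exprn_gt0. Qed.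

Section fixed_threshold.
Variables (e : R) (e0 : 0 < e).

Let sproc k (t : R) w := soft e (X (p2 k * t) w).

Let msproc k t : measurable_fun setT (sproc k t).
Proof.
apply: (measurableT_comp _ (mX _)).
by apply: continuous_measurable_fun; exact: continuous_soft.
Qed.

Let comp k (t : R) := 2 ^+ k * (Ex P (fun w => sin (X (p2 k * t) w)) - Ex P (fun w => sin (sproc k t w))).

(* Sum of [2^k] independent copies of the soft-thresholded increment over
   [t / 2^k], re-centred so that the truncated drift is that of [X]. *)
Definition jump_approx k l : R[i] :=
  cf P (lin l (sproc k)) ^+ (2 ^ k) * cexp (\sum_(p <- l) p.1 * comp k p.2).

Lemma realizable_jump_approx k : realizable (jump_approx k).
Proof.
apply: realizable_mul; last exact: realizable_shift.
by apply: realizable_exp; exists (@Realization _ _ _ P _ (msproc k)).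
Qed.

Let q : R := Num.min 1 (e ^+ 2).
Let q0 : 0 < q. Proof. by rewrite lt_min ltr01 exprn_gt0. Qed.

(** Chebyshev-type dichotomy: a thresholded increment that does not vanish is paid for by the mass
    [min (1, x^2)], up to the factor [1 / q]. *)
Let soft_ind (x : R) : soft e x = 0 \/ q <= Num.min 1 (x ^+ 2).
Proof.
have [h|h] := leP `|x| e; first by left; apply: soft_eq0.
right; rewrite le_min /q !ge_min lexx/=.
by rewrite -[x ^+ 2]real_normK ?num_real// ler_sqr ?nnegrE ?(ltW e0)// (ltW h) orbT.
Qed.

Let mset_tail k t (A : R) : measurable [set w | A <= `|X (p2 k * t) w|].
Proof.
apply: (@measurable_ge_set _ _ _ (fun w => `|X (p2 k * t) w|)).
exact: measurableT_comp.
Qed.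

(** A power [z ^ (2 ^ k)] is within [2 ^ k |z - 1|] of [1]. Increments larger than [A] cost at most
    [eta / 4] by [dyadic_tail]; the smaller nonzero ones cost a multiple of [|th|] by [dyadic_mass],
    and so does the compensator. *)
Lemma jump_approx_tight t eta : 0 < eta -> exists delta : R, 0 < delta /\
  U [set k | forall th : R, `|th| <= delta ->
    1 - complex.Re (jump_approx k [:: (th, t)]) <= eta].
Proof.
move=> eta0; have eta8 : 0 < eta / 8 by lra.
have [A [k0 [A0 hA]]] := dyadic_tail mX scX tsX t eta8.
have [B0 hB0] := dyadic_mass mX scX tsX t; have [B' hB'] := dyadic_drift mX scX tsX t.
pose B := `|B0|; have hB k := le_trans (hB0 k) (ler_norm B0); rewrite -/B in hB.
have B'0 : 0 <= B' := le_trans (normr_ge0 _) (hB' 0%N).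
(* The first term is the slope in [|th|] due to increments below [A]; the parenthesis bounds the
   compensator [comp]. *)
pose K := A / q * B + (B' + q^-1 * B).
have qV : 0 <= q^-1 by rewrite invr_ge0 ltW.
have Aq : 0 <= A / q by rewrite mulr_ge0// ltW.
have K0 : 0 <= K by rewrite !addr_ge0// mulr_ge0// normr_ge0.
have K1 : 0 < K + 1 by lra.
exists ((eta / 2) / (K + 1)); split; first by rewrite !divr_gt0.
apply: Uoo; exists k0 => // k /= kk0 th hth.
pose m w := Num.min 1 (X (p2 k * t) w ^+ 2); have bm : bmf m by exact: bmf_min1_sqr.
pose S := [set w | A <= `|X (p2 k * t) w|].
have b1 : bmf (\1_S : T -> R) by apply: bmf_indic; exact: mset_tail.
pose g w := 2 * \1_S w + (`|th| * (A / q)) * m w.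
have bg : bmf g by apply: bmfD; exact: bmfZ.
have m0 w : 0 <= m w by rewrite /m le_min ler01 sqr_ge0.
have ag : 0 <= `|th| * (A / q) by rewrite mulr_ge0.
have g0 w : 0 <= g w by rewrite /g indicE addr_ge0// mulr_ge0.
have hcf : cn (cf P (fun w => th * sproc k t w) - 1) <= Ex P g.
  rewrite -(cf0 P); apply: cf_sub_le => //; first exact: measurable_funM.
  move=> w; have [s0|sq] := soft_ind (X (p2 k * t) w).
    by rewrite /sproc s0 mulr0 !subrr expr0n addr0 sqr_ge0.
  have [h|h] := leP A `|X (p2 k * t) w|.
    apply: le_trans (chord_le2 _ _) _; rewrite ler_sqr ?nnegrE//.
    rewrite /g indicE mem_set//= mulr1 lerDl mulr_ge0//.
  apply: le_trans (chord_le (lexx _)) _; rewrite ler_sqr ?nnegrE// subr0 normrM.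
  apply: le_trans (_ : `|th| * (A / q) * m w <= _); last by rewrite lerDr mulr_ge0// indicE.
  rewrite -mulrA; apply: ler_wpM2l => //.
  apply: le_trans (soft_le _ (ltW e0)) _; apply: le_trans (ltW h) _.
  by rewrite -mulrA ler_peMr ?(ltW A0)// ler_pdivlMl// mulr1.
have hg : 2 ^+ k * Ex P g <= eta / 4 + `|th| * (A / q * B).
  rewrite ExD; [|exact: bmfZ..]; rewrite !ExZ// Ex_indic; last exact: mset_tail.
  have h1 := hA k kk0; have := ler_wpM2l ag (hB k); rewrite -/m.
  move: h1; rewrite -/S; move: (fine _) (Ex P m) (2 ^+ k : R) => x y z h1 h2.
  have -> : z * (2 * x + `|th| * (A / q) * y) = 2 * (z * x) + `|th| * (A / q) * (z * y) by ring.
  apply: lerD; first lra.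
  by rewrite [`|th| * (A / q * B)]mulrA.
have hc : `|comp k t| <= B' + q^-1 * B.
  rewrite /comp mulrBr; apply: le_trans (ler_normB _ _) _; apply: lerD; first exact: hB'.
  rewrite normrM ger0_norm ?(ltW (p20 _))//; apply: le_trans (ler_wpM2l qV (hB k)).
  rewrite mulrCA ler_wpM2l ?(ltW (p20 _))// -ExZ//; apply: Ex_abs.
  - by apply: bmf_sin; exact: msproc.
  - exact: bmfZ.
  move=> w; have [s0|sq] := soft_ind (X (p2 k * t) w).
    by rewrite /sproc s0 sin0 normr0; exact: mulr_ge0 qV (m0 w).
  by apply: le_trans (sin_max _) _; rewrite ler_pdivlMl// mulr1.
have z1 : cn (cf P (fun w => th * sproc k t w)) <= 1.
  by apply: cf_le1; exact: measurable_funM.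
have jE : jump_approx k [:: (th, t)] =
    cf P (fun w => th * sproc k t w) ^+ (2 ^ k) * cexp (th * comp k t).
  rewrite /jump_approx big_seq1; congr (_ ^+ _ * _).
  by apply: eq_cf => w; rewrite lin1.
apply: le_trans (_ : cn (jump_approx k [:: (th, t)] - 1) <= _).
  apply: le_trans (ler_norm _) _; rewrite distrC.
  by have := abs_Re_le (jump_approx k [:: (th, t)] - 1); rewrite raddfB.
rewrite jE; move: z1 hcf; set z := cf P _ => z1 hcf.
have -> : z ^+ (2 ^ k) * cexp (th * comp k t) - 1 =
  (z ^+ (2 ^ k) - 1 ^+ (2 ^ k)) * cexp (th * comp k t) + (cexp (th * comp k t) - 1).
  by rewrite expr1n; ring.
apply: le_trans (cnD _ _) _; rewrite cnM cn_cexp mulr1.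
have h1 : cn (z ^+ (2 ^ k) - 1 ^+ (2 ^ k)) <= eta / 4 + `|th| * (A / q * B).
  apply: le_trans (cn_subX _ z1 _) _; first by rewrite cn1.
  by apply: le_trans hg; rewrite natrX ler_wpM2l// ltW.
have h2 : cn (cexp (th * comp k t) - 1) <= `|th| * (B' + q^-1 * B).
  by apply: le_trans (cn_cexp_sub1 _) _; rewrite normrM ler_wpM2l.
have h3 : `|th| * K <= eta / 2.
  apply: le_trans (ler_wpM2r K0 hth) _.
  rewrite -[leLHS]mulrA -[leRHS]mulr1; apply: ler_wpM2l; first by rewrite divr_ge0// ltW.
  by rewrite ler_pdivrMl// mulr1 lerDl.
apply: le_trans (lerD h1 h2) _; rewrite -addrA -mulrDr -/K.
by move: h3; move: (`|th| * K) => u; lra.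
Qed.

Definition jump_lim l : R[i] :=
  lim (complex.Re (jump_approx k l) @[k --> U]) +i* lim (complex.Im (jump_approx k l) @[k --> U]).

Lemma jump_lim_cvg l : ccvg U (jump_approx ^~ l) (jump_lim l).
Proof.
have b k : cn (jump_approx k l) <= 1.
  rewrite /jump_approx cnM cn_cexp mulr1 cnX exprn_ile1 ?cn_ge0// cf_le1//.
  exact: measurable_lin.
apply/ccvg_ReIm; split => /=; apply: (@ultra_cvg R U UU _ 1) => k; apply: le_trans (b k).
  exact: abs_Re_le.
exact: abs_Im_le.
Qed.

Lemma realizable_jump_lim : realizable jump_lim.
Proof.
apply: (@realizable_lim R U UU Uoo _ _ realizable_jump_approx jump_lim_cvg).
exact: jump_approx_tight.
Qed.

Section explicit.
Variables (m : nat) (t : m.-tuple R).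
Local Notation V := (m.-tuple R).
Variables (dS : measure_display) (S : measurableType dS) (M : {finite_measure set S -> \bar R}).
Variables (Y : S -> V).
Hypothesis mY : measurable_fun setT Y.
Let nu (f : V -> R) := Ex M (fun w => rdiv f (Y w)).
Hypothesis lim_nu : forall f K, measurable_fun setT f -> fconv U f ->
  (forall x, `|f x| <= K * rho x) -> flat f ->
  2 ^+ k * Ex P (fun w => f (Dv X t k w)) @[k --> U] --> nu f.

(** On the ball of radius [e] the thresholded vector is [0]; outside it [rho] is at least [q]. *)
Lemma vsoft_bound (f : V -> R) K x : (forall x, (forall i, tnth x i = 0) -> f x = 0) ->
  (forall x, `|f x| <= K) -> `|f (vsoft e x)| <= K / q * rho x.
Proof.
move=> f0 fK; have K0 : 0 <= K := le_trans (normr_ge0 _) (fK x).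
have [h|h] := leP (sqnorm x) (e ^+ 2).
  rewrite f0 ?normr0; first by rewrite mulr_ge0 ?rho_ge0// mulr_ge0// invr_ge0 ltW.
  exact: (vsoft_eq0 (ltW e0)).
apply: le_trans (fK _) _; rewrite -mulrA ler_peMr// ler_pdivlMl// mulr1.
by rewrite /rho le_min /q !ge_min lexx/= (ltW h) orbT.
Qed.

Lemma vsoft_lim (f : V -> R) K : measurable_fun setT f -> fconv U f ->
  (forall x, (forall i, tnth x i = 0) -> f x = 0) -> (forall x, `|f x| <= K) ->
  2 ^+ k * Ex P (fun w => f (vsoft e (Dv X t k w))) @[k --> U] --> nu (fun x => f (vsoft e x)).
Proof.
move=> mf cf f0 fK; apply: (lim_nu (f := fun x => f (vsoft e x)) (K := K / q)).
- exact: (measurableT_comp mf (measurable_vsoft e)).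
- exact: fconv_vsoft.
- by move=> x; exact: vsoft_bound.
- exact: flat_vsoft.
Qed.

Lemma measurable_sin_dot (th : V) : measurable_fun setT (fun x : V => sin (dot th x)).
Proof.
apply: (measurableT_comp _ (measurable_dot th)).
by apply: continuous_measurable_fun; exact: continuous_sin.
Qed.

Lemma bmf_nu_vsoft (f : V -> R) K : measurable_fun setT f ->
  (forall x, (forall i, tnth x i = 0) -> f x = 0) -> (forall x, `|f x| <= K) ->
  bmf (fun w => rdiv (fun x => f (vsoft e x)) (Y w)).
Proof.
move=> mf f0 fK; split.
  apply: (measurableT_comp _ mY); apply: measurable_rdiv.
  exact: (measurableT_comp mf (measurable_vsoft e)).
by exists `|K / q| => w; apply: rdiv_bound => x; exact: vsoft_bound.
Qed.

(** Thresholded integrands are flat, so the real part has no quadratic term. In the imaginary part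
    the compensator subtracts the integrals of the coordinate sines and adds the original drift,
    turning [sin (dot th x)] into the centred [fsin]. *)
Lemma jump_lim_zl (th : V) : jump_lim (zl th t) =
  cE (nu (fun x => fcos th (vsoft e x)) +i*
      (\sum_(i < m) tnth th i * drift P X U (tnth t i) + nu (fun x => fsin th (vsoft e x)))).
Proof.
apply: (@ccvg_unique _ U _ _ _ _ (@jump_lim_cvg (zl th t))).
have sin0x (x : V) : (forall i, tnth x i = 0) -> sin (dot th x) = 0.
  by move=> x0; rewrite dot_zero// sin0.
have sinc0 i (x : V) : (forall i, tnth x i = 0) -> sin (tnth x i) = 0.
  by move=> x0; rewrite x0 sin0.
have linE k w : lin (zl th t) (sproc k) w = dot th (vsoft e (Dv X t k w)).
  by rewrite lin_zl; apply: eq_bigr => i _; rewrite vsoftE DvE.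
have mv k : measurable_fun setT (fun w => dot th (vsoft e (Dv X t k w))).
  apply: (measurableT_comp (measurable_dot th)).
  exact: (measurableT_comp (measurable_vsoft e) (measurable_Dv mX t k)).
pose z k := cf P (fun w => dot th (vsoft e (Dv X t k w))).
have zlE k : cf P (lin (zl th t) (sproc k)) = z k by apply: eq_cf => v; exact: linE.
have zp : ccvg U (fun k => z k ^+ (2 ^ k))
    (cE (nu (fun x => fcos th (vsoft e x)) +i* nu (fun x => sin (dot th (vsoft e x))))).
  apply: (@cf_pow2_cvg _ _ _ P U _ _ _ _ Uoo mv).
    apply: (@vsoft_lim (fcos th) 2 (measurable_fcos th)).
    - apply: fconvB; last exact: fconv_cst.
      by apply: fconv_comp; [exact: continuous_cos|exact: fconv_dot].
    - by move=> x x0; rewrite /fcos dot_zero// cos0 subrr.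
    - move=> x; rewrite /fcos distrC ger0_norm ?one_sub_cos_ge0//.
      by have := cos_geN1 (dot th x); lra.
  apply: (@vsoft_lim (fun x => sin (dot th x)) 1 (measurable_sin_dot th)) => //.
  - by apply: fconv_comp; [exact: continuous_sin|exact: fconv_dot].
  - by move=> x; exact: sin_max.
have cc : \sum_(p <- zl th t) p.1 * comp k p.2 @[k --> U] -->
    \sum_(i < m) tnth th i * (drift P X U (tnth t i) - nu (fun x => sin (tnth (vsoft e x) i))).
  under eq_fun do rewrite sum_zl.
  apply: cvg_sum => i; apply: cvgMl_tmp.
  have dr := drift_cvg mX scX tsX UU.
  have fs : fconv U (fun x : V => sin (tnth x i)) by exact: fconv_sinc.
  have h := @vsoft_lim (fun x => sin (tnth x i)) 1 (@measurable_sinc _ _ i) fs (sinc0 i)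
    (fun x => sin_max _).
  have c := cvgB (dr (tnth t i)) h.
  apply: (cvg_trans _ (c _)); apply: near_eq_cvg; apply: nearW => k.
  rewrite !fctE /comp mulrBr; congr (_ - _ * _).
  by apply: eq_Ex => v; rewrite vsoftE DvE.
set c := \sum_(i < m) tnth th i * _ in cc.
have ce : ccvg U (fun k => cE (0 +i* (\sum_(p <- zl th t) p.1 * comp k p.2))) (cE (0 +i* c)).
  by apply: ccvg_cE => //; exact: cvg_cst.
have cE0i (y : R) : cE (0 +i* y) = cexp y by rewrite /cE /= expR0 mul1r.
have : ccvg U (fun k => z k ^+ (2 ^ k) * cE (0 +i* (\sum_(p <- zl th t) p.1 * comp k p.2)))
   (cE (nu (fun x => fcos th (vsoft e x)) +i* nu (fun x => sin (dot th (vsoft e x)))) * cE (0 +i* c)).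
  exact: (@ccvgM _ U _ (fun k => z k ^+ (2 ^ k)) _ _ _ zp ce).
under [X in ccvg _ X _]eq_fun do rewrite cE0i -zlE.
rewrite -cED.
rewrite (_ : (_ +i* _) + (_ +i* _) = nu (fun x => fcos th (vsoft e x)) +i*
  (\sum_(i < m) tnth th i * drift P X U (tnth t i) + nu (fun x => fsin th (vsoft e x))))//.
apply/eqP; rewrite eq_complex /= addr0 eqxx/=; apply/eqP.
have -> : c = \sum_(i < m) tnth th i * drift P X U (tnth t i) -
    \sum_(i < m) tnth th i * nu (fun x => sin (tnth (vsoft e x) i)).
  by rewrite -sumrB; apply: eq_bigr => i _; rewrite mulrBr.
rewrite addrCA; congr (_ + _).
have bs1 := bmf_nu_vsoft (measurable_sin_dot th) (@sin0x) (fun x => sin_max _).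
have bs2 i := bmf_nu_vsoft (@measurable_sinc _ _ i) (@sinc0 i) (fun x => sin_max _).
rewrite /nu; under eq_bigr do rewrite -ExZ//.
rewrite -Ex_sum; last by move=> i; exact: bmfZ.
rewrite -ExB//; last by apply: bmf_sum => i; exact: bmfZ.
apply: eq_Ex => v; rewrite /rdiv /fsin mulrBl; congr (_ - _).
by rewrite /sdot mulr_suml; apply: eq_bigr => i _; rewrite mulrA.
Qed.

End explicit.

End fixed_threshold.
End jump_part.

Lemma zl1 (R : realType) (th t : R) : zl [tuple th] [tuple t] = [:: (th, t)].
Proof. by rewrite /zl enum_ordSl /= (size0nil (size_enum_ord 0)) /= !tnth0. Qed.

Section jump_process.
Variables (R : realType) (d : measure_display) (T : measurableType d).
Variables (P : probability T R) (X : @process R T).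
Hypothesis mX : forall t, measurable_fun setT (X t).
Hypothesis scX : forall t eps delta : R, 0 < eps -> 0 < delta -> exists eta : R,
  0 < eta /\ forall s, `|s - t| < eta ->
    fine (P [set w | eps < `|X s w - X t w|]) < delta.
Hypothesis tsX : forall n l, (0 < n)%N -> phi P X (scl n%:R 1 l) = phi P X l ^+ n.
Variables (U : set_system nat) (UU : UltraFilter U) (Uoo : \oo `<=` U).

Let ej (j : nat) : R := j.+1%:R^-1.
Let ej0 j : 0 < ej j. Proof. by rewrite invr_gt0. Qed.

(* Removing the Gaussian factor from [phi]; positive definiteness is not clear a
   priori. *)
Definition psi l : R[i] := phi P X l * (expR (Qf P X l / 2))%:C.

Section limit.
Variables (m : nat) (dS : measure_display) (S : measurableType dS).
Variables (M : {finite_measure set S -> \bar R}) (Y : S -> m.-tuple R).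
Hypothesis mY : measurable_fun setT Y.

(** Thresholding moves each coordinate by at most the threshold and does not increase [rho], so
    convergence is pointwise and dominated by [|K|]. *)
Lemma nu_vsoft_cvg (f : m.-tuple R -> R) K : measurable_fun setT f -> fconv \oo f ->
  (forall x, `|f x| <= K * rho x) ->
  Ex M (fun w => rdiv (fun x => f (vsoft (ej j) x)) (Y w)) @[j --> \oo] -->
  Ex M (fun w => rdiv f (Y w)).
Proof.
move=> mf cf fK; have vK j x : `|f (vsoft (ej j) x)| <= `|K| * rho x.
  apply: le_trans (fK _) _; apply: le_trans (ler_wpM2r (rho_ge0 _) (ler_norm K)) _.
  by rewrite ler_wpM2l//; exact: rho_vsoft (ltW (ej0 j)).
apply: (@Ex_cvg _ _ _ _ _ _ `|K|) => [j|j w|w].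
- apply: (measurableT_comp _ mY); apply: measurable_rdiv.
  exact: (measurableT_comp mf (measurable_vsoft _)).
- by have := rdiv_bound (vK j) (Y w); rewrite normr_id.
apply: cvgMr_tmp; apply: cf => i.
apply/cvgrPdist_le => e e0; have /cvgr0_norm_le /(_ e e0) := @invSn_cvg0 R.
apply: filterS => k; rewrite (ger0_norm (ltW (ej0 k))) => he.
by rewrite vsoftE distrC; apply: le_trans (soft_near _ (ltW (ej0 k))) he.
Qed.

End limit.

Lemma psi_zl m (th t : m.-tuple R) (dS : measure_display) (S : measurableType dS)
  (M : {finite_measure set S -> \bar R}) (Y : S -> m.-tuple R) (Q : 'M[R]_m) a :
  measurable_fun setT Y ->
  (forall th, Hlog P X (zl th t) = - (quad Q th / 2) + Ex M (fun w => rdiv (fcos th) (Y w))) ->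
  phi P X (zl th t) = cE (Hlog P X (zl th t) +i* a) ->
  psi (zl th t) = cE (Ex M (fun w => rdiv (fcos th) (Y w)) +i* a).
Proof.
move=> mY HE pE; rewrite /psi pE HE (Qf_rep mY HE).
have -> : (expR (quad Q th / 2))%:C = cE ((quad Q th / 2) +i* 0) by rewrite /cE /= cexp0 mulr1.
rewrite -cED; congr cE; apply/eqP; rewrite eq_complex /=.
by apply/andP; split; apply/eqP; ring.
Qed.

(** The representation [M], [Y] is the same for every threshold, so only the integrands vary with
    [j]. *)
Lemma jump_lim_cvg_psi l : ccvg U (fun j => jump_lim P X U (ej j) l) (psi l).
Proof.
have [th [t <-]] := zl_list l.
have [dS [S [M [Y [mY lim psd HE phiE]]]]] := levy_rep mX scX tsX UU Uoo t.
set Q := \matrix_(i, j) _ in psd HE.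
rewrite (psi_zl mY HE (phiE th)).
under [X in ccvg _ X _]eq_fun => j do rewrite (jump_lim_zl mX scX tsX UU Uoo (ej0 j) mY lim).
apply: ccvg_cE.
  have c : Ex M (fun w => rdiv (fun x => fcos th (vsoft (ej j) x)) (Y w)) @[j --> \oo] -->
      Ex M (fun w => rdiv (fcos th) (Y w)).
    apply: (@nu_vsoft_cvg _ _ _ M Y mY (fcos th) (2 + wt th ^+ 2) (measurable_fcos th)); last exact: fcos_abs.
    apply: fconvB; last exact: fconv_cst.
    by apply: fconv_comp; [exact: continuous_cos|exact: fconv_dot].
  by move=> A /c; apply: Uoo.
have c : Ex M (fun w => rdiv (fun x => fsin th (vsoft (ej j) x)) (Y w)) @[j --> \oo] -->
    Ex M (fun w => rdiv (fsin th) (Y w)).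
  apply: (@nu_vsoft_cvg _ _ _ M Y mY (fsin th) (1 + wt th + (2 * wt th ^+ 2 + 2 * wt th)) (measurable_fsin th)); last exact: fsin_abs.
  apply: fconvB; last exact: fconv_sdot.
  by apply: fconv_comp; [exact: continuous_sin|exact: fconv_dot].
have cU : Ex M (fun w => rdiv (fun x => fsin th (vsoft (ej j) x)) (Y w)) @[j --> U] -->
    Ex M (fun w => rdiv (fsin th) (Y w)).
  by move=> A /c; apply: Uoo.
by apply: cvgD => //; exact: cvg_cst.
Qed.

Lemma cn_cE_sub1 (z : R[i]) (r : R) : complex.Re z <= 0 -> cn z <= 3 * r -> 0 <= r -> r <= 36^-1 ->
  cn (cE z - 1) <= 4 * r.
Proof.
move=> z0 zr r0 r1; have -> : cE z - 1 = (cE z - 1 - z) + z by ring.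
apply: le_trans (cnD _ _) _; have := cE_taylor z0.
have : cn z ^+ 2 <= (3 * r) ^+ 2 by rewrite ler_sqr ?nnegrE ?cn_ge0 ?mulr_ge0.
(* The Taylor remainder is at most [4 (3 r)^2 = 36 r^2], hence at most [r]; this is the origin of
   [36^-1]. *)
have : r * r <= 36^-1 * r by apply: ler_wpM2r.
rewrite exprMn expr2; lra.
Qed.

Lemma bmf_rdiv m (f : m.-tuple R -> R) K (dS : measure_display) (S : measurableType dS)
  (Y : S -> m.-tuple R) : measurable_fun setT Y -> measurable_fun setT f ->
  (forall x, `|f x| <= K * rho x) -> bmf (fun w => rdiv f (Y w)).
Proof.
move=> mY mf fK; split; first exact: (measurableT_comp (measurable_rdiv mf) mY).
by exists `|K| => w; exact: rdiv_bound.
Qed.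

(** Common bound for [fcos] and [fsin] at frequencies up to [1 / (n + 1)], uniform in the threshold.
    It is dominated by [5 * rho] and its integral tends to [0] with [n]. *)
Let gn (n : nat) (x : 1.-tuple R) : R := Num.min 4 (n.+1%:R^-1 * (5 * sqnorm x)).

Let g0 n x : 0 <= gn n x.
Proof. by rewrite le_min ler0n/= mulr_ge0 ?invr_ge0// mulr_ge0// sqnorm_ge0. Qed.

Let g5 n x : gn n x <= 5 * rho x.
Proof.
rewrite /gn /rho; have s0 := sqnorm_ge0 x.
have : n.+1%:R^-1 * (5 * sqnorm x) <= 5 * sqnorm x.
  by rewrite ler_piMl ?mulr_ge0// invf_le1// ler1n.
rewrite ge_min; move: (n.+1%:R^-1 * _) => v hv.
by have [h|h] := leP 1 (sqnorm x); apply/orP; [left; lra|right].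
Qed.

Let mg n : measurable_fun setT (gn n).
Proof.
apply: measurable_minr => //; apply: measurable_funM => //; apply: measurable_funM => //.
exact: measurable_sqnorm.
Qed.

Lemma gn_cvg0 (dS : measure_display) (S : measurableType dS)
  (M : {finite_measure set S -> \bar R}) (Y : S -> 1.-tuple R) :
  measurable_fun setT Y -> Ex M (fun w => rdiv (gn n) (Y w)) @[n --> \oo] --> (0 : R).
Proof.
move=> mY.
have -> : (0 : R) = Ex M (fun w => 0) by rewrite Ex_cst mul0r.
apply: (@Ex_cvg _ _ _ _ _ _ `|5|) => [n|n w|w].
- exact: (measurableT_comp (measurable_rdiv (@mg n)) mY).
- by apply: rdiv_bound => x; rewrite ger0_norm.
have h : n.+1%:R^-1 * (5 * sqnorm (Y w) / rho (Y w)) @[n --> \oo] --> (0 : R).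
  by rewrite -[X in _ --> X](mul0r (5 * sqnorm (Y w) / rho (Y w))); apply: cvgMr_tmp; exact: invSn_cvg0.
apply: (squeeze_cvgr _ (cvg_cst 0) h); apply: nearW => n.
rewrite /rdiv divr_ge0 ?rho_ge0//= mulrA ler_wpM2r ?invr_ge0 ?rho_ge0//.
by rewrite /gn ge_min lexx orbT.
Qed.

Lemma gn_bound n (e th : R) x : 0 <= e -> `|th| <= n.+1%:R^-1 ->
  `|fcos [tuple th] (vsoft e x)| <= gn n x /\ `|fsin [tuple th] (vsoft e x)| <= gn n x.
Proof.
move=> e0 hth; have th1 : `|th| <= 1 by apply: le_trans hth _; rewrite invf_le1// ler1n.
pose s := soft e (tnth x ord0).
have hs : s ^+ 2 <= sqnorm x.
  apply: le_trans (coord_sqr_le x ord0); rewrite -[leLHS]real_normK ?num_real//.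
  by rewrite -[leRHS]real_normK ?num_real// ler_sqr ?nnegrE// soft_le.
have dE : dot [tuple th] (vsoft e x) = th * s by rewrite /dot big_ord1 vsoftE !tnth0.
have sE : sdot [tuple th] (vsoft e x) = th * sin s by rewrite /sdot big_ord1 vsoftE !tnth0.
have hv : `|th| * s ^+ 2 <= n.+1%:R^-1 * sqnorm x.
  by apply: ler_pM => //; exact: sqr_ge0.
have t2 : (th * s) ^+ 2 <= `|th| * s ^+ 2.
  rewrite exprMn ler_wpM2r ?sqr_ge0// -real_normK ?num_real// expr2.
  by rewrite ler_piMl.
have ts0 : 0 <= (th * s) ^+ 2 := sqr_ge0 _.
rewrite /gn !le_min /fcos /fsin dE sE (mulrCA _ 5); move: hv; set v := _^-1 * _ => hv.
split; apply/andP; split.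
- rewrite distrC ger0_norm ?one_sub_cos_ge0//.
  by have := cos_geN1 (th * s); lra.
- rewrite distrC ger0_norm ?one_sub_cos_ge0//.
  by have := one_sub_cos_le (th * s); lra.
- apply: le_trans (ler_normB _ _) _; rewrite normrM.
  have : `|th| * `|sin s| <= 1 by rewrite mulr_ile1// sin_max.
  by have := sin_max (th * s); lra.
- have -> : sin (th * s) - th * sin s = th * (s - sin s) - (th * s - sin (th * s)) by ring.
  apply: le_trans (ler_normB _ _) _; rewrite normrM.
  have := ler_wpM2l (normr_ge0 th) (abs_sub_sin_le s); rewrite mulrCA.
  by have := abs_sub_sin_le (th * s); lra.
Qed.

(** Tightness must be uniform over the thresholds [ej j], hence the bound by [gn], in which the
    threshold does not appear. *)
Theorem realizable_psi : realizable psi.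
Proof.
apply: (@realizable_lim R U UU Uoo (fun j => jump_lim P X U (ej j))).
- by move=> j; exact: (realizable_jump_lim mX scX tsX UU Uoo (ej0 j)).
- exact: jump_lim_cvg_psi.
move=> t eta eta0.
have [dS [S [M [Y [mY lim _ _ _]]]]] := levy_rep mX scX tsX UU Uoo [tuple t].
(* The real integral, the imaginary integral and the drift are each kept below [r], so the exponent
   is at most [3 r] in modulus and [cn_cE_sub1] gives [4 r <= eta]. *)
pose r := Num.min 36^-1 (eta / 4).
have r0 : 0 < r by rewrite lt_min invr_gt0 divr_gt0// ltr0n.
have [n hn] : exists n, Ex M (fun w => rdiv (gn n) (Y w)) <= r.
  have /cvgr0_norm_le /(_ r r0) := gn_cvg0 M mY.
  by move=> [n _ /(_ n (leqnn n))] /= h; exists n; apply: le_trans (ler_norm _) h.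
pose D := drift P X U t.
have D1 : 0 < `|D| + 1 by rewrite ltr_wpDl.
exists (Num.min n.+1%:R^-1 (r / (`|D| + 1))); split; first by rewrite lt_min invr_gt0 divr_gt0// ltr0n.
apply: Uoo; exists 0%N => // j _ th; rewrite le_min => /andP[h1 h2].
rewrite -zl1 (jump_lim_zl mX scX tsX UU Uoo (ej0 j) mY lim) big_ord1 !tnth0 -/D.
have bnd (f : 1.-tuple R -> R) : measurable_fun setT f -> (forall x, `|f x| <= gn n x) ->
    `|Ex M (fun w => rdiv f (Y w))| <= r.
  move=> mf fg; apply: le_trans hn; apply: Ex_abs.
  - by apply: (bmf_rdiv (K := 5) mY mf) => x; exact: le_trans (fg x) (g5 n x).
  - by apply: (bmf_rdiv (K := 5) mY (@mg n)) => x; rewrite ger0_norm.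
  move=> w; rewrite /rdiv normrM (@ger0_norm _ (_^-1)) ?invr_ge0 ?rho_ge0//.
  by rewrite ler_wpM2r ?invr_ge0 ?rho_ge0.
have gb x := gn_bound x (ltW (ej0 j)) h1.
have mv := @measurable_vsoft R 1 (ej j).
have b1 := bnd _ (measurableT_comp (measurable_fcos [tuple th]) mv) (fun x => (gb x).1).
have b2 := bnd _ (measurableT_comp (measurable_fsin [tuple th]) mv) (fun x => (gb x).2).
set z := _ +i* _.
apply: le_trans (_ : cn (cE z - 1) <= _).
  by apply: le_trans (ler_norm _) _; rewrite distrC; have := abs_Re_le (cE z - 1); rewrite raddfB.
apply: le_trans (_ : 4 * r <= _); last first.
  have : r <= eta / 4 by rewrite /r ge_min lexx orbT.
  lra.
apply: cn_cE_sub1; [|  |exact: ltW|by rewrite /r ge_min lexx].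
  rewrite /= -oppr_ge0 -mulN1r -ExZ; first apply: Ex_ge0.
    move=> v; rewrite /rdiv mulN1r -mulNr divr_ge0 ?rho_ge0// /fcos.
    by rewrite opprB one_sub_cos_ge0.
  apply: (bmf_rdiv (K := 5) mY (measurableT_comp (measurable_fcos [tuple th]) mv)) => x.
  exact: le_trans (gb x).1 (g5 n x).
apply: le_trans (cn_le _) _; rewrite /=.
have : `|th * D| <= r.
  rewrite normrM; apply: le_trans (_ : r / (`|D| + 1) * (`|D| + 1) <= _); last first.
    by rewrite divfK// gt_eqF.
  by apply: ler_pM => //; rewrite lerDl.
move=> b3; apply: le_trans (lerD b1 (ler_normD _ _)) _.
have -> : 3 * r = r + (r + r) by ring.
by apply: lerD => //; apply: lerD.
Qed.

End jump_process.

(** * The Levy measure *)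

Section density_measure.
Variables (d : measure_display) (T : measurableType d) (R : realType).
Variables (mu : {measure set T -> \bar R}) (g : T -> R).
Hypotheses (mg : measurable_fun setT g) (g0 : forall x, 0 <= g x).
Import HBNNSimple.

Definition dens of measurable_fun setT g & (forall x, 0 <= g x) :=
  fun A : set T => (\int[mu]_(x in A) (g x)%:E)%E.
Local Notation nu := (dens mg g0).

Let mgE : measurable_fun setT (EFin \o g).
Proof. exact/measurable_EFinP. Qed.

Let nu_set0 : nu set0 = 0%E. Proof. by rewrite /dens integral_set0. Qed.
Let nu_ge0 A : (0 <= nu A)%E.
Proof. by apply: integral_ge0 => x _; rewrite lee_fin. Qed.
Let nu_additive : semi_sigma_additive nu.
Proof. by apply: semi_sigma_additive_nng_induced => // x; rewrite lee_fin. Qed.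

HB.instance Definition _ := isMeasure.Build d T R nu nu_set0 nu_ge0 nu_additive.

(** Monotone approximation by simple functions, for which the formula is the definition of [dens] on
    level sets. *)
Lemma ge0_integral_dens (f : T -> \bar R) : measurable_fun setT f -> (forall x, 0 <= f x)%E ->
  (\int[nu]_x f x = \int[mu]_x (f x * (g x)%:E))%E.
Proof.
move=> mf f0; pose h := nnsfun_approx measurableT mf.
have hf x : (EFin \o h n) x @[n --> \oo] --> f x by exact: cvg_nnsfun_approx.
have mh n : measurable_fun setT (EFin \o h n) by apply/measurable_EFinP; exact/measurable_funP.
have nd x n m : (n <= m)%N -> ((h n x)%:E <= (h m x)%:E)%E.
  by move=> nm; rewrite lee_fin; exact/lefP/nd_nnsfun_approx.
have -> : (\int[nu]_x f x = limn (fun n => \int[nu]_x (h n x)%:E))%E.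
  rewrite -monotone_convergence//.
  - by apply: eq_integral => x _; apply/esym/cvg_lim => //; exact: hf.
  - by move=> n x _; rewrite lee_fin.
  - by move=> x _ n m; exact: nd.
have -> : (\int[mu]_x (f x * (g x)%:E) = limn (fun n => \int[mu]_x ((h n x)%:E * (g x)%:E)))%E.
  rewrite -monotone_convergence//.
  - apply: eq_integral => x _; apply/esym/cvg_lim => //.
    by apply: cvgeZr => //; exact: hf.
  - by move=> n; apply: emeasurable_funM; [exact: mh|exact/measurable_EFinP].
  - by move=> n x _; rewrite mule_ge0// lee_fin.
  - by move=> x _ n m nm; rewrite lee_wpmul2r ?lee_fin ?g0//; exact: nd.
congr (limn _); apply/funext => n.
rewrite integralT_nnsfun sintegralE.
transitivity (\int[mu]_x (\sum_(y \in range (h n)) (y%:E * (\1_(h n @^-1` [set y]) x * g x)%:E)))%E; last first.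
  apply: eq_integral => x _; rewrite [in RHS](fimfunE (h n) x) -EFinM.
  rewrite mulr_fsuml -fsumEFin//; apply: eq_fsbigr => y _.
  by rewrite -EFinM mulrA.
have mhg y : measurable_fun setT (fun x => (\1_(h n @^-1` [set y]) x * g x)%:E).
  by apply/measurable_EFinP; apply: measurable_funM => //; exact: measurable_indic.
rewrite ge0_integral_fsum//.
- apply: eq_fsbigr => y; rewrite inE => -[x _ <-].
  rewrite ge0_integralZl//.
  - congr (_ * _)%E; rewrite /dens [LHS]integral_mkcond; apply: eq_integral => z _.
    by rewrite patchE indicE; case: ifPn => zA; rewrite ?mul1r ?mul0r.
  - by move=> z _; rewrite lee_fin mulr_ge0.
  - by rewrite lee_fin.
- by move=> y; apply: measurable_funeM.
- move=> y x _; rewrite indicE; case: (boolP (_ \in _)) => [|_].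
    by rewrite inE => /= <-; rewrite -EFinM lee_fin mul1r mulr_ge0.
  by rewrite mul0r mule0.
Qed.

End density_measure.

Lemma density_image d (T : measurableType d) d' (V : measurableType d') (R : realType)
  (mu : {measure set T -> \bar R}) (g : T -> R) (W : T -> V) :
  measurable_fun setT g -> (forall x, 0 <= g x) -> measurable_fun setT W ->
  exists nu : {measure set V -> \bar R}, forall f : V -> \bar R,
    measurable_fun setT f -> (forall x, 0 <= f x)%E ->
    (\int[nu]_x f x = \int[mu]_x (f (W x) * (g x)%:E))%E.
Proof.
move=> mg g0 mW; unshelve eexists (pushforward (dens mu mg g0) W); first exact: mW.
move=> f mf f0; rewrite ge0_integral_pushforward// preimage_setT ge0_integral_dens//.
  exact: (measurableT_comp mf mW).
by move=> x; exact: f0.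
Qed.

Section levy_measure_density.
Variables (R : realType) (n : nat).
Local Notation V := (n.-tuple R).
Variables (d : measure_display) (S : measurableType d) (M : {finite_measure set S -> \bar R}).
Variables (Y : S -> V).
Hypothesis mY : measurable_fun setT Y.

(** The image under [Y] of [M] with density [1 / rho (Y)], undoing the weight. As the inverse of [0]
    is [0], the origin gets no mass, and the integral of [rho] is at most the mass of [M]. *)
Lemma exists_levy_measure : exists nu : {measure set V -> \bar R}, levy_measure nu /\
  forall (f : V -> R) K, measurable_fun setT f -> (forall x, `|f x| <= K * rho x) ->
    Rintegral nu [set: V] f = Ex M (fun w => rdiv f (Y w)).
Proof.
have mr : measurable_fun setT (fun w => (rho (Y w))^-1).
  have := measurableT_comp (measurable_rdiv (measurable_cst (1 : R))) mY.
  by move=> h; apply: eq_measurable_fun h => w _; rewrite /rdiv /= div1r.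
have r0 w : 0 <= (rho (Y w))^-1 by rewrite invr_ge0 rho_ge0.
have [nu hnu] := density_image M mr r0 mY.
exists nu; split; first split.
- have mA : measurable [set [tuple (0 : R) | _ < n]].
    rewrite (_ : [set _] = (@sqnorm R n) @^-1` [set 0]).
      by rewrite -[X in measurable X]setTI; exact: measurable_sqnorm.
    apply/seteqP; split => x /= h.
      by rewrite h sqnormE big1// => i _; rewrite tnth_mktuple expr0n.
    by apply: eq_from_tnth => i; rewrite tnth_mktuple sqnorm0_coord.
  rewrite -[X in nu X]setIT -integral_indic//.
  rewrite hnu//; last first.
    by apply/measurable_EFinP; exact: measurable_indic.
  rewrite integral0_eq// => w _; rewrite indicE; case: (boolP (_ \in _)); last by rewrite mul0e.
  rewrite inE /= => ->; rewrite (_ : rho _ = 0) ?invr0 ?mule0//.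
  apply/eqP; rewrite rho_eq0 sqnormE big1// => i _; by rewrite tnth_mktuple expr0n.
- rewrite hnu//; [|by apply/measurable_EFinP; exact: measurable_rho|by move=> x; rewrite lee_fin rho_ge0].
  have b : (\int[M]_w (rho (Y w) / rho (Y w))%:E < +oo)%E.
    apply: le_lt_trans (_ : (\int[M]_w 1%:E < +oo)%E).
      apply: ge0_le_integral => //.
      - by move=> w _; rewrite lee_fin mulr_ge0 ?rho_ge0.
      - by apply/measurable_EFinP; apply: measurable_funM => //; exact: (measurableT_comp (@measurable_rho _ _) mY).
      - move=> w _; rewrite lee_fin; have [->|h] := eqVneq (rho (Y w)) 0; first by rewrite mul0r.
        by rewrite divff.
    by rewrite integral_cst// mul1e; exact: fin_num_fun_lty.
  by rewrite (eq_integral (fun w => (rho (Y w) / rho (Y w))%:E)).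
move=> f K mf fK; rewrite /Ex /Rintegral; congr fine.
have mfE : measurable_fun setT (EFin \o f) by exact/measurable_EFinP.
(* The density formula is available for nonnegative functions only, so positive and negative parts
   are treated separately. *)
have key (u : R) w : (maxe (u%:E) 0 * (rho (Y w))^-1%:E = maxe (u * (rho (Y w))^-1)%:E 0)%E.
  rewrite -!EFin_max -EFinM; congr EFin.
  by rewrite maxr_pMl// mul0r.
rewrite integralE [RHS]integralE; congr (_ - _)%E; rewrite hnu//.
- by apply: eq_integral => w _; rewrite !funeposE /= key.
- exact: measurable_funepos.
- by apply: eq_integral => w _; rewrite !funenegE /= key mulNr.
- exact: measurable_funeneg.
Qed.

End levy_measure_density.

Lemma dot_fdvec (R : realType) T n (X : @process R T) (t th : n.-tuple R) w :
  dot th (fdvec X t w) = lin (zl th t) X w.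
Proof. by rewrite lin_zl; apply: eq_bigr => i _; rewrite tnth_mktuple. Qed.

Section levy_khintchine_triplet.
Variables (R : realType) (d : measure_display) (T : measurableType d).
Variables (P : probability T R) (X : @process R T).
Hypothesis mX : forall t, measurable_fun setT (X t).
Hypothesis scX : forall t eps delta : R, 0 < eps -> 0 < delta -> exists eta : R,
  0 < eta /\ forall s, `|s - t| < eta ->
    fine (P [set w | eps < `|X s w - X t w|]) < delta.
Hypothesis tsX : forall n l, (0 < n)%N -> phi P X (scl n%:R 1 l) = phi P X l ^+ n.
Variables (U : set_system nat) (UU : UltraFilter U) (Uoo : \oo `<=` U).

Section truncation.
Variable n : nat.
Implicit Types x th : n.-tuple R.

Let ball_ind x : R := if sqnorm x <= 1 then 1 else 0.

(** Difference between the centring by the unit ball and the centring by the sine. It is of order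
    [rho], so its integral is finite and can be moved into the drift. *)
Let ftr i x : R := tnth x i * ball_ind x - sin (tnth x i).

Let ftr_abs i x : `|ftr i x| <= 2 * rho x.
Proof.
rewrite /ftr /ball_ind; case: ifPn => [h|]; last rewrite -ltNge => h.
  rewrite mulr1 rho_small//; apply: le_trans (abs_sub_sin_le _) _.
  by rewrite ler_wpM2l// coord_sqr_le.
rewrite mulr0 sub0r normrN /rho min_l ?(ltW h)// mulr1.
by apply: le_trans (sin_max _) _; rewrite ler1n.
Qed.

Let measurable_ball_ind : measurable_fun setT ball_ind.
Proof.
apply: measurable_fun_ifT => //; apply: measurable_fun_ler => //.
exact: measurable_sqnorm.
Qed.

Let measurable_ftr i : measurable_fun setT (ftr i).
Proof.
apply: measurable_funB; last exact: measurable_sinc.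
by apply: measurable_funM => //; exact: measurable_coord.
Qed.

Let fsin_ftr th x : sin (dot th x) - dot th x * ball_ind x =
  fsin th x - \sum_(i < n) tnth th i * ftr i x.
Proof.
have -> : \sum_(i < n) tnth th i * ftr i x = dot th x * ball_ind x - sdot th x.
  rewrite /dot /sdot mulr_suml -sumrB; apply: eq_bigr => i _.
  by rewrite /ftr mulrBr mulrA.
by rewrite /fsin; ring.
Qed.

(** Dividing out the Gaussian factor leaves only the jump exponent, with matrix [0]. Changing the
    truncation from the sine to the unit ball shifts the drift by the integral of [ftr]. *)
Lemma LK_triplet_psi d' (T' : measurableType d') (P' : probability T' R) (Z : @process R T')
  (t : n.-tuple R) :
  (forall l, cf P' (lin l Z) = psi P X l) ->
  exists a nu, LK_triplet P' (fdvec Z t) a 0 nu.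
Proof.
move=> ZE; have [dS [S [M [Y [mY lim _ HE phiE]]]]] := levy_rep mX scX tsX UU Uoo t.
set Q := \matrix_(i, j) _ in HE.
have [nu [lnu hnu]] := exists_levy_measure M mY.
exists [tuple drift P X U (tnth t i) + Rintegral nu setT (ftr i) | i < n], nu.
split=> //; split; first by rewrite trmx0.
have quad0 th : quad (0 : 'M[R]_n) th = 0.
  by rewrite /quad big1// => i _; rewrite big1// => j _; rewrite mxE mulr0 mul0r.
split=> [th|th /=]; first by rewrite quad0.
rewrite quad0 mul0r oppr0 add0r.
have K1 := fcos_abs th; have K2 := fsin_abs th.
rewrite (hnu _ _ (measurable_fcos th) K1).
have -> : dot th [tuple drift P X U (tnth t i) + Rintegral nu setT (ftr i) | i < n] +
    Rintegral nu setT (fun x => sin (dot th x) - dot th x * (if sqnorm x <= 1 then 1 else 0)) =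
    \sum_(i < n) tnth th i * drift P X U (tnth t i) + Ex M (fun w => rdiv (fsin th) (Y w)).
  have sumE x : `|\sum_(i < n) tnth th i * ftr i x| <= wt th * 2 * rho x.
    by rewrite -mulrA; apply: sum_wt_le => i; exact: ftr_abs.
  have msum : measurable_fun setT (fun x : n.-tuple R => \sum_(i < n) tnth th i * ftr i x).
    by apply: measurable_sumord => i; apply: measurable_funM.
  set K := (_ + _ : R) in K2.
  rewrite (_ : (fun x => _) = fun x => fsin th x - \sum_(i < n) tnth th i * ftr i x); last first.
    by apply: funext => x; rewrite -fsin_ftr.
  rewrite (hnu _ (K + wt th * 2)); last 2 first.
  - by apply: measurable_funB => //; exact: measurable_fsin.
  - by move=> x; apply: le_trans (ler_normB _ _) _; rewrite mulrDl lerD.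
  rewrite (@eq_Ex _ _ _ _ _ (fun w => rdiv (fsin th) (Y w) - \sum_(i < n) tnth th i * rdiv (ftr i) (Y w))); last first.
    move=> w; rewrite /rdiv mulrBl mulr_suml; congr (_ - _).
    by apply: eq_bigr => i _; rewrite mulrA.
  have bi i : bmf (fun w => rdiv (ftr i) (Y w)) by apply: (bmf_rdiv mY) (ftr_abs i).
  rewrite ExB; last 2 first.
  - exact: (bmf_rdiv mY (measurable_fsin th) K2).
  - by apply: bmf_sum => i; exact: bmfZ.
  rewrite Ex_sum; last by move=> i; exact: bmfZ.
  rewrite /dot (eq_bigr (fun i => tnth th i * drift P X U (tnth t i) + Ex M (fun w => tnth th i * rdiv (ftr i) (Y w)))).
    by rewrite big_split /= addrA addrAC addrK.
  by move=> i _; rewrite tnth_mktuple mulrDr (hnu _ _ (@measurable_ftr i) (ftr_abs i)) ExZ.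
have := ZE (zl th t); rewrite (psi_zl mY HE (phiE th)).
set A := Ex M _; set B := (_ + _ : R).
rewrite /cf /cE /= => /eqP; rewrite eq_complex /= !mul0r subr0 addr0 => /andP[/eqP h1 /eqP h2].
split; [rewrite -h1 | rewrite -h2]; apply: eq_Ex => w; by rewrite dot_fdvec.
Qed.

End truncation.
End levy_khintchine_triplet.

(** * Independent copies *)

Section laws.
Variable R : realType.

Lemma law_exists d (T : measurableType d) d' (S : measurableType d') (P : probability T R)
  (W : T -> S) : measurable_fun setT W ->
  exists Q : probability S R, forall A, Q A = P (W @^-1` A).
Proof.
move=> mW; pose mixW := isMeasurableFun.Build _ _ _ _ _ mW.
pose Wm : {mfun T >-> S} := HB.pack W mixW.
by exists (distribution P Wm).
Qed.

Lemma Ex_of_law d (T : measurableType d) d' (S : measurableType d') (P : probability T R)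
  (W : T -> S) (Q : probability S R) (f : S -> R) : measurable_fun setT W ->
  (forall A, measurable A -> Q A = P (W @^-1` A)) -> bmf f -> Ex P (fun w => f (W w)) = Ex Q f.
Proof.
move=> mW QE bf.
have b1 : bmf (fun _ : T => 1 : R) by exact: bmf_cst.
have := @Ex_mul_of_indic R _ _ P _ _ Q W (fun=> 1) 1 mW b1 _ f bf.
under eq_Ex do rewrite mul1r; rewrite mul1r; apply => A mA.
rewrite mul1r QE// -Ex_indic; last by rewrite -[X in measurable X]setTI; exact: mW.
by apply: eq_Ex => w; rewrite mul1r.
Qed.

Lemma eq_law_Ex d1 (T1 : measurableType d1) d2 (T2 : measurableType d2) d' (S : measurableType d')
  (P1 : probability T1 R) (P2 : probability T2 R) (V1 : T1 -> S) (V2 : T2 -> S) (f : S -> R) :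
  measurable_fun setT V1 -> measurable_fun setT V2 ->
  (forall A, measurable A -> P1 (V1 @^-1` A) = P2 (V2 @^-1` A)) -> bmf f ->
  Ex P1 (fun w => f (V1 w)) = Ex P2 (fun w => f (V2 w)).
Proof.
move=> m1 m2 e bf; have [Q QE] := law_exists P1 m1.
rewrite (Ex_of_law m1 (fun A _ => QE A) bf); apply/esym/Ex_of_law => // A mA.
by rewrite QE e.
Qed.

End laws.

Section independent_sum.
Variables (R : realType) (d : measure_display) (T : measurableType d) (P : probability T R).
Variables (d' : measure_display) (S : measurableType d') (m : nat).
Variables (V : 'I_m -> T -> S) (g : 'I_m -> S -> R).
Hypotheses (mV : forall i, measurable_fun setT (V i)) (mg : forall i, measurable_fun setT (g i)).
Hypothesis indV : forall A : 'I_m -> set S, (forall i, measurable (A i)) ->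
  fine (P (\bigcap_(i in [set: 'I_m]) (V i @^-1` A i))) = \prod_(i < m) fine (P (V i @^-1` A i)).

Let prod_indic (A : 'I_m -> set S) w :
  \prod_(i < m) (\1_(A i) (V i w) : R) = \1_(\bigcap_(i in [set: 'I_m]) (V i @^-1` A i)) w.
Proof.
rewrite indicE; case: (boolP (w \in _)) => [|h].
  by rewrite inE => h; rewrite big1// => i _; rewrite indicE mem_set//; exact: h.
have [i hi] : exists i, ~ A i (V i w).
  by apply: contrapT => /forallNP hi; move/negP: h; apply; rewrite inE => i _; apply: contrapT; exact: hi.
by rewrite (bigD1 i)//= indicE memNset// mul0r.
Qed.

(* Interpolates between the product rule for events ([D] empty) and the product
   rule for characteristic functions ([D] full). *)
Let mixed (D : {set 'I_m}) := forall A : 'I_m -> set S, (forall i, measurable (A i)) ->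
  Ex P (fun w => cos (\sum_(i in D) g i (V i w)) * \prod_(i | i \notin D) \1_(A i) (V i w)) +i*
  Ex P (fun w => sin (\sum_(i in D) g i (V i w)) * \prod_(i | i \notin D) \1_(A i) (V i w)) =
  \prod_(i in D) cf P (fun w => g i (V i w)) * (\prod_(i | i \notin D) fine (P (V i @^-1` A i)))%:C.

Let msum (D : {set 'I_m}) : measurable_fun setT (fun w => \sum_(i in D) g i (V i w)).
Proof.
elim: (index_enum _) => [|i r IH].
  by under eq_fun do rewrite big_nil; exact: measurable_cst.
under eq_fun do rewrite big_cons; case: (i \in D) => //.
by apply: measurable_funD => //; exact: measurableT_comp.
Qed.

Let bprod (Q : pred 'I_m) (A : 'I_m -> set S) : (forall i, measurable (A i)) ->
  bmf (fun w => \prod_(i | Q i) (\1_(A i) (V i w) : R)).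
Proof.
by move=> mA; apply: bmf_prod => i; apply: (bmf_comp_meas (mV i)); exact: bmf_indic.
Qed.

(** As the event of index [j] varies, the induction hypothesis says that the weighted law of [V j]
    is a constant multiple of its law. Hence the event may be replaced by [cos (g j)] and
    [sin (g j)], and the addition formulas absorb index [j] into the sum. *)
Let mixed_step (D : {set 'I_m}) j : j \notin D -> mixed D -> mixed (j |: D).
Proof.
move=> jD IH A mA; have [Q QE] := law_exists P (mV j).
have notin i : (i \notin j |: D) = (i \notin D) && (i != j) by rewrite in_setU1 negb_or andbC.
pose B w := \prod_(i | i \notin j |: D) (\1_(A i) (V i w) : R).
have bB : bmf B by exact: bprod.
pose s w := \sum_(i in D) g i (V i w).
have b1 : bmf (fun w => cos (s w) * B w) by apply: bmfM => //; apply: bmf_cos; exact: msum.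
have b2 : bmf (fun w => sin (s w) * B w) by apply: bmfM => //; apply: bmf_sin; exact: msum.
pose c := \prod_(i in D) cf P (fun w => g i (V i w)) *
  (\prod_(i | i \notin j |: D) fine (P (V i @^-1` A i)))%:C.
have hE E : measurable E ->
    Ex P (fun w => cos (s w) * B w * \1_E (V j w)) = complex.Re c * fine (Q E) /\
    Ex P (fun w => sin (s w) * B w * \1_E (V j w)) = complex.Im c * fine (Q E).
  move=> mE; pose A' i := if i == j then E else A i.
  have mA' i : measurable (A' i) by rewrite /A'; case: eqP.
  have pE w : \prod_(i | i \notin D) (\1_(A' i) (V i w) : R) = B w * \1_E (V j w).
    rewrite (bigD1 j)//= /A' eqxx mulrC; congr (_ * _).
    by apply: eq_big => [i|i /andP[_ /negbTE ->]//]; rewrite notin.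
  have pP : \prod_(i | i \notin D) fine (P (V i @^-1` A' i)) =
      fine (Q E) * \prod_(i | i \notin j |: D) fine (P (V i @^-1` A i)).
    rewrite (bigD1 j)//= /A' eqxx QE; congr (_ * _).
    by apply: eq_big => [i|i /andP[_ /negbTE ->]//]; rewrite notin.
  have := IH A' mA'; rewrite pP rmorphM /= mulrCA -/c.
  case: (c) => a b /eqP; rewrite eq_complex /= !mul0r subr0 addr0 => /andP[/eqP h1 /eqP h2].
  rewrite ![_ * fine (Q E)]mulrC -h1 -h2.
  by split; apply: eq_Ex => w; rewrite pE mulrA.
have kg h : bmf h -> Ex P (fun w => cos (s w) * B w * h (V j w)) = complex.Re c * Ex P (fun w => h (V j w)) /\
    Ex P (fun w => sin (s w) * B w * h (V j w)) = complex.Im c * Ex P (fun w => h (V j w)).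
  move=> bh; rewrite (Ex_of_law (mV j) (fun A _ => QE A) bh).
  by split; apply: (Ex_mul_of_indic (mV j)) => // E mE; have [] := hE E mE.
have [bc bs] : bmf (fun x => cos (g j x)) /\ bmf (fun x => sin (g j x)).
  by split; [exact: bmf_cos|exact: bmf_sin].
have [k1 k2] := kg _ bc; have [k3 k4] := kg _ bs.
have bb (h : T -> R) (k : S -> R) : bmf h -> bmf k -> bmf (fun w => h w * k (V j w)).
  by move=> bh bk; apply: bmfM => //; exact: (bmf_comp_meas (mV j) bk).
rewrite big_setU1//= -mulrA -/c.
transitivity ((complex.Re c * Ex P (fun w => cos (g j (V j w))) - complex.Im c * Ex P (fun w => sin (g j (V j w)))) +i*
   (complex.Re c * Ex P (fun w => sin (g j (V j w))) + complex.Im c * Ex P (fun w => cos (g j (V j w))))).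
  rewrite -k1 -k2 -k3 -k4.
  rewrite -(ExB P (bb _ _ b1 bc) (bb _ _ b2 bs)) -(ExD P (bb _ _ b1 bs) (bb _ _ b2 bc)).
  congr (_ +i* _); apply: eq_Ex => w; rewrite big_setU1//= -/(s w) -/(B w).
    by rewrite cosD; ring.
  by rewrite sinD; ring.
apply/eqP; rewrite /cf eq_complex; case: (c) => a b /=.
by apply/andP; split; apply/eqP; ring.
Qed.

Theorem cf_indep_sum : cf P (fun w => \sum_(i < m) g i (V i w)) = \prod_(i < m) cf P (fun w => g i (V i w)).
Proof.
have all k : forall D : {set 'I_m}, #|D| = k -> mixed D.
  elim: k => [|k IH] D hD.
    move/eqP: hD; rewrite cards_eq0 => /eqP -> A mA.
    rewrite big_set0 mul1r.
    have e1 (F : 'I_m -> R) : \prod_(i | i \notin (finset.set0 : {set 'I_m})) F i = \prod_(i < m) F i.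
      by apply: eq_bigl => i; rewrite finset.in_set0.
    rewrite e1 -indV// -Ex_indic; last first.
      apply: fin_bigcap_measurable => [|i _]; first exact: finite_finset.
      by rewrite -[X in measurable X]setTI; exact: mV.
    congr (_ +i* _); last first.
      by rewrite -[RHS](Ex_prob_cst P); apply: eq_Ex => w; rewrite big_set0 sin0 mul0r.
    by apply: eq_Ex => w; rewrite big_set0 cos0 mul1r e1 prod_indic.
  have [j jD] : exists j, j \in D by apply/card_gt0P; rewrite hD.
  rewrite -(finset.setD1K jD); apply: mixed_step; first by rewrite finset.in_setD1 eqxx.
  by apply: IH; move: hD; rewrite (cardsD1 j) jD => -[].
have e2 (F : 'I_m -> R) : \prod_(i | i \notin (finset.setT : {set 'I_m})) F i = 1.
  by apply: big_pred0 => i; rewrite finset.in_setT.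
have := all _ (finset.setT : {set 'I_m}) erefl (fun=> setT) (fun=> measurableT).
rewrite e2 mulr1 /cf => e; transitivity (\prod_(i in (finset.setT : {set 'I_m})) cf P (fun w => g i (V i w))); last first.
  by apply: eq_bigl => i; rewrite finset.in_setT.
rewrite -e; have sE w : \sum_(i in (finset.setT : {set 'I_m})) g i (V i w) = \sum_(i < m) g i (V i w).
  by apply: eq_bigl => i; rewrite finset.in_setT.
by congr (_ +i* _); apply: eq_Ex => w; rewrite sE e2 mulr1.
Qed.

End independent_sum.

Section processes.
Variable R : realType.

Lemma measurable_fdvec d (T : measurableType d) (X : @process R T) n (t : n.-tuple R) :
  is_process X -> nonneg_times t -> measurable_fun setT (fdvec X t).
Proof.
move=> pX t0; apply/measurable_fun_tnthP => i; rewrite (_ : _ \o _ = X (tnth t i)); first exact: pX.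
by apply: funext => w /=; rewrite tnth_mktuple.
Qed.

Lemma cf_of_fdd d1 (T1 : measurableType d1) (P1 : probability T1 R) (X1 : @process R T1)
  d2 (T2 : measurableType d2) (P2 : probability T2 R) (X2 : @process R T2)
  n (t th : n.-tuple R) : is_process X1 -> is_process X2 -> fdd_eq P1 X1 P2 X2 -> nonneg_times t ->
  cf P1 (fun w => dot th (fdvec X1 t w)) = cf P2 (fun w => dot th (fdvec X2 t w)).
Proof.
move=> p1 p2 e t0; have m1 := measurable_fdvec p1 t0; have m2 := measurable_fdvec p2 t0.
have h A mA := e n t t0 A mA; rewrite /cf.
by rewrite (eq_law_Ex m1 m2 h (bmf_cosdot th)) (eq_law_Ex m1 m2 h (bmf_sindot th)).
Qed.

Lemma fdd_of_cf d1 (T1 : measurableType d1) (P1 : probability T1 R) (X1 : @process R T1)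
  d2 (T2 : measurableType d2) (P2 : probability T2 R) (X2 : @process R T2) :
  is_process X1 -> is_process X2 ->
  (forall n (t th : n.-tuple R), nonneg_times t ->
    cf P1 (fun w => dot th (fdvec X1 t w)) = cf P2 (fun w => dot th (fdvec X2 t w))) ->
  fdd_eq P1 X1 P2 X2.
Proof.
move=> p1 p2 e n t t0 A mA; apply: char_unique => // [||th]; [exact: measurable_fdvec..|].
by have /eqP := e n t th t0; rewrite eq_complex => /andP[/eqP ? /eqP ?].
Qed.

Lemma cf_indep_processes d (T : measurableType d) (P : probability T R) m (Xs : 'I_m -> @process R T)
  n (t th : n.-tuple R) : (forall i, is_process (Xs i)) -> indep_processes P Xs -> nonneg_times t ->
  cf P (fun w => dot th (fdvec (fun s w => \sum_(i < m) Xs i s w) t w)) =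
  \prod_(i < m) cf P (fun w => dot th (fdvec (Xs i) t w)).
Proof.
move=> pX iX t0.
rewrite -(@cf_indep_sum R _ _ P _ _ m (fun i => fdvec (Xs i) t) (fun=> dot th)).
- apply: eq_cf => w; rewrite /dot exchange_big /=; apply: eq_bigr => j _.
  by rewrite tnth_mktuple mulr_sumr; apply: eq_bigr => i _; rewrite tnth_mktuple.
- by move=> i; exact: measurable_fdvec.
- by move=> i; exact: measurable_dot.
- by move=> A mA; exact: (iX n t t0 A mA).
Qed.

Lemma prodP_rect d1 (T1 : measurableType d1) (P1 : probability T1 R)
  d2 (T2 : measurableType d2) (P2 : probability T2 R) (A : set T1) (B : set T2) :
  measurable A -> measurable B -> prodP P1 P2 (fst @^-1` A `&` snd @^-1` B) = (P1 A * P2 B)%E.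
Proof.
move=> mA mB; rewrite -(product_measure1E P1 P2 mA mB).
by congr (_ _); apply/seteqP; split => w.
Qed.

Lemma prodP_fst d1 (T1 : measurableType d1) (P1 : probability T1 R)
  d2 (T2 : measurableType d2) (P2 : probability T2 R) (A : set T1) :
  measurable A -> prodP P1 P2 (fst @^-1` A) = P1 A.
Proof.
move=> mA; have := prodP_rect P1 P2 mA measurableT.
by rewrite preimage_setT setIT probability_setT mule1.
Qed.

Lemma prodP_snd d1 (T1 : measurableType d1) (P1 : probability T1 R)
  d2 (T2 : measurableType d2) (P2 : probability T2 R) (B : set T2) :
  measurable B -> prodP P1 P2 (snd @^-1` B) = P2 B.
Proof.
move=> mB; have := prodP_rect P1 P2 measurableT mB.
by rewrite preimage_setT setTI probability_setT mul1e.
Qed.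

Lemma measurable_fdvec_preimage d (T : measurableType d) (X : @process R T) n (t : n.-tuple R)
  (A : set (n.-tuple R)) : is_process X -> nonneg_times t -> measurable A -> measurable (fdvec X t @^-1` A).
Proof.
by move=> pX t0 mA; rewrite -[X in measurable X]setTI; exact: (measurable_fdvec pX t0).
Qed.

(** Time-stability quantifies over all families of independent copies; it yields an identity for
    [xi] only once such a family is exhibited. Finite products suffice, adding one factor at a
    time. *)
Lemma iid_copies d (T : measurableType d) (P : probability T R) (X : @process R T) m :
  is_process X ->
  exists (d' : measure_display) (T' : measurableType d') (P' : probability T' R)
    (Xs : 'I_m -> @process R T'),
    [/\ forall i, is_process (Xs i), forall i, fdd_eq P' (Xs i) P X & indep_processes P' Xs].
Proof.
move=> pX; elim: m => [|m [d' [T' [P' [Xs [pXs eXs iXs]]]]]].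
  exists d, T, P, (fun=> X); split => [[]//|[]//|n t t0 A mA].
  rewrite big_ord0 (_ : \bigcap_(i in _) _ = setT) ?/Pr ?probability_setT//.
  by apply/seteqP; split => // w _ [].
pose Ys (i : 'I_m.+1) : @process R (T * T') := fun t w =>
  if unlift ord0 i is Some j then Xs j t w.2 else X t w.1.
have Y0 t : Ys ord0 t = fun w => X t w.1 by rewrite /Ys unlift_none.
have YS j t : Ys (lift ord0 j) t = fun w => Xs j t w.2 by rewrite /Ys liftK.
have f0 n (t : n.-tuple R) A : fdvec (Ys ord0) t @^-1` A = fst @^-1` (fdvec X t @^-1` A).
  have e : fdvec (Ys ord0) t = fdvec X t \o fst.
    by apply: funext => w; apply: eq_from_tnth => i; rewrite !tnth_mktuple Y0.
  by rewrite e.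
have fS j n (t : n.-tuple R) A : fdvec (Ys (lift ord0 j)) t @^-1` A = snd @^-1` (fdvec (Xs j) t @^-1` A).
  have e : fdvec (Ys (lift ord0 j)) t = fdvec (Xs j) t \o snd.
    by apply: funext => w; apply: eq_from_tnth => i; rewrite !tnth_mktuple YS.
  by rewrite e.
exists _, (T * T')%type, (prodP P P'), Ys; split.
- move=> i t t0; have [j ->|->] := unliftP ord0 i.
    by rewrite YS; apply: measurableT_comp => //; exact: pXs.
  by rewrite Y0; apply: measurableT_comp => //; exact: pX.
- move=> i n t t0 A mA; have [j ->|->] := unliftP ord0 i.
    by rewrite fS prodP_snd; [exact: eXs|exact: measurable_fdvec_preimage].
  by rewrite f0 prodP_fst//; exact: measurable_fdvec_preimage.
move=> n t t0 A mA; rewrite big_ord_recl f0.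
rewrite (_ : \bigcap_(i in _) _ = fst @^-1` (fdvec X t @^-1` A ord0) `&`
    snd @^-1` (\bigcap_(j in [set: 'I_m]) (fdvec (Xs j) t @^-1` A (lift ord0 j)))); last first.
  apply/seteqP; split => [w h|w [h1 h2] i _].
    split; first by rewrite -f0; exact: (h ord0).
    by move=> j _; have := h (lift ord0 j) Logic.I; rewrite fS.
  have [j ->|->] := unliftP ord0 i; first by rewrite fS; exact: (h2 j).
  by rewrite f0.
have mX0 := measurable_fdvec_preimage pX t0 (mA ord0).
have mXj j := measurable_fdvec_preimage (pXs j) t0 (mA (lift ord0 j)).
rewrite /Pr prodP_rect//; last by apply: fin_bigcap_measurable => [|j _]; [exact: finite_finset|exact: mXj].
rewrite fineM ?fin_num_measure//; last by apply: fin_bigcap_measurable => [|j _]; [exact: finite_finset|exact: mXj].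
rewrite prodP_fst//; congr (_ * _).
have := iXs n t t0 (fun j => A (lift ord0 j)) (fun j => mA _); rewrite /Pr => ->.
by apply: eq_bigr => j _; rewrite fS prodP_snd.
Qed.

End processes.

Section absolute_time.
Variables (R : realType) (d : measure_display) (T : measurableType d).
Variables (P : probability T R) (xi : @process R T).
Hypothesis stable : time_stable P xi.

(* Extends the process to all real times, so that no sign condition is carried
   along. *)
Definition abs_time : @process R T := fun t => xi `|t|.

Lemma measurable_abs_time t : measurable_fun setT (abs_time t).
Proof. by have [+ _] := stable; apply; rewrite normr_ge0. Qed.

Lemma abs_time_scX t eps delta : 0 < eps -> 0 < delta -> exists eta : R,
  0 < eta /\ forall s, `|s - t| < eta ->
    fine (P [set w | eps < `|abs_time s w - abs_time t w|]) < delta.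
Proof.
move=> e0 d0; have [_ [sc _]] := stable.
have [eta [eta0 h]] := sc _ (normr_ge0 t) _ e0 _ d0.
exists eta; split => // s st; apply: (h `|s| (normr_ge0 _)).
exact: le_lt_trans (ler_dist_dist _ _) st.
Qed.

Lemma phi_abs_time n (t th : n.-tuple R) : nonneg_times t ->
  phi P abs_time (zl th t) = cf P (fun w => dot th (fdvec xi t w)).
Proof.
move=> t0; apply: eq_cf => w; rewrite dot_fdvec !lin_zl; apply: eq_bigr => i _.
by rewrite /abs_time ger0_norm.
Qed.

Lemma is_process_tscale d' (T' : measurableType d') (X : @process R T') (c : R) :
  0 <= c -> is_process X -> is_process (tscale c X).
Proof. by move=> c0 pX t t0; apply: pX; exact: mulr_ge0. Qed.

Lemma is_process_sum d' (T' : measurableType d') m (Xs : 'I_m -> @process R T') :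
  (forall i, is_process (Xs i)) -> is_process (fun t w => \sum_(i < m) Xs i t w).
Proof.
move=> pX t t0; elim: (index_enum _) => [|i r IH].
  by under eq_fun do rewrite big_nil; exact: measurable_cst.
under eq_fun do rewrite big_cons; apply: measurable_funD => //; exact: pX.
Qed.

Lemma abs_time_tsX n l : (0 < n)%N ->
  phi P abs_time (scl n%:R 1 l) = phi P abs_time l ^+ n.
Proof.
(* The definition speaks of [n >= 2] only; the case [n = 1] is trivial. *)
case: n => // -[|n _]; first by rewrite scl11 expr1.
have [pxi [_ ts]] := stable; have [th [s <-]] := zl_list l.
pose t := [tuple `|tnth s i| | i < size l].
have t0 : nonneg_times t by move=> i; rewrite tnth_mktuple.
have [d' [T' [P' [Xs [pX eX iX]]]]] := iid_copies P n.+2 pxi.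
have e1 : phi P abs_time (zl th s) = cf P (fun w => dot th (fdvec xi t w)).
  by apply: eq_cf => w; rewrite dot_fdvec !lin_zl; apply: eq_bigr => i _; rewrite tnth_mktuple.
have e2 : phi P abs_time (scl n.+2%:R 1 (zl th s)) = cf P (fun w => dot th (fdvec (tscale n.+2%:R xi) t w)).
  apply: eq_cf => w; rewrite dot_fdvec lin_zl lin_scl_zl; apply: eq_bigr => i _.
  by rewrite tnth_mktuple mul1r /abs_time normrM /tscale (@ger0_norm _ n.+2%:R).
rewrite e2 -(cf_of_fdd th _ _ (ts n.+2 isT _ _ P' Xs pX eX iX) t0); last 2 first.
- exact: is_process_sum.
- exact: is_process_tscale.
rewrite cf_indep_processes// e1 (eq_bigr (fun=> cf P (fun w => dot th (fdvec xi t w)))).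
  by rewrite prodr_const card_ord.
by move=> i _; exact: cf_of_fdd.
Qed.

End absolute_time.

(** * Time-stability of the jump part *)

Section stable_jump_part.
Variables (R : realType) (d : measure_display) (T : measurableType d).
Variables (P : probability T R) (X : @process R T).
Hypothesis mX : forall t, measurable_fun setT (X t).
Hypothesis scX : forall t eps delta : R, 0 < eps -> 0 < delta -> exists eta : R,
  0 < eta /\ forall s, `|s - t| < eta ->
    fine (P [set w | eps < `|X s w - X t w|]) < delta.
Hypothesis tsX : forall n l, (0 < n)%N -> phi P X (scl n%:R 1 l) = phi P X l ^+ n.
Variables (U : set_system nat) (UU : UltraFilter U) (Uoo : \oo `<=` U).

Lemma psi_scl n l : (0 < n)%N -> psi P X (scl n%:R 1 l) = psi P X l ^+ n.
Proof.
move=> n0; rewrite /psi tsX// (Qf_hom mX scX tsX UU Uoo)// exprMn -rmorphXn -expRM_natl.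
by congr (_ * (expR _)%:C); rewrite mulrA.
Qed.

Lemma phi_increment_small t a e : 0 < a -> 0 < e -> exists eta : R, 0 < eta /\
  forall s th, `|s - t| < eta -> `|th| <= a ->
    cn (phi P X [:: (th, s); (- th, t)] - 1) <= e.
Proof.
move=> a0 e0; pose r := e / (2 * a); have r0 : 0 < r by rewrite divr_gt0// mulr_gt0.
have e4 : 0 < e / 4 by lra.
have [eta [eta0 h]] := scX t r0 e4; exists eta; split => // s th st tha.
pose S := [set w | r < `|X s w - X t w|].
have mS : measurable S.
  apply: (@measurable_gt_set _ _ _ (fun w => `|X s w - X t w|)).
  by apply: measurableT_comp => //; exact: measurable_funB.
have b1 : bmf (\1_S : T -> R) by exact: bmf_indic.
apply: le_trans (_ : Ex P (fun w => 2 * \1_S w + a * r) <= _); last first.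
  rewrite ExD; [|exact: bmfZ|exact: bmf_cst]; rewrite ExZ// Ex_indic// Ex_prob_cst.
  have -> : a * r = e / 2 by rewrite /r; field; rewrite gt_eqF.
  by have := h s st; rewrite -/S; lra.
have ar : 0 <= a * r by rewrite mulr_ge0 ?ltW.
have g0 w : 0 <= 2 * \1_S w + a * r by rewrite indicE addr_ge0// mulr_ge0.
rewrite -(cf0 P); apply: cf_sub_le => //.
- exact: measurable_lin.
- by apply: bmfD; [exact: bmfZ|exact: bmf_cst].
move=> w; rewrite lin_cons lin1 /=; set y := th * _ + _.
have yE : y = th * (X s w - X t w) by rewrite /y; ring.
have [h1|h1] := leP `|X s w - X t w| r.
  apply: le_trans (chord_le (lexx _)) _; rewrite ler_sqr ?nnegrE// subr0 yE normrM.
  apply: le_trans (_ : a * r <= _); first exact: ler_pM.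
  by rewrite lerDr indicE mulr_ge0.
apply: le_trans (chord_le2 _ _) _; rewrite ler_sqr ?nnegrE//.
by rewrite indicE mem_set//= mulr1 lerDl.
Qed.

(** For stochastic continuity, dividing out the Gaussian factor can only bring the real part of an
    increment's characteristic function closer to [1] from below; so the bound for the original
    process carries over and [tail_bound] applies. The stability identity is the homogeneity
    [psi_scl]. *)
Lemma time_stable_psi d' (T' : measurableType d') (P' : probability T' R) (Z : @process R T') :
  (forall t, measurable_fun setT (Z t)) -> (forall l, cf P' (lin l Z) = psi P X l) ->
  time_stable P' Z.
Proof.
move=> mZ ZE; have pZ : is_process Z by move=> t _; exact: mZ.
split => //; split.
  move=> t t0 eps e0 delta d0; have a0 : 0 < 4 / eps by rewrite divr_gt0.
  (* The bound [e <= 1] keeps the real part of [phi] nonnegative, so that multiplying it by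
     [exp (Qf / 2) >= 1] does not decrease it; [delta / 4] offsets the factor [2] of
     [tail_bound]. *)
  pose e := Num.min 1 (delta / 4).
  have e'0 : 0 < e by rewrite lt_min ltr01 divr_gt0.
  have [eta [eta0 h]] := phi_increment_small t a0 e'0; exists eta; split => // s _ st.
  have mY : measurable_fun setT (fun w => Z s w - Z t w) by exact: measurable_funB.
  have := @tail_bound _ _ _ P' (fun w => Z s w - Z t w) (4 / eps) e mY a0.
  have sub : [set w | eps < `|Z s w - Z t w|] `<=` [set w | 4 <= 4 / eps * `|Z s w - Z t w|].
    by move=> w /= hw; rewrite mulrAC ler_pdivlMr// ler_wpM2l// ltW.
  move=> tb; rewrite /Pr; apply: (@le_lt_trans _ _ (2 * e)); last first.
    by have : e <= delta / 4; [rewrite ge_min lexx orbT|lra].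
  have mabs : measurable_fun setT (fun w => `|Z s w - Z t w|) by exact: measurableT_comp.
  have m1 := measurable_gt_set mabs eps.
  have m2 : measurable [set w | 4 <= 4 / eps * `|Z s w - Z t w|].
    by apply: (@measurable_ge_set _ _ _ (fun w => 4 / eps * `|Z s w - Z t w|)); exact: measurable_funM.
  apply: le_trans (_ : _ <= fine (P' [set w | 4 <= 4 / eps * `|Z s w - Z t w|])) _.
    by apply: fine_le; rewrite ?fin_num_measure// le_measure ?inE.
  apply: tb => th tha; have := h s th st tha.
  have -> : Ex P' (fun w => cos (th * (Z s w - Z t w))) = complex.Re (psi P X [:: (th, s); (- th, t)]).
    by rewrite -ZE; apply: eq_Ex => w; rewrite lin_cons lin1 /=; congr cos; ring.
  have := Qf_ge0 mX scX tsX UU Uoo [:: (th, s); (- th, t)]; rewrite /psi.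
  move: (phi _ _ _) (Qf _ _ _) => [x y] q q0 hxy.
  have := le_trans (abs_Re_le _) hxy; rewrite /= mulr0 subr0 ler_norml => /andP[h1 _].
  have x0 : 0 <= x by have : e <= 1; [rewrite ge_min lexx|lra].
  have : x <= x * expR (q / 2) by rewrite ler_peMr// -expR0 ler_expR divr_ge0.
  lra.
move=> n n2 d2 T2 P2 Xs pX eX iX.
have n0 : (0 < n)%N by exact: ltnW.
apply: fdd_of_cf => [||k t th t0]; [exact: is_process_sum|exact: is_process_tscale|].
rewrite cf_indep_processes// (eq_bigr (fun=> psi P X (zl th t))); last first.
  move=> i _; rewrite (cf_of_fdd th (pX i) pZ (eX i) t0) -ZE.
  by apply: eq_cf => w; rewrite dot_fdvec.
rewrite prodr_const card_ord -psi_scl// -ZE; apply: eq_cf => w.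
rewrite dot_fdvec lin_zl lin_scl_zl; apply: eq_bigr => i _.
by rewrite mul1r.
Qed.

End stable_jump_part.

(** * The decomposition *)

Theorem theorem2p2 (R : realType) (d : measure_display) (T : measurableType d)
  (P : probability T R) (xi : @process R T) :
  time_stable P xi ->
  exists (b : R) (C : R -> R -> R)
         (d' : measure_display) (T' : measurableType d')
         (P' : probability T' R) (G Z : @process R T'),
    is_process G /\ is_process Z /\
    centred_gaussian P' G C /\
    (forall t s u : R, 0 <= t -> 0 <= s -> 0 <= u -> C (u * t) (u * s) = u * C t s) /\
    time_stable P' Z /\ no_gaussian_component P' Z /\
    indep2 P' G Z /\
    fdd_eq P xi P' (fun t w => b * t + G t w + Z t w).
Proof.
move=> stable; pose X := abs_time xi.
have mX t : measurable_fun setT (X t) := measurable_abs_time stable t.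
have scX := abs_time_scX stable; rewrite -/X in scX.
have tsX n l (n0 : (0 < n)%N) : phi P X (scl n%:R 1 l) = phi P X l ^+ n := abs_time_tsX stable l n0.
have [U [UU Uoo]] := @ultraFilterLemma nat \oo _.
have [rG GE] := realizable_gauss mX scX tsX UU Uoo.
have [rZ ZE] := realizable_psi mX scX tsX UU Uoo.
pose P' := prodP (r_prob rG) (r_prob rZ).
pose G : @process R (r_type rG * r_type rZ) := fun t w => r_proc rG t w.1.
pose Z : @process R (r_type rG * r_type rZ) := fun t w => r_proc rZ t w.2.
have mG t : measurable_fun setT (G t) by apply: measurableT_comp => //; exact: r_meas.
have mZ t : measurable_fun setT (Z t) by apply: measurableT_comp => //; exact: r_meas.
have mlG l := measurable_lin l (r_meas rG).
have mlZ l := measurable_lin l (r_meas rZ).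
have cG l : cf P' (lin l G) = (expR (- (Qf P X l / 2)))%:C.
  rewrite -GE /rcf -[RHS]mulr1 -(cf0 (r_prob rZ)) -cf_prod//.
  by apply: eq_cf => w; rewrite addr0.
have cZ l : cf P' (lin l Z) = psi P X l.
  rewrite -ZE /rcf -[RHS]mul1r -(cf0 (r_prob rG)) -cf_prod//.
  by apply: eq_cf => w; rewrite add0r.
(* The drift stays in [Z], whose triplets may have any first component, so the linear term is
   zero. *)
exists 0, (Ccov P X), _, (r_type rG * r_type rZ)%type, P', G, Z.
split; first by move=> t _.
split; first by move=> t _.
split.
  move=> n t t0 th q.
  have qE : q = Qf P X (zl th t) by exact: (Ccov_quad mX scX tsX UU Uoo).
  have /eqP := cG (zl th t); rewrite eq_complex -qE /= => /andP[/eqP h1 /eqP h2].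
  by split; [rewrite -h1 | rewrite -h2]; apply: eq_Ex => w; rewrite dot_fdvec.
split; first by move=> t s u _ _ u0; exact: (Ccov_hom mX scX tsX UU Uoo).
split; first exact: (time_stable_psi mX scX tsX UU Uoo mZ cZ).
split; first by move=> n t _; exact: (LK_triplet_psi mX scX tsX UU Uoo t cZ).
have pG : is_process (r_proc rG) by move=> t _; exact: r_meas.
have pZ : is_process (r_proc rZ) by move=> t _; exact: r_meas.
split.
  move=> n t t0 A B mA mB.
  have -> : fdvec G t @^-1` A = fst @^-1` (fdvec (r_proc rG) t @^-1` A) by [].
  have -> : fdvec Z t @^-1` B = snd @^-1` (fdvec (r_proc rZ) t @^-1` B) by [].
  have mA' := measurable_fdvec_preimage pG t0 mA; have mB' := measurable_fdvec_preimage pZ t0 mB.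
  by rewrite /Pr prodP_rect// prodP_fst// prodP_snd// fineM// fin_num_measure.
have pxi : is_process xi := stable.1.
apply: fdd_of_cf => //.
  by move=> t _; apply: measurable_funD => //; apply: measurable_funD.
move=> n t th t0; rewrite -(phi_abs_time _ _ th t0) -/X.
(* Independence turns the sum into a product of characteristic functions, in which [exp (- Qf / 2)]
   cancels the factor built into [psi]. *)
transitivity (cf P' (fun w => lin (zl th t) (r_proc rG) w.1 + lin (zl th t) (r_proc rZ) w.2)).
  rewrite cf_prod// -/(rcf rG _) -/(rcf rZ _) GE ZE /psi mulrCA -rmorphM /= -expRD addNr expR0.
  by rewrite rmorph1 mulr1.
apply: eq_cf => w; rewrite dot_fdvec !lin_zl -big_split; apply: eq_bigr => i _ /=.
by rewrite mul0r add0r mulrDr.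
Qed.
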